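(* There exists a universal constant $c_0>0$ such that the following holds. Let $n\ge1$. For $1\le j\le n$ let $(K_j,a_j,b_j,\theta_j,\gamma_j)\in\mathbb{R}_+^*\times\mathbb{R}\times\mathbb{R}\times\mathbb{R}\times\mathbb{C}$ and let $(\lambda_j,\mu_j,\alpha_j)\in\mathbb{R}\times\mathbb{R}\times\mathbb{C}^*$ be given by $$\lambda_j=\frac{K_j^2}{32\pi}\big(7+2\sqrt3\,\mathrm{Im}(\gamma_je^{-i\theta_j})\big),\quad \mu_j=\frac{K_j^2}{32\pi}\big(-7+2\sqrt3\,\mathrm{Im}(\gamma_je^{-i\theta_j})\big),\quad \alpha_j=\frac{\sqrt3}{32\pi}K_j^2e^{-i\theta_j}.$$ Assume that $\alpha_j\ne\alpha_\ell$ for $j\neq\ell$, and set $$\delta=\frac{\max_{1\le j\le n}K_j^2}{\min_{1\le j\le n}K_j^2}=\frac{\max_{1\le j\le n}|\alpha_j|}{\min_{1\le j\le n}|\alpha_j|}.$$ Let $$U_j=K_je^{ia_j}\Big(\tfrac12\varphi_0^{\gamma_j}+\tfrac{\sqrt3}{2}ie^{i\theta_j}\varphi_1^{\gamma_j}\Big),\qquad V_j=K_je^{ib_j}\Big(\tfrac12\varphi_0^{\gamma_j}-\tfrac{\sqrt3}{2}ie^{i\theta_j}\varphi_1^{\gamma_j}\Big).$$ If $\kappa>c_0\delta$ and if $(\widetilde u,\widetilde v)\in\mathcal{C}(\mathbb{R},\mathcal{X}^\kappa_{\mathcal E}\times\mathcal{X}^\kappa_{\mathcal E})$ is a solution of the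 coupled LLL system $i\partial_tu=\Pi(|v|^2u)$, $i\partial_tv=-\Pi(|u|^2v)$ of the form $$\widetilde u(t,z)=\sum_{j=1}^ne^{-i\lambda_jt}U_j(z+\alpha_jt)e^{\frac12(\overline z\alpha_j-z\overline{\alpha_j})t}+\widetilde r_1(t,z),$$ $$\widetilde v(t,z)=\sum_{j=1}^ne^{-i\mu_jt}V_j(z+\alpha_jt)e^{\frac12(\overline z\alpha_j-z\overline{\alpha_j})t}+\widetilde r_2(t,z),$$ where $$\big\|e^{\kappa|z|}\widetilde r_1(t)\big\|_{L^2(\mathbb{C})}+\big\|e^{\kappa|z|}\widetilde r_2(t)\big\|_{L^2(\mathbb{C})}\longrightarrow0\quad\text{as }t\to+\infty,$$ then $(\widetilde u,\widetilde v)\equiv(u,v)$, where $(u,v)$ is the Gaussian-rate multi-soliton with the same parameters and the same $\kappa$ (defined in the context).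
   Context: $\mathcal{E}=\{u(z)=e^{-|z|^2/2}f(z):\ f\text{ entire holomorphic}\}\cap L^2(\mathbb{C})$ is the Bargmann-Fock space, and $\Pi$ is the orthogonal projection onto $\mathcal{E}$, given by $[\Pi u](z)=\frac1\pi e^{-|z|^2/2}\int_{\mathbb{C}}e^{\overline wz-|w|^2/2}u(w)\,dL(w)$, with $L$ Lebesgue measure on $\mathbb{C}$. For $\kappa\ge0$, $\mathcal{X}^\kappa_{\mathcal E}=\{u\in\mathscr{S}'(\mathbb{C}):\ e^{\kappa|z|}u\in L^2(\mathbb{C})\}\cap\mathcal{E}$, with norm $\|e^{\kappa|z|}u\|_{L^2(\mathbb{C})}$. For $\gamma\in\mathbb{C}$ and $n\in\mathbb{N}$, $\varphi_n^\gamma(z)=\frac{1}{\sqrt{\pi n!}}(z-\overline\gamma)^ne^{-\frac{|z|^2}{2}-\frac{|\gamma|^2}{2}+\gamma z}$. Gaussian-rate multi-soliton: let $n\ge1$ and, for $1\le j\le n$, let $(K_j,a_j,b_j,\theta_j,\gamma_j)\in\mathbb{R}_+^*\times\mathbb{R}\times\mathbb{R}\times\mathbb{R}\times\mathbb{C}$, with $\lambda_j=\frac{K_j^2}{32\pi}\big(7+2\sqrt3\,\mathrm{Im}(\gamma_je^{-i\theta_j})\big)$, $\mu_j=\frac{K_j^2}{32\pi}\big(-7+2\sqrt3\,\mathrm{Im}(\gamma_je^{-i\theta_j})\big)$, $\alpha_j=\frac{\sqrt3}{32\pi}K_j^2e^{-i\theta_j}$, where $\alpha_j\ne\alpha_\ell$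 for $j\ne\ell$, and let $U_j=K_je^{ia_j}\big(\tfrac12\varphi_0^{\gamma_j}+\tfrac{\sqrt3}{2}ie^{i\theta_j}\varphi_1^{\gamma_j}\big)$, $V_j=K_je^{ib_j}\big(\tfrac12\varphi_0^{\gamma_j}-\tfrac{\sqrt3}{2}ie^{i\theta_j}\varphi_1^{\gamma_j}\big)$. For these parameters and any $\kappa>0$, it is known (an existence theorem) that there exists a solution $(u,v)\in\mathcal{C}^\infty(\mathbb{R},\mathcal{X}^\kappa_{\mathcal E}\times\mathcal{X}^\kappa_{\mathcal E})$ of the system $i\partial_tu=\Pi(|v|^2u)$, $i\partial_tv=-\Pi(|u|^2v)$ of the form $u(t,z)=\sum_{j=1}^ne^{-i\lambda_jt}U_j(z+\alpha_jt)e^{\frac12(\overline z\alpha_j-z\overline{\alpha_j})t}+r_1(t,z)$, $v(t,z)=\sum_{j=1}^ne^{-i\mu_jt}V_j(z+\alpha_jt)e^{\frac12(\overline z\alpha_j-z\overline{\alpha_j})t}+r_2(t,z)$, such that for all $c<\frac14$ and all $m\in\mathbb{N}$ there is $C_{m,\kappa}>0$ with $\|e^{\kappa|z|}(\partial_t^mr_1)(t)\|_{L^2}+\|e^{\kappa|z|}(\partial_t^mr_2)(t)\|_{L^2}\le C_{m,\kappa}e^{-c\alpha_\sharp^2t^2}$ for all $t\ge0$, where $\alpha_\sharp=\min_{j\ne\ell}|\alpha_j-\alpha_\ell|$ (read as $+\infty$ when $n=1$). In the claim, $(u,v)$ is such a solution. *)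

(* Defs.v *)
From HB Require Import structures.
From mathcomp Require Import all_boot all_order all_algebra.
From mathcomp Require Import complex.
From mathcomp Require Import all_classical all_reals all_analysis.

Set Implicit Arguments.
Unset Strict Implicit.
Unset Printing Implicit Defensive.

Import Order.TTheory GRing.Theory Num.Theory numFieldNormedType.Exports.

Local Open Scope classical_set_scope.
Local Open Scope complex_scope.
Local Open Scope ring_scope.

Local Notation Re := complex.Re.
Local Notation Im := complex.Im.

Section Complex.
Variable R : realType.
Implicit Types (z w : R[i]) (f : R[i] -> R[i]).

(* The norm of the numFieldType R[i] takes values in R[i]; [cabs] is the modulus
   as an element of R. *)
Definition cabs z : R := ComplexField.Normc.normc z.

Definition cexp z : R[i] :=
  (expR (Re z) * cos (Im z)) +i* (expR (Re z) * sin (Im z)).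

(* Lebesgue measure of C, carried by pairs (real part, imaginary part). *)
Local Notation RxR := (measurableTypeR R * measurableTypeR R)%type.

Definition lebC : {measure set RxR -> \bar R} :=
  (@lebesgue_measure R \x @lebesgue_measure R)%E.

Definition toC (p : RxR) : R[i] := (p.1 : R) +i* (p.2 : R).

Definition measurableC f : Prop :=
  measurable_fun setT (fun p => Re (f (toC p)) : measurableTypeR R) /\
  measurable_fun setT (fun p => Im (f (toC p)) : measurableTypeR R).

Definition integralC f : R[i] :=
  (\int[lebC]_p Re (f (toC p))) +i* (\int[lebC]_p Im (f (toC p))).

Definition normL2 f : \bar R :=
  'N[lebC]_2%:E[EFin \o cabs \o f \o toC]%E.

Definition inL2 f : Prop := measurableC f /\ (normL2 f < +oo)%E.

(* [derivable] is taken over the field R[i], so this is complex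
   differentiability at every point. *)
Definition entire f : Prop := forall z, derivable (f : R[i]^o -> R[i]^o) z 1.

(* The projection acts on functions; on L^2 it does not depend on the
   representative. *)
Definition fock_proj f : R[i] -> R[i] := fun z =>
  (pi^-1)%:C * cexp (- (cabs z ^+ 2 / 2)%:C) *
  integralC (fun w =>
    cexp (conjc w * z - (cabs w ^+ 2 / 2)%:C) * f w).

(* An element of the Bargmann-Fock space is identified with its unique
   continuous representative. *)
Definition fock f : Prop :=
  (exists2 g, entire g &
     forall z, f z = cexp (- (cabs z ^+ 2 / 2)%:C) * g z) /\
  inL2 f.

Definition expweight (kappa : R) f : R[i] -> R[i] := fun z =>
  (expR (kappa * cabs z))%:C * f z.

(* Being a tempered distribution is implied by membership in L^2. *)
Definition Xspace (kappa : R) f : Prop := fock f /\ inL2 (expweight kappa f).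

Definition normX (kappa : R) f : \bar R := normL2 (expweight kappa f).

Definition phi (n : nat) (gamma : R[i]) : R[i] -> R[i] := fun z =>
  ((Num.sqrt (pi * n`!%:R))^-1)%:C * (z - conjc gamma) ^+ n *
  cexp (- (cabs z ^+ 2 / 2)%:C - (cabs gamma ^+ 2 / 2)%:C + gamma * z).

End Complex.

Section Evolution.
Variable R : realType.
Implicit Types (u v : R -> R[i] -> R[i]) (kappa : R).

Definition time_derivable u (t : R) (z : R[i]) : Prop :=
  derivable (fun s : R => Re (u s z)) t 1 /\
  derivable (fun s : R => Im (u s z)) t 1.

Definition dt u : R -> R[i] -> R[i] := fun t z =>
  derive1 (fun s : R => Re (u s z)) t +i* derive1 (fun s : R => Im (u s z)) t.

Definition dtn (m : nat) u : R -> R[i] -> R[i] := iter m dt u.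

(* Time derivatives are taken pointwise in z. Point evaluations are continuous
   on X^kappa and the right-hand sides are continuous in time with values in
   X^kappa, so for curves continuous in X^kappa this amounts to the equation
   holding in X^kappa. *)
Definition LLL_solution u v : Prop := forall t z,
  [/\ time_derivable u t z, time_derivable v t z,
      'i%C * dt u t z = fock_proj (fun w => (cabs (v t w) ^+ 2)%:C * u t w) z &
      'i%C * dt v t z = - fock_proj (fun w => (cabs (u t w) ^+ 2)%:C * v t w) z].

Definition Xcontinuous kappa u : Prop :=
  (forall t, Xspace kappa (u t)) /\
  (forall t : R, normX kappa (fun z => u s z - u t z) @[s --> t] --> 0%E).

(* Norm convergence of difference quotients in X^kappa forces pointwise
   convergence, so that the derivative in X^kappa can only be [dt u]. *)
Definition Xdifferentiable kappa u : Prop := forall t : R,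
  normX kappa (fun z => (h^-1)%:C * (u (t + h) z - u t z) - dt u t z)
    @[h --> 0^'] --> 0%E.

Definition Xsmooth kappa u : Prop := forall m : nat,
  Xcontinuous kappa (dtn m u) /\ Xdifferentiable kappa (dtn m u).

End Evolution.

Section MultiSoliton.
Variables (R : realType) (n : nat).
Variables (K a b theta : 'I_n -> R) (gamma : 'I_n -> R[i]).

Definition expi (x : R) : R[i] := cexp ('i%C * x%:C).

Definition lambda (j : 'I_n) : R :=
  K j ^+ 2 / (32 * pi) *
  (7 + 2 * Num.sqrt 3 * Im (gamma j * expi (- theta j))).

Definition mu (j : 'I_n) : R :=
  K j ^+ 2 / (32 * pi) *
  (- 7 + 2 * Num.sqrt 3 * Im (gamma j * expi (- theta j))).

Definition alpha (j : 'I_n) : R[i] :=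
  (Num.sqrt 3 / (32 * pi) * K j ^+ 2)%:C * expi (- theta j).

Definition profileU (j : 'I_n) : R[i] -> R[i] := fun z =>
  (K j)%:C * expi (a j) *
  ((1 / 2)%:C * phi 0 (gamma j) z +
   (Num.sqrt 3 / 2)%:C * 'i%C * expi (theta j) * phi 1 (gamma j) z).

Definition profileV (j : 'I_n) : R[i] -> R[i] := fun z =>
  (K j)%:C * expi (b j) *
  ((1 / 2)%:C * phi 0 (gamma j) z -
   (Num.sqrt 3 / 2)%:C * 'i%C * expi (theta j) * phi 1 (gamma j) z).

Definition soliton_sum (omega : 'I_n -> R) (W : 'I_n -> R[i] -> R[i]) :
    R -> R[i] -> R[i] := fun t z =>
  \sum_(j < n) expi (- (omega j * t)) * W j (z + alpha j * t%:C) *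
    cexp ((1 / 2)%:C * (conjc z * alpha j - z * conjc (alpha j)) * t%:C).

Definition has_remainders (u v r1 r2 : R -> R[i] -> R[i]) : Prop :=
  forall t z, u t z = soliton_sum lambda profileU t z + r1 t z /\
              v t z = soliton_sum mu profileV t z + r2 t z.

(* max_j K_j^2 / min_j K_j^2, for n >= 1. *)
Definition delta : R :=
  sup [set K j ^+ 2 | j in [set: 'I_n]] / inf [set K j ^+ 2 | j in [set: 'I_n]].

(* Equal to +oo when n = 1. *)
Definition alpha_sharp : \bar R :=
  ereal_inf [set (cabs (alpha jl.1 - alpha jl.2))%:E |
             jl in [set jl : 'I_n * 'I_n | jl.1 != jl.2]].

(* When alpha_sharp = +oo, the bound is 0 for c > 0 and t > 0. *)
Definition gaussian_multisoliton (kappa : R) (u v : R -> R[i] -> R[i]) : Prop :=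
  [/\ Xsmooth kappa u, Xsmooth kappa v, LLL_solution u v &
    exists r1 r2, has_remainders u v r1 r2 /\
      forall (c : R) (m : nat), c < 1 / 4 ->
        exists2 C : R, 0 < C & forall t : R, 0 <= t ->
          (normX kappa (dtn m r1 t) + normX kappa (dtn m r2 t) <=
           C%:E * expeR (- (c%:E * alpha_sharp ^+ 2 * (t ^+ 2)%:E)))%E].

End MultiSoliton.

Section Delta.
Variables (R : realType) (n : nat).

Lemma cabs_alpha (K th : 'I_n -> R) j :
  cabs (alpha K th j) = Num.sqrt 3 / (32 * pi) * K j ^+ 2.
Proof.
have pos : 0 <= Num.sqrt 3 / (32 * pi) * K j ^+ 2 :> R.
  by rewrite mulr_ge0 ?sqr_ge0 // divr_ge0 // mulr_ge0 // pi_ge0.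
rewrite /cabs /alpha ComplexField.Normc.normcM /expi /cexp /=.
rewrite !(mul0r, mulr0, mul1r, mulr1, add0r, subr0, oppr0, expR0) /= expr0n /=.
by rewrite !addr0 ?mul1r cos2Dsin2 sqrtr1 mulr1 sqrtr_sqr ger0_norm.
Qed.

Lemma sup_scale (c : R) (f : 'I_n -> R) : (0 < n)%N -> 0 < c ->
  sup [set c * f j | j in [set: 'I_n]] = c * sup [set f j | j in [set: 'I_n]].
Proof.
move=> n0 c0.
have ub (g : 'I_n -> R) : has_ubound [set g j | j in [set: 'I_n]].
  exists (\sum_j `|g j|) => _ [j _ <-]; rewrite (bigD1 j) //=.
  by rewrite (le_trans (ler_norm _)) // lerDl sumr_ge0.
have ne (g : 'I_n -> R) : [set g j | j in [set: 'I_n]] !=set0.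
  by exists (g (Ordinal n0)); exists (Ordinal n0).
apply/eqP; rewrite eq_le; apply/andP; split.
  apply: ge_sup => // _ [j _ <-]; rewrite ler_pM2l //.
  by apply: ub_le_sup => //; exists j.
rewrite mulrC -ler_pdivlMr //; apply: ge_sup => // _ [j _ <-].
by rewrite ler_pdivlMr // mulrC; apply: ub_le_sup => //; exists j.
Qed.

(* The second expression for delta, as a quotient of extremal moduli |alpha_j|. *)
Lemma delta_alpha (K th : 'I_n -> R) : (0 < n)%N ->
  delta K = sup [set cabs (alpha K th j) | j in [set: 'I_n]] /
            inf [set cabs (alpha K th j) | j in [set: 'I_n]].
Proof.
move=> n0; have c0 : 0 < Num.sqrt 3 / (32 * pi) :> R.
  by rewrite divr_gt0 ?sqrtr_gt0 // mulr_gt0 // pi_gt0.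
have infE (g : 'I_n -> R) : inf [set g j | j in [set: 'I_n]] =
    - sup [set - g j | j in [set: 'I_n]] by rewrite /inf image_comp.
have E : (fun j => cabs (alpha K th j)) =
    (fun j => Num.sqrt 3 / (32 * pi) * K j ^+ 2).
  by apply/funext => j; exact: cabs_alpha.
have infM (c : R) (g : 'I_n -> R) : 0 < c ->
    inf [set c * g j | j in [set: 'I_n]] = c * inf [set g j | j in [set: 'I_n]].
  move=> c_gt0; rewrite !infE.
  have -> : (fun j => - (c * g j)) = (fun j => c * - g j).
    by apply/funext => j; rewrite mulrN.
  by rewrite sup_scale // mulrN.
by rewrite E /delta sup_scale // infM // -mulf_div divff ?mul1r // gt_eqF.
Qed.

End Delta.

(* Main.v *)
(* Let w1 = u' - u, w2 = v' - v and Y = (|w1|^2 + |w2|^2) / 2 integrated over C. Since Pi is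
   symmetric and fixes w1 and w2, the terms of Y' in which |v|^2 multiplies |w1|^2, or |u|^2
   multiplies |w2|^2, are real multiples of i and drop out. What is left is
     |Y'| <= int |w1| |w2| ((|v'| + |v|) |u| + (|u'| + |u|) |v|).
   The mean value property turns the weighted L^2 bounds into pointwise ones. For large t the
   solitons are far apart, so the bracket is at most L = 36 e^4 max K_j^2 and |Y'| <= L Y.
   Moreover u and v are of size exp(-kappa |alpha_j| t) where exp(-kappa |z|), a bound for w1
   and w2, is of order one, because the solitons travel at speeds |alpha_j|, and the Gaussian
   rate of the remainders of (u, v) is faster than that. Hence Y' = O(exp(-beta t)) with
   beta = kappa min |alpha_j|, so Y = O(exp(-beta t)) as Y tends to 0. If beta > L, which is
   the condition on kappa / delta, backward Gronwall gives Y = 0 for large t, and then for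
   every t. *)

(* Entire functions are given only as complex differentiable at each point. What is needed of them
   comes from one identity: the derivative in conj(z) of [(g(z) - g(z0)) / (z - z0) h(|z - z0|^2)]
   is [(g(z) - g(z0)) h'(|z - z0|^2)], so Green's formula on squares bounds the integral of the
   latter by boundary values. A compactly supported h yields the local mean value bound, and h(s) =
   exp(-s) yields Pi f = f. The constant must not depend on the number of solitons: once they are
   separated, at most one is near a given point and the others together contribute at most one unit.
   Each component is then at most 3m with m = e^2 max K_j, whence L = 4 (3m)^2; as |alpha_j| = sqrt
   3 K_j^2 / (32 pi), beta > L reads kappa > 36 e^4 (32 pi / sqrt 3) delta. The product w1 w2
   carries the weight exp(-kappa |z|) twice: one copy is spent on the smallness of u and v, the
   other keeps the integral over C finite. Time derivatives are pointwise in z; continuity in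
   X^kappa makes the spatial decay locally uniform in time, which allows differentiation of Y under
   the integral. *)
Require Import Defs.
From HB Require Import structures.
From mathcomp Require Import all_boot all_order all_algebra.
From mathcomp Require Import complex.
From mathcomp Require Import all_classical all_reals all_analysis.
From mathcomp Require Import measurable_realfun ring lra.

Set Implicit Arguments.
Unset Strict Implicit.
Unset Printing Implicit Defensive.

Import Order.TTheory GRing.Theory Num.Theory numFieldNormedType.Exports.

Local Open Scope classical_set_scope.
Local Open Scope complex_scope.
Local Open Scope ring_scope.
Local Notation Re := complex.Re.
Local Notation Im := complex.Im.
Local Notation measurableC := Defs.measurableC.

Arguments cabs : simpl never.
Arguments cexp : simpl never.

(** * The complex exponential and Wirtinger derivatives *)

Section Cabs.
Variable R : realType.
Implicit Types (z w : R[i]).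

Lemma cabsE z : cabs z = Num.sqrt (Re z ^+ 2 + Im z ^+ 2).
Proof. by case: z. Qed.
Lemma normcC z : `|z| = (cabs z)%:C.
Proof. by rewrite cabsE normc_def. Qed.
Lemma cabs_ge0 z : 0 <= cabs z.
Proof. by rewrite cabsE sqrtr_ge0. Qed.
Lemma cabsM z w : cabs (z * w) = cabs z * cabs w.
Proof. exact: ComplexField.Normc.normcM. Qed.
Lemma cabsV z : cabs z^-1 = (cabs z)^-1.
Proof. exact: ComplexField.Normc.normcV. Qed.
Lemma cabs0 : cabs 0 = 0 :> R.
Proof. by rewrite cabsE /= expr0n addr0 sqrtr0. Qed.
Lemma cabs1 : cabs 1 = 1 :> R.
Proof. by rewrite cabsE /= expr0n addr0 expr1n sqrtr1. Qed.
Lemma cabsN z : cabs (- z) = cabs z.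
Proof. by rewrite !cabsE; case: z => a b /=; rewrite !sqrrN. Qed.
Lemma cabsB z w : cabs (z - w) = cabs (w - z).
Proof. by rewrite -cabsN opprB. Qed.
Lemma cabsD z w : cabs (z + w) <= cabs z + cabs w.
Proof.
by rewrite -lecR rmorphD -!normcC ler_normD.
Qed.
Lemma cabsBD z w : cabs (z - w) <= cabs z + cabs w.
Proof. by rewrite -(cabsN w) cabsD. Qed.
Lemma cabs_conj z : cabs (conjc z) = cabs z.
Proof. by rewrite !cabsE; case: z => a b /=; rewrite sqrrN. Qed.
Lemma cabsR (x : R) : cabs x%:C = `|x|.
Proof. by rewrite cabsE /= expr0n addr0 sqrtr_sqr. Qed.
Lemma cabsi : cabs 'i%C = 1 :> R.
Proof. by rewrite cabsE /= expr0n add0r expr1n sqrtr1. Qed.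
Lemma cabs_sqr z : cabs z ^+ 2 = Re z ^+ 2 + Im z ^+ 2.
Proof. by rewrite cabsE sqr_sqrtr // addr_ge0 ?sqr_ge0. Qed.
Lemma cabs_sqrC z : (cabs z ^+ 2)%:C = z * conjc z.
Proof.
rewrite cabs_sqr; case: z => a b /=; apply/eqP.
by rewrite eq_complex /=; apply/andP; split; apply/eqP; ring.
Qed.
Lemma Re_le_cabs z : `|Re z| <= cabs z.
Proof.
by rewrite -(@ler_pXn2r _ 2) ?nnegrE ?cabs_ge0 // cabs_sqr real_normK ?num_real // lerDl sqr_ge0.
Qed.
Lemma Im_le_cabs z : `|Im z| <= cabs z.
Proof.
by rewrite -(@ler_pXn2r _ 2) ?nnegrE ?cabs_ge0 // cabs_sqr real_normK ?num_real // lerDr sqr_ge0.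
Qed.
Lemma cabs_le z : cabs z <= `|Re z| + `|Im z|.
Proof.
rewrite -(@ler_pXn2r _ 2) ?nnegrE ?cabs_ge0 ?addr_ge0 // cabs_sqr sqrrD.
rewrite !real_normK ?num_real // lerD2r lerDl mulrn_wge0 // mulr_ge0 //.
Qed.
Lemma cabs_eq0 z : cabs z = 0 -> z = 0.
Proof. exact: ComplexField.Normc.eq0_normc. Qed.
Lemma cabs_gt0 z : z != 0 -> 0 < cabs z.
Proof.
move=> z0; rewrite lt_neqAle cabs_ge0 andbT eq_sym; apply: contra z0 => /eqP h.
by rewrite (cabs_eq0 h).
Qed.
Lemma cabs_tri z w : `|cabs z - cabs w| <= cabs (z - w).
Proof.
rewrite ler_norml; apply/andP; split.
  rewrite lerBrDr -lerBrDl opprK; have := cabsD (w - z) z; rewrite subrK.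
  by rewrite cabsB addrC.
by have := cabsD (z - w) w; rewrite subrK lerBlDr.
Qed.

Lemma Re_add z w : Re (z + w) = Re z + Re w. Proof. by case: z w => a b [c d]. Qed.
Lemma Im_add z w : Im (z + w) = Im z + Im w. Proof. by case: z w => a b [c d]. Qed.
Lemma Re_opp z : Re (- z) = - Re z. Proof. by case: z. Qed.
Lemma Im_opp z : Im (- z) = - Im z. Proof. by case: z. Qed.
Lemma Re_mul z w : Re (z * w) = Re z * Re w - Im z * Im w.
Proof. by case: z w => a b [c d]. Qed.
Lemma Im_mul z w : Im (z * w) = Re z * Im w + Im z * Re w.
Proof. by case: z w => a b [c d]. Qed.
Lemma Re_cc z : Re (conjc z) = Re z. Proof. by case: z. Qed.
Lemma Im_cc z : Im (conjc z) = - Im z. Proof. by case: z. Qed.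

Lemma cexpD z w : cexp (z + w) = cexp z * cexp w.
Proof.
case: z w => a b [c d]; rewrite /cexp /= expRD cosD sinD; apply/eqP.
by rewrite eq_complex /=; apply/andP; split; apply/eqP; ring.
Qed.
Lemma cexp0 : cexp 0 = 1 :> R[i].
Proof. by rewrite /cexp /= expR0 cos0 sin0 mulr1 mulr0. Qed.
Lemma cabs_cexp z : cabs (cexp z) = expR (Re z).
Proof.
by rewrite cabsE /cexp /= !exprMn -mulrDr cos2Dsin2 mulr1 sqrtr_sqr ger0_norm // expR_ge0.
Qed.
Lemma cexpR (x : R) : cexp x%:C = (expR x)%:C.
Proof. by rewrite /cexp /= cos0 sin0 mulr1 mulr0. Qed.
Lemma cexp_conj z : cexp (conjc z) = conjc (cexp z).
Proof. by case: z => a b; rewrite /cexp /= cosN sinN mulrN. Qed.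
Lemma conjcM z w : conjc (z * w) = conjc z * conjc w.
Proof. exact: rmorphM. Qed.
Lemma Re_conjM z w : Re (conjc z * w) = Re z * Re w + Im z * Im w.
Proof. by case: z w => a b [c d] /=; ring. Qed.
End Cabs.

Section Wirtinger.
Variable R : realType.
Local Notation C := R[i].

(* Real differentiability at z0, with A and D the values at z0 of the
   Wirtinger derivatives d/dz and d/dconj(z) *)
Definition wirt (F : C -> C) (z0 A D : C) : Prop :=
  forall e : R, 0 < e -> exists2 d : R, 0 < d & forall z,
    cabs (z - z0) < d ->
    cabs (F z - F z0 - A * (z - z0) - D * conjc (z - z0)) <= e * cabs (z - z0).

Lemma wirt_lip F z0 A D : wirt F z0 A D -> exists2 d : R, 0 < d &
  forall z, cabs (z - z0) < d ->
    cabs (F z - F z0) <= (cabs A + cabs D + 1) * cabs (z - z0).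
Proof.
move=> /(_ 1 ltr01)[d d0 H]; exists d => // z /H {}H.
have -> : F z - F z0 = (F z - F z0 - A * (z - z0) - D * conjc (z - z0)) +
   (A * (z - z0) + D * conjc (z - z0)) by ring.
apply: (le_trans (cabsD _ _)); rewrite mul1r in H.
have := cabsD (A * (z - z0)) (D * conjc (z - z0)).
rewrite !cabsM cabs_conj; lra.
Qed.

Lemma wirt_cst c z0 : wirt (fun _ => c) z0 0 0.
Proof.
move=> e e0; exists 1 => // z _; rewrite subrr !mul0r !subr0 cabs0.
by rewrite mulr_ge0 ?cabs_ge0 // ltW.
Qed.
Lemma wirt_id z0 : wirt id z0 1 0.
Proof.
move=> e e0; exists 1 => // z _; rewrite mul1r mul0r subrr subr0 cabs0.
by rewrite mulr_ge0 ?cabs_ge0 // ltW.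
Qed.
Lemma wirt_conj z0 : wirt conjc z0 0 1.
Proof.
move=> e e0; exists 1 => // z _; rewrite mul1r mul0r subr0 rmorphB subrr cabs0.
by rewrite mulr_ge0 ?cabs_ge0 // ltW.
Qed.

Lemma wirtD F G z0 A D A' D' : wirt F z0 A D -> wirt G z0 A' D' ->
  wirt (fun z => F z + G z) z0 (A + A') (D + D').
Proof.
move=> HF HG e e0; have e2 : 0 < e / 2 by lra.
have [d d0 {}HF] := HF _ e2; have [d' d'0 {}HG] := HG _ e2.
exists (Num.min d d'); first by rewrite lt_min d0.
move=> z; rewrite lt_min => /andP[/HF {}HF /HG {}HG].
set p := (X in cabs X <= _) in HF; set q := (X in cabs X <= _) in HG.
have -> : F z + G z - (F z0 + G z0) - (A + A') * (z - z0) -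
   (D + D') * (z - z0)^* = p + q by rewrite /p /q; ring.
by have := cabsD p q; lra.
Qed.

Lemma wirtZ F z0 A D c : wirt F z0 A D -> wirt (fun z => c * F z) z0 (c * A) (c * D).
Proof.
move=> HF e e0; have c1 : 0 < cabs c + 1 by have := cabs_ge0 c; lra.
have [d d0 {}HF] := HF (e / (cabs c + 1)) (divr_gt0 e0 c1).
exists d => // z /HF {}HF.
have -> : c * F z - c * F z0 - c * A * (z - z0) - c * D * (z - z0)^* =
  c * (F z - F z0 - A * (z - z0) - D * (z - z0)^*) by ring.
rewrite cabsM; apply: (le_trans (ler_wpM2l (cabs_ge0 _) HF)).
rewrite mulrA ler_wpM2r ?cabs_ge0 // mulrA ler_pdivrMr // mulrC ler_pM2l //; lra.
Qed.

Lemma wirt_comp F G z0 A D p q : wirt F z0 A D -> wirt G (F z0) p q ->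
  wirt (G \o F) z0 (p * A + q * conjc D) (p * D + q * conjc A).
Proof.
move=> HF HG e e0.
have [d1 d10 HL] := wirt_lip HF.
set L := cabs A + cabs D + 1 in HL.
have L0 : 0 < L by have := cabs_ge0 A; have := cabs_ge0 D; rewrite /L; lra.
have pq0 : 0 < cabs p + cabs q + 1
  by have := cabs_ge0 p; have := cabs_ge0 q; lra.
have [d2 d20 {}HF] := HF (e / 2 / (cabs p + cabs q + 1)) ltac:(apply: divr_gt0; lra).
have [d3 d30 {}HG] := HG (e / 2 / L) ltac:(apply: divr_gt0; lra).
exists (Num.min (Num.min d1 d2) (d3 / L)).
  by rewrite !lt_min d10 d20 divr_gt0.
move=> z; rewrite !lt_min => /andP[/andP[/HL {}HL /HF {}HF]].
rewrite ltr_pdivlMr // mulrC => h3.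
have {}HG := HG (F z) (le_lt_trans HL h3).
set r := (X in cabs X <= _) in HF; set s := (X in cabs X <= _) in HG.
have -> : (G \o F) z - (G \o F) z0 - (p * A + q * D^*) * (z - z0) -
   (p * D + q * A^*) * (z - z0)^* = s + (p * r + q * conjc r).
  rewrite /s /r /= !(rmorphB, rmorphM) /= !conjcK; ring.
have sb : cabs s <= e / 2 * cabs (z - z0).
  apply: (le_trans HG); rewrite -mulrA ler_pM2l; last by lra.
  by rewrite mulrC ler_pdivrMr // mulrC.
have rb : (cabs p + cabs q + 1) * cabs r <= e / 2 * cabs (z - z0).
  by rewrite mulrC -ler_pdivlMr // mulrAC.
have h1 := cabsD s (p * r + q * conjc r); have h2 := cabsD (p * r) (q * conjc r).
rewrite !cabsM cabs_conj in h2; have := cabs_ge0 r; lra.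
Qed.

Lemma wirtM F G z0 A D A' D' : wirt F z0 A D -> wirt G z0 A' D' ->
  wirt (fun z => F z * G z) z0 (A * G z0 + F z0 * A') (D * G z0 + F z0 * D').
Proof.
move=> HF HG e e0.
have [d1 d10 HL] := wirt_lip HF; have [d2 d20 HM] := wirt_lip HG.
set L := cabs A + cabs D + 1 in HL; set M := cabs A' + cabs D' + 1 in HM.
have L0 : 0 < L by have := cabs_ge0 A; have := cabs_ge0 D; rewrite /L; lra.
have M0 : 0 < M by have := cabs_ge0 A'; have := cabs_ge0 D'; rewrite /M; lra.
have f0 : 0 < cabs (F z0) + 1 by have := cabs_ge0 (F z0); lra.
have g0 : 0 < cabs (G z0) + 1 by have := cabs_ge0 (G z0); lra.
have [d3 d30 {}HF] := HF (e / 3 / (cabs (G z0) + 1)) ltac:(apply: divr_gt0; lra).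
have [d4 d40 {}HG] := HG (e / 3 / (cabs (F z0) + 1)) ltac:(apply: divr_gt0; lra).
exists (Num.min (Num.min (Num.min d1 d2) (Num.min d3 d4)) (e / 3 / (L * M))).
  by rewrite !lt_min d10 d20 d30 d40 divr_gt0 ?mulr_gt0 //; lra.
move=> z; rewrite !lt_min => /andP[/andP[/andP[/HL {}HL /HM {}HM] /andP[/HF {}HF /HG {}HG]]].
rewrite ltr_pdivlMr ?mulr_gt0 // => h5.
set r := (X in cabs X <= _) in HF; set s := (X in cabs X <= _) in HG.
have -> : F z * G z - F z0 * G z0 - (A * G z0 + F z0 * A') * (z - z0) -
   (D * G z0 + F z0 * D') * (z - z0)^* =
   r * G z0 + F z0 * s + (F z - F z0) * (G z - G z0) by rewrite /r /s; ring.
have c0 := cabs_ge0 (z - z0).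
have rb : (cabs (G z0) + 1) * cabs r <= e / 3 * cabs (z - z0).
  by rewrite mulrC -ler_pdivlMr // mulrAC.
have sb : (cabs (F z0) + 1) * cabs s <= e / 3 * cabs (z - z0).
  by rewrite mulrC -ler_pdivlMr // mulrAC.
have pb : cabs (F z - F z0) * cabs (G z - G z0) <= e / 3 * cabs (z - z0).
  apply: (le_trans (ler_pM (cabs_ge0 _) (cabs_ge0 _) HL HM)).
  have -> : L * cabs (z - z0) * (M * cabs (z - z0)) =
     cabs (z - z0) * (L * M) * cabs (z - z0) by ring.
  by rewrite ler_wpM2r // ltW.
have h1 := cabsD (r * G z0 + F z0 * s) ((F z - F z0) * (G z - G z0)).
have h2 := cabsD (r * G z0) (F z0 * s).
rewrite !cabsM in h1 h2.
have := cabs_ge0 r; have := cabs_ge0 s; lra.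
Qed.

Lemma wirt_ext F G z0 A D : F =1 G -> wirt F z0 A D -> wirt G z0 A D.
Proof. by move=> /funext ->. Qed.

Lemma is_derive_eps (h : R -> R) (x d : R) : is_derive x 1 h d ->
  forall e, 0 < e -> exists2 r, 0 < r & forall y, `|y - x| < r ->
    `|h y - h x - d * (y - x)| <= e * `|y - x|.
Proof.
move=> [dh hd] e e0.
have {}dh : (fun t : R => t^-1 *: (h (t *: 1 + x) - h x)) t @[t --> 0^'] --> 'D_1 h x := dh.
move/cvgrPdist_le : dh; rewrite hd => /(_ e e0)/nbhs_ballP[r /= r0 H].
exists r => // y yx; have [->|yx0] := eqVneq y x.
  by rewrite !subrr mulr0 subr0 !normr0 mulr0.
have yx0' : y - x != 0 by rewrite subr_eq0.
have := H (y - x); rewrite /ball /= sub0r normrN => /(_ yx yx0').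
rewrite /GRing.scale /= mulr1 subrK.
have -> : d - (y - x)^-1 * (h y - h x) = - (h y - h x - d * (y - x)) / (y - x) by field.
by rewrite normrM normfV normrN ler_pdivrMr ?normr_gt0.
Qed.

(** For a function of Re z alone each Wirtinger derivative is half the real derivative. Composition
    with a real-valued function such as |z - z0|^2 then differentiates radial factors. *)
Lemma wirt_real (h : R -> R) (x d : R) : is_derive x 1 h d -> forall y : R,
  wirt (fun z => (h (Re z))%:C) (x +i* y) (d / 2)%:C (d / 2)%:C.
Proof.
move=> /is_derive_eps H y e e0; have [r r0 {}H] := H _ e0.
exists r => // -[a b] /= ab.
have := Re_le_cabs ((a +i* b) - (x +i* y)); rewrite /= => Rle.
have {}H := H a (le_lt_trans Rle ab).
apply: (le_trans _ (ler_wpM2l (ltW e0) Rle)); apply: le_trans H.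
rewrite -cabsR le_eqVlt; apply/orP; left; apply/eqP; congr cabs.
by apply/eqP; rewrite eq_complex /=; apply/andP; split; apply/eqP; field.
Qed.

(** The addition law moves the question to the origin, where the first-order expansions of exp, cos
    and sin are combined. *)
Lemma wirt_cexp z0 : wirt (@cexp R) z0 (cexp z0) 0.
Proof.
suff H0 : wirt (@cexp R) 0 1 0.
  have h := wirtZ (cexp z0) (wirt_comp (wirtD (wirt_id z0) (wirt_cst (- z0) z0)) (G := @cexp R)
     (p := 1) (q := 0) _).
  have := h ltac:(by rewrite /= subrr).
  rewrite !(mul0r, mulr0, addr0, mulr1, mul1r, conjc0).
  by apply: wirt_ext => z /=; rewrite -cexpD addrC subrK.
move=> e e0; have e6 : 0 < e / 6 by lra.
have [r r0 Hr] := is_derive_eps (is_derive_expR (0:R)) e6.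
have [s s0 Hs] := is_derive_eps (is_derive_sin (0:R)) e6.
have [s' s'0 Hs'] := is_derive_eps (is_derive_sin (0:R)) ltr01.
have [t t0 Ht] := is_derive_eps (is_derive_cos (0:R)) e6.
(* The radius e / 12, together with |sin y - y| <= |z|, makes |sin y| <= e / 6, which controls the
   cross term x sin y. *)
exists (Num.min (Num.min (Num.min r s) t) (Num.min (Num.min 1 s') (e / 12))).
  by rewrite !lt_min r0 s0 t0 s'0 ltr01 /=; lra.
move=> z; rewrite !lt_min subr0 => /andP[/andP[/andP[hr hs] ht] /andP[/andP[h1 h3] h2]].
have Rz := Re_le_cabs z; have Iz := Im_le_cabs z.
rewrite mul1r mul0r subr0 cexp0.
move: z hr hs ht h1 h2 h3 Rz Iz => [x y] hr hs ht h1 h2 h3 /= Rz Iz.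
set c := cabs _ in hr hs ht h1 h2 h3 Rz Iz *.
have := Hr x; rewrite subr0 expR0 mul1r => /(_ (le_lt_trans Rz hr)) {}Hr.
have := Hs y; rewrite subr0 sin0 cos0 mul1r subr0 => /(_ (le_lt_trans Iz hs)) {}Hs.
have := Hs' y; rewrite subr0 sin0 cos0 mul1r mul1r subr0 => /(_ (le_lt_trans Iz h3)) {}Hs'.
have := Ht y; rewrite subr0 sin0 cos0 oppr0 mul0r subr0 => /(_ (le_lt_trans Iz ht)) {}Ht.
apply: (le_trans (cabs_le _)); rewrite /cexp /=.
have c0 : 0 <= c := cabs_ge0 _.
have Hr' : `|expR x - 1 - x| <= e / 6 * c by apply: (le_trans Hr); nra.
have Hs2 : `|sin y - y| <= e / 6 * c by apply: (le_trans Hs); nra.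
have Ht' : `|cos y - 1| <= e / 6 * c by apply: (le_trans Ht); nra.
have cosb := cos_max y; have sinb := sin_max y.
have x1 : `|x| <= 1 by lra.
have a1 : `|expR x * cos y - 1 - x| <= e / 6 * c * 3.
  have -> : expR x * cos y - 1 - x = (expR x - 1 - x) * cos y + (1 + x) * (cos y - 1) by ring.
  apply: (le_trans (ler_normD _ _)); rewrite !normrM.
  have : `|1 + x| <= 2 by apply: (le_trans (ler_normD _ _)); rewrite normr1; lra.
  have := normr_ge0 (expR x - 1 - x); have := normr_ge0 (cos y - 1); nra.
have a2 : `|expR x * sin y - 0 - y| <= e / 6 * c * 3.
  have -> : expR x * sin y - 0 - y = (expR x - 1 - x) * sin y + (sin y - y) + x * sin y by ring.
  have sy : `|sin y| <= e / 6.
    have := ler_normD (sin y - y) y; rewrite subrK; lra.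
  have b1 : `|(expR x - 1 - x) * sin y| <= e / 6 * c.
    by rewrite normrM; have := normr_ge0 (expR x - 1 - x); have : `|sin y| <= 1 by []; nra.
  have b2 : `|x * sin y| <= e / 6 * c.
    by rewrite normrM mulrC ler_pM.
  have -> : e / 6 * c * 3 = e / 6 * c + e / 6 * c + e / 6 * c by ring.
  by apply: (le_trans (ler_normD _ _)); apply: lerD => //; apply: (le_trans (ler_normD _ _)); apply: lerD.
lra.
Qed.

(** The remainder is exactly (z - z0)^2 / (z z0^2), and |z| >= |z0| / 2 on the chosen disc. *)
Lemma wirt_inv z0 : z0 != 0 -> wirt (fun z => z^-1) z0 (- z0 ^- 2) 0.
Proof.
move=> nz e e0; set a := cabs z0; have a0 : 0 < a := cabs_gt0 nz.
exists (Num.min (a / 2) (e * a ^+ 3 / 2)).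
  by rewrite lt_min !divr_gt0 ?mulr_gt0 ?exprn_gt0.
move=> z; rewrite lt_min => /andP[h1 h2].
have hz : a / 2 <= cabs z.
  by have := cabsD z (z0 - z); rewrite addrC subrK (cabsB z0) -/a; lra.
have nz' : z != 0 by apply: contraTN hz => /eqP ->; rewrite cabs0 -ltNge; lra.
have -> : z^-1 - z0^-1 - - z0 ^- 2 * (z - z0) - 0 * (z - z0)^* =
   (z - z0) * (z - z0) * (z^-1 * (z0 ^- 2)) by field; rewrite nz nz'.
rewrite !cabsM mulrAC ler_wpM2r ?cabs_ge0 // !cabsV exprS expr1 cabsM -/a.
rewrite -invfM ler_pdivrMr; last by rewrite !mulr_gt0 // (lt_le_trans _ hz) //; lra.
apply: (le_trans (ltW h2)); rewrite -mulrA ler_pM2l //.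
by have := ler_wpM2r (ltW (mulr_gt0 a0 a0)) hz; lra.
Qed.

Lemma entire_wirt (g : C -> C) : entire g -> forall z, exists A, wirt g z A 0.
Proof.
move=> gE z; have dg := gE z.
have {}dg : (fun t : C^o => t^-1 *: ((g : C^o -> C^o) (t *: 1 + z) - g z)) t @[t --> 0^']
   --> 'D_1 (g : C^o -> C^o) z := dg.
exists ('D_1 (g : C^o -> C^o) z) => e e0.
have e0' : 0 < e%:C by rewrite ltcR.
move/cvgrPdist_le : dg => /(_ _ e0')/nbhs_ballP[r /= r0 H].
(* Balls of R[i] have radii in R[i]; a positive element is real. *)
have rE : r = (Re r)%:C by rewrite RRe_real // gtr0_real.
exists (Re r); first by rewrite -ltcR -rE.
move=> y; rewrite mul0r subr0 => yx; have [->|yx0] := eqVneq y z.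
  by rewrite !subrr mulr0 subr0 !cabs0 mulr0.
have yx0' : y - z != 0 by rewrite subr_eq0.
have := H (y - z); rewrite /ball /= sub0r normrN normcC rE ltcR => /(_ yx yx0').
rewrite /GRing.scale /= mulr1 subrK normcC lecR.
set D := derive _ _ _.
have -> : D - (y - z)^-1 * (g y - g z) = - (g y - g z - D * (y - z)) / (y - z) by field.
by rewrite cabsM cabsN cabsV ler_pdivrMr ?cabs_gt0.
Qed.

End Wirtinger.

(** * Green's formula on rectangles *)

Section Bisection.
Variable R : realType.

Lemma expn2_small (s e : R) : 0 < e -> exists n, s / 2 ^+ n < e.
Proof.
move=> e0; have [n hn] : exists n : nat, s / e < n%:R.
  exists (Num.bound `|s / e|); apply: le_lt_trans (ler_norm _) _.
  exact: archi_boundP.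
exists n; rewrite ltr_pdivrMr ?exprn_gt0 // mulrC -ltr_pdivrMr //.
apply: (lt_trans hn); rewrite -natrX ltr_nat; exact: ltn_expl.
Qed.

(** If the property failed, some quarter would be bad at each stage, and these nested rectangles
    would shrink to a point near which it holds. This form of compactness serves for Green's
    formula, for boundedness of continuous functions and for intervals of time. *)
Lemma bisection (good : R -> R -> R -> R -> Prop) (a b c d : R) :
  a <= b -> c <= d ->
  (forall a b c d, a <= b -> c <= d ->
    good a ((a + b) / 2) c ((c + d) / 2) -> good ((a + b) / 2) b c ((c + d) / 2) ->
    good a ((a + b) / 2) ((c + d) / 2) d -> good ((a + b) / 2) b ((c + d) / 2) d ->
    good a b c d) ->
  (forall x y, a <= x <= b -> c <= y <= d -> exists2 e, 0 < e &
    forall a' b' c' d', a <= a' -> a' <= x <= b' -> b' <= b ->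
      c <= c' -> c' <= y <= d' -> d' <= d -> b' - a' < e -> d' - c' < e ->
      good a' b' c' d') ->
  good a b c d.
Proof.
move=> ab cd Hsub Hloc; apply: contrapT => bad.
pose T := (R * R * R * R)%type.
pose A (q : T) := q.1.1.1; pose B (q : T) := q.1.1.2.
pose C (q : T) := q.1.2; pose D (q : T) := q.2.
pose bd (q : T) := ~ good (A q) (B q) (C q) (D q).
pose inv (q : T) := [/\ A q <= B q, C q <= D q & bd q].
pose sub (q q' : T) := [/\ A q <= A q', B q' <= B q, C q <= C q', D q' <= D q &
   (B q' - A q' = (B q - A q) / 2 /\ D q' - C q' = (D q - C q) / 2)].
(* The implication sits under the existential so that [choice] gives a total successor map, with an
   arbitrary value where [inv] fails. *)
have step q : exists q', inv q -> inv q' /\ sub q q'.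
  have [iq|niq] := pselect (inv q); last by exists q.
  case: q iq => [[[a1 b1] c1] d1] [/= ab1 cd1 bad1].
  rewrite /A /B /C /D /bd /= in ab1 cd1 bad1.
  pose m := (a1 + b1) / 2; pose n := (c1 + d1) / 2.
  have [g1|g1] := pselect (good a1 m c1 n); last first.
    by exists (a1, m, c1, n) => _; rewrite /inv /sub /bd /A /B /C /D /=; split; split=> //; try (match goal with |- _ /\ _ => split end); rewrite /m /n; lra.
  have [g2|g2] := pselect (good m b1 c1 n); last first.
    by exists (m, b1, c1, n) => _; rewrite /inv /sub /bd /A /B /C /D /=; split; split=> //; try (match goal with |- _ /\ _ => split end); rewrite /m /n; lra.
  have [g3|g3] := pselect (good a1 m n d1); last first.
    by exists (a1, m, n, d1) => _; rewrite /inv /sub /bd /A /B /C /D /=; split; split=> //; try (match goal with |- _ /\ _ => split end); rewrite /m /n; lra.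
  have [g4|g4] := pselect (good m b1 n d1); last first.
    by exists (m, b1, n, d1) => _; rewrite /inv /sub /bd /A /B /C /D /=; split; split=> //; try (match goal with |- _ /\ _ => split end); rewrite /m /n; lra.
  by exfalso; apply: bad1; exact: Hsub.
have [nx Hnx] := choice step.
pose Q n := iter n nx (a, b, c, d).
have invQ n : inv (Q n).
  by elim: n => [|n IH]; [split|exact: (Hnx _ IH).1].
have subQ n : sub (Q n) (Q n.+1) by exact: (Hnx _ (invQ n)).2.
have len n : B (Q n) - A (Q n) = (b - a) / 2 ^+ n /\ D (Q n) - C (Q n) = (d - c) / 2 ^+ n.
  elim: n => [|n [IH1 IH2]]; first by rewrite expr0 !divr1.
  have [_ _ _ _ [-> ->]] := subQ n; rewrite IH1 IH2 exprS.
  by split; field; rewrite expf_neq0.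
have mono n k : [/\ A (Q n) <= A (Q (k + n)%N), B (Q (k + n)%N) <= B (Q n),
    C (Q n) <= C (Q (k + n)%N) & D (Q (k + n)%N) <= D (Q n)].
  elim: k => [|k [i1 i2 i3 i4]]; first by split.
  have [h1 h2 h3 h4 _] := subQ (k + n)%N.
  by split; [exact: le_trans h1|exact: le_trans i2|exact: le_trans h3|exact: le_trans i4].
have AB n m : A (Q n) <= B (Q m) /\ C (Q n) <= D (Q m).
  have [h1 _ h3 _] := mono n m; have [_ h2 _ h4] := mono m n.
  have [h5 h6 _] := invQ (m + n)%N; rewrite addnC in h2 h4.
  by split; [exact: (le_trans h1 (le_trans h5 h2))|exact: (le_trans h3 (le_trans h6 h4))].
pose x := sup (range (fun n => A (Q n))); pose y := sup (range (fun n => C (Q n))).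
have xA n : A (Q n) <= x.
  apply: ub_le_sup; last by exists n.
  by exists (B (Q 0)) => _ [k _ <-]; exact: (AB k 0).1.
have xB n : x <= B (Q n).
  apply: ge_sup; first by exists (A (Q 0)); exists 0.
  by move=> _ [k _ <-]; exact: (AB k n).1.
have yC n : C (Q n) <= y.
  apply: ub_le_sup; last by exists n.
  by exists (D (Q 0)) => _ [k _ <-]; exact: (AB k 0).2.
have yD n : y <= D (Q n).
  apply: ge_sup; first by exists (C (Q 0)); exists 0.
  by move=> _ [k _ <-]; exact: (AB k n).2.
have [e e0 He] := Hloc x y ltac:(by have := xA 0; have := xB 0 => /= -> ->)
  ltac:(by have := yC 0; have := yD 0 => /= -> ->).
have [n hn] := expn2_small (Num.max (b - a) (d - c)) e0.
have [_ _] := invQ n; apply.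
have [h1 h2 h3 h4] := mono 0 n; rewrite addn0 in h1 h2 h3 h4.
have [l1 l2] := len n.
have p0 : 0 <= (2 ^+ n : R)^-1 by rewrite invr_ge0 exprn_ge0.
apply: He => //; rewrite ?xA ?xB ?yC ?yD // ?l1 ?l2; apply: le_lt_trans hn.
  by rewrite ler_wpM2r // le_max lexx.
by rewrite ler_wpM2r // le_max lexx orbT.
Qed.
End Bisection.

Lemma norm_itv_le (R : realType) (x a b : R) : a <= x -> x <= b -> `|x| <= Num.max `|a| `|b|.
Proof.
move=> ax xb; rewrite le_max; case: (leP 0 x) => x0; apply/orP; [right|left].
  by rewrite ger0_norm // (le_trans xb) // ler_norm.
by rewrite ltr0_norm // -normrN (le_trans _ (ler_norm _)) // lerN2.
Qed.

Lemma integrable_subR d (T : measurableType d) (R : realType) (mu : {measure set T -> \bar R})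
    (D : set T) (f g : T -> R) : measurable D ->
  mu.-integrable D (EFin \o f) -> mu.-integrable D (EFin \o g) ->
  mu.-integrable D (EFin \o (fun x => f x - g x)).
Proof.
move=> mD fi gi; apply: eq_integrable (integrableB mD fi gi) => // x _.
Qed.

Section Green.
Variable R : realType.
Local Notation leb := (@lebesgue_measure R).
Local Notation RxR := (measurableTypeR R * measurableTypeR R)%type.
Implicit Types (P Q E : RxR -> R).

(** Enough for integrability on all rectangles and edges, and weak enough for the difference
    quotient used below, which may be discontinuous at one point. *)
Definition locbm P := measurable_fun setT (P : RxR -> measurableTypeR R) /\
  forall M : R, exists B : R, forall x y : R, `|x| <= M -> `|y| <= M -> `|P (x, y)| <= B.

(** Half-open, so that the pieces of a subdivision are disjoint and their integrals add up
    exactly. *)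
Definition rect (a b c d : R) : set RxR := `[a, b[%classic `*` `[c, d[%classic.

Lemma measurable_rect a b c d : measurable (rect a b c d).
Proof. by apply: measurableX; exact: measurable_itv. Qed.

Lemma lebesgue_co (a b : R) : a <= b -> leb `[a, b[%classic = (b - a)%:E.
Proof.
move=> ab; rewrite lebesgue_measure_itv /= lte_fin.
by case: ltP => [//|ba]; rewrite (le_anti (introT andP (conj ab ba))) subrr.
Qed.

Lemma lebC_rect a b c d : a <= b -> c <= d ->
  @lebC R (rect a b c d) = ((b - a) * (d - c))%:E.
Proof.
move=> ab cd; have := @product_measure1E _ _ _ _ _ leb leb _ _
  (measurable_itv `[a, b[) (measurable_itv `[c, d[).
by rewrite EFinM -!lebesgue_co //; exact.
Qed.

Lemma locbm_int_rect E a b c d : locbm E -> a <= b -> c <= d ->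
  (@lebC R).-integrable (rect a b c d) (EFin \o E).
Proof.
move=> [mE bE] ab cd; have [M HM] := bE (Num.max (Num.max `|a| `|b|) (Num.max `|c| `|d|)).
apply: measurable_bounded_integrable.
- exact: measurable_rect.
- by rewrite lebC_rect // ltry.
- by apply: measurable_funTS.
exists M; split; rewrite ?num_real // => N MN [x y] [/= + +].
rewrite !in_itv /= => /andP[ax xb] /andP[cy yd].
apply: le_trans (ltW MN); apply: HM; rewrite le_max.
  by rewrite (norm_itv_le ax (ltW xb)).
by rewrite (norm_itv_le cy (ltW yd)) orbT.
Qed.

Lemma bounded_int_co (f : R -> R) a b : measurable_fun setT (f : measurableTypeR R -> measurableTypeR R) ->
  (exists B, forall x, a <= x <= b -> `|f x| <= B) -> a <= b ->
  leb.-integrable `[a, b[%classic (EFin \o f).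
Proof.
move=> mf [B HB] ab; apply: measurable_bounded_integrable.
- exact: measurable_itv.
- by have := ltry (b - a); rewrite -(lebesgue_co ab).
- by apply: measurable_funTS.
exists B; split; rewrite ?num_real // => N BN x /=; rewrite in_itv /= => /andP[ax xb].
by apply: le_trans (ltW BN); apply: HB; rewrite ax ltW.
Qed.

Lemma locbm_int_x P a b c : locbm P -> a <= b ->
  leb.-integrable `[a, b[%classic (EFin \o (fun x => P (x, c))).
Proof.
move=> [mP bP] ab; apply: bounded_int_co => //.
  by apply: (measurableT_comp mP); exact: measurable_pair2.
have [M HM] := bP (Num.max (Num.max `|a| `|b|) `|c|).
exists M => x /andP[ax xb]; apply: HM; rewrite le_max ?lexx ?orbT // (norm_itv_le ax xb) //.
Qed.

Lemma locbm_int_y P a b c : locbm P -> a <= b ->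
  leb.-integrable `[a, b[%classic (EFin \o (fun x => P (c, x))).
Proof.
move=> [mP bP] ab; apply: bounded_int_co => //.
  by apply: (measurableT_comp mP); exact: measurable_pair1.
have [M HM] := bP (Num.max (Num.max `|a| `|b|) `|c|).
exists M => x /andP[ax xb]; apply: HM; rewrite le_max ?lexx ?orbT // (norm_itv_le ax xb) //.
Qed.

(** The counterclockwise circulation of P dx + Q dy around the rectangle. *)
Definition bdry P Q a b c d : R :=
  \int[leb]_(x in `[a, b[) (P (x, c) - P (x, d)) +
  \int[leb]_(y in `[c, d[) (Q (b, y) - Q (a, y)).

(** The defect in Green's formula, E standing for dQ/dx - dP/dy. *)
Definition green P Q E a b c d : R :=
  bdry P Q a b c d - \int[@lebC R]_(p in rect a b c d) E p.

Lemma itv_co_split (a m b : R) : a <= m -> m <= b ->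
  `[a, b[%classic = `[a, m[%classic `|` `[m, b[%classic.
Proof.
move=> am mb; apply/seteqP; split=> x /=; rewrite !in_itv /=.
  by case: (ltP x m) => xm /andP[-> ->]; [left|right].
by move=> [] /andP[h1 h2]; rewrite ?h1 ?h2 ?(lt_le_trans h2) ?(le_trans am).
Qed.

Lemma disj_co (a m b : R) : [disjoint `[a, m[%classic & `[m, b[%classic].
Proof.
apply/disj_setPS => x [/=]; rewrite !in_itv /= => /andP[_ h1] /andP[h2 _].
by move: (lt_le_trans h1 h2); rewrite ltxx.
Qed.

Lemma rect_splitX (a m b c d : R) : a <= m -> m <= b ->
  rect a b c d = rect a m c d `|` rect m b c d.
Proof.
move=> am mb; rewrite /rect (itv_co_split am mb); apply/seteqP; split=> p /=.
  by move=> [[h|h] k]; [left|right].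
by move=> [[h k]|[h k]]; split => //; [left|right].
Qed.

Lemma rect_splitY (a b c m d : R) : c <= m -> m <= d ->
  rect a b c d = rect a b c m `|` rect a b m d.
Proof.
move=> cm md; rewrite /rect (itv_co_split cm md); apply/seteqP; split=> p /=.
  by move=> [k [h|h]]; [left|right].
by move=> [[h k]|[h k]]; split => //; [left|right].
Qed.

Lemma Rint_co_split (f : R -> R) (a m b : R) : a <= m -> m <= b ->
  leb.-integrable `[a, b[%classic (EFin \o f) ->
  \int[leb]_(x in `[a, b[) f x =
  \int[leb]_(x in `[a, m[) f x + \int[leb]_(x in `[m, b[) f x.
Proof.
move=> am mb; rewrite (itv_co_split am mb) => fi.
by apply: Rintegral_setU => //; exact: disj_co.
Qed.

Lemma locbmB_int_x P a b c d : locbm P -> a <= b ->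
  leb.-integrable `[a, b[%classic (EFin \o (fun x => P (x, c) - P (x, d))).
Proof.
move=> lP ab.
by apply: integrable_subR; [exact: measurable_itv|exact: locbm_int_x|exact: locbm_int_x].
Qed.

Lemma locbmB_int_y P a b c d : locbm P -> c <= d ->
  leb.-integrable `[c, d[%classic (EFin \o (fun y => P (b, y) - P (a, y))).
Proof.
move=> lP cd.
by apply: integrable_subR; [exact: measurable_itv|exact: locbm_int_y|exact: locbm_int_y].
Qed.

(** The two contributions of the common edge cancel. *)
Lemma greenX P Q E a m b c d : locbm P -> locbm Q -> locbm E ->
  a <= m -> m <= b -> c <= d ->
  green P Q E a b c d = green P Q E a m c d + green P Q E m b c d.
Proof.
move=> lP lQ lE am mb cd; have ab := le_trans am mb; rewrite /green /bdry.
rewrite (Rint_co_split am mb (locbmB_int_x c d lP ab)).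
rewrite (rect_splitX c d am mb) Rintegral_setU; first last.
- apply/disj_setPS => -[x y] [[/= + _] [/= + _]]; rewrite !in_itv /= => /andP[_ h1] /andP[h2 _].
  by move: (lt_le_trans h1 h2); rewrite ltxx.
- by rewrite -(rect_splitX c d am mb); exact: locbm_int_rect.
- exact: measurable_rect.
- exact: measurable_rect.
rewrite !RintegralB; try exact: measurable_itv; try exact: locbm_int_y; try exact: locbm_int_x.
ring.
Qed.

Lemma greenY P Q E a b c m d : locbm P -> locbm Q -> locbm E ->
  a <= b -> c <= m -> m <= d ->
  green P Q E a b c d = green P Q E a b c m + green P Q E a b m d.
Proof.
move=> lP lQ lE ab cm md; have cd := le_trans cm md; rewrite /green /bdry.
rewrite (Rint_co_split cm md (locbmB_int_y a b lQ cd)).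
rewrite (rect_splitY a b cm md) Rintegral_setU; first last.
- apply/disj_setPS => -[x y] [[_ /= +] [_ /= +]]; rewrite !in_itv /= => /andP[_ h1] /andP[h2 _].
  by move: (lt_le_trans h1 h2); rewrite ltxx.
- by rewrite -(rect_splitY a b cm md); exact: locbm_int_rect.
- exact: measurable_rect.
- exact: measurable_rect.
rewrite !RintegralB; try exact: measurable_itv; try exact: locbm_int_y; try exact: locbm_int_x.
ring.
Qed.

Definition rdiff P (x0 y0 p q : R) := forall e, 0 < e -> exists2 r, 0 < r &
  forall x y, `|x - x0| < r -> `|y - y0| < r ->
  `|P (x, y) - P (x0, y0) - p * (x - x0) - q * (y - y0)| <= e * (`|x - x0| + `|y - y0|).

Definition rcont P (x0 y0 : R) := forall e, 0 < e -> exists2 r, 0 < r &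
  forall x y, `|x - x0| < r -> `|y - y0| < r -> `|P (x, y) - P (x0, y0)| <= e.

Definition green_at P Q E x y := exists p1 p2 q1 q2 : R,
  [/\ rdiff P x y p1 p2, rdiff Q x y q1 q2, rcont E x y & E (x, y) = q1 - p2].

(** Besides comparing with a linear model, it serves with k = 0 as a plain sup bound for
    integrals. *)
Lemma Rint_near_cst d (T : measurableType d) (mu : {measure set T -> \bar R})
    (D : set T) (f : T -> R) (k e : R) (V : R) : measurable D -> mu D = V%:E ->
  mu.-integrable D (EFin \o f) -> (forall x, D x -> `|f x - k| <= e) ->
  `|\int[mu]_(x in D) f x - k * V| <= e * V.
Proof.
move=> mD muV fi H.
have ki (c : R) : mu.-integrable D (EFin \o (fun _ : T => c)).
  apply: measurable_bounded_integrable => //; first by rewrite muV ltry.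
  exact: bounded_cst.
have -> : k * V = \int[mu]_(x in D) k by rewrite Rintegral_cst // muV.
have -> : e * V = \int[mu]_(x in D) e by rewrite Rintegral_cst // muV.
rewrite -(RintegralB mD fi (ki k)).
apply: (le_trans (le_normr_Rintegral _ _)) => //.
  exact: (integrable_subR mD fi (ki k)).
apply: le_Rintegral; [exact: mD|exact: integrable_norm (integrable_subR mD fi (ki k))|exact: ki|exact: H].
Qed.

(** The linear parts of P and Q contribute exactly [q1 - p2] times the area, and so does E up to its
    oscillation. The errors amount to three fifths of the allowance. *)
Lemma green_local P Q E x0 y0 : locbm P -> locbm Q -> locbm E ->
  green_at P Q E x0 y0 -> forall e, 0 < e -> exists2 r, 0 < r &
  forall a b c d, a <= x0 -> x0 <= b -> c <= y0 -> y0 <= d -> b - a < r -> d - c < r ->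
  `|green P Q E a b c d| <= e * ((b - a) + (d - c)) ^+ 2.
Proof.
move=> lP lQ lE [p1 [p2 [q1 [q2 [dP dQ cE EE]]]]] e e0.
have e5 : 0 < e / 5 by lra.
have [r1 r10 {}dP] := dP _ e5; have [r2 r20 {}dQ] := dQ _ e5; have [r3 r30 {}cE] := cE _ e5.
exists (Num.min r1 (Num.min r2 r3)); first by rewrite !lt_min r10 r20.
move=> a b c d ax xb cy yd; rewrite !lt_min => /and3P[ba1 ba2 ba3] /and3P[dc1 dc2 dc3].
have ab := le_trans ax xb; have cd := le_trans cy yd.
set s := (b - a) + (d - c).
have xr x : a <= x -> x <= b -> `|x - x0| <= b - a by move=> *; rewrite ler_norml; lra.
have yr y : c <= y -> y <= d -> `|y - y0| <= d - c by move=> *; rewrite ler_norml; lra.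
have B1 : `|\int[leb]_(x in `[a, b[) (P (x, c) - P (x, d)) - (p2 * (c - d)) * (b - a)| <=
    (2 * (e / 5) * s) * (b - a).
  apply: Rint_near_cst; [exact: measurable_itv|exact: lebesgue_co|exact: locbmB_int_x|].
  move=> x /=; rewrite in_itv /= => /andP[hx1 /ltW hx2].
  have xx := xr _ hx1 hx2; have yc := yr _ (lexx c) cd; have yd' := yr _ cd (lexx d).
  have := dP x c (le_lt_trans xx ba1) (le_lt_trans yc dc1).
  have := dP x d (le_lt_trans xx ba1) (le_lt_trans yd' dc1).
  set u := (X in `|X| <= _ -> _); set v := (X in _ -> `|X| <= _ -> _) => hu hv.
  have -> : P (x, c) - P (x, d) - p2 * (c - d) = v - u by rewrite /u /v; ring.
  apply: (le_trans (ler_normB _ _)).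
  have : e / 5 * (`|x - x0| + `|c - y0|) <= e / 5 * s by rewrite ler_pM2l // /s; lra.
  have : e / 5 * (`|x - x0| + `|d - y0|) <= e / 5 * s by rewrite ler_pM2l // /s; lra.
  lra.
have B2 : `|\int[leb]_(y in `[c, d[) (Q (b, y) - Q (a, y)) - (q1 * (b - a)) * (d - c)| <=
    (2 * (e / 5) * s) * (d - c).
  apply: Rint_near_cst; [exact: measurable_itv|exact: lebesgue_co|exact: locbmB_int_y|].
  move=> y /=; rewrite in_itv /= => /andP[hy1 /ltW hy2].
  have yy := yr _ hy1 hy2; have xa := xr _ (lexx a) ab; have xb' := xr _ ab (lexx b).
  have := dQ a y (le_lt_trans xa ba2) (le_lt_trans yy dc2).
  have := dQ b y (le_lt_trans xb' ba2) (le_lt_trans yy dc2).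
  set u := (X in `|X| <= _ -> _); set v := (X in _ -> `|X| <= _ -> _) => hu hv.
  have -> : Q (b, y) - Q (a, y) - q1 * (b - a) = u - v by rewrite /u /v; ring.
  apply: (le_trans (ler_normB _ _)).
  have : e / 5 * (`|b - x0| + `|y - y0|) <= e / 5 * s by rewrite ler_pM2l // /s; lra.
  have : e / 5 * (`|a - x0| + `|y - y0|) <= e / 5 * s by rewrite ler_pM2l // /s; lra.
  lra.
have B3 : `|\int[@lebC R]_(p in rect a b c d) E p - E (x0, y0) * ((b - a) * (d - c))| <=
    e / 5 * ((b - a) * (d - c)).
  apply: Rint_near_cst; [exact: measurable_rect|exact: lebC_rect|exact: locbm_int_rect|].
  move=> [x y] [/= + +]; rewrite !in_itv /= => /andP[hx1 /ltW hx2] /andP[hy1 /ltW hy2].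
  by apply: cE; [exact: le_lt_trans (xr _ hx1 hx2) _|exact: le_lt_trans (yr _ hy1 hy2) _].
rewrite /green /bdry.
set I1 := Rintegral _ _ _ in B1 *; set I2 := Rintegral _ _ _ in B2 *.
set I3 := Rintegral _ _ _ in B3 *.
rewrite EE in B3.
have -> : I1 + I2 - I3 = (I1 - p2 * (c - d) * (b - a)) + (I2 - q1 * (b - a) * (d - c)) -
   (I3 - (q1 - p2) * ((b - a) * (d - c))) by ring.
apply: (le_trans (ler_normB _ _)); apply: (le_trans (lerD (le_trans (ler_normD _ _) (lerD B1 B2)) B3)).
have h1 : 0 <= b - a by lra.
have h2 : 0 <= d - c by lra.
have : (b - a) * (d - c) <= s ^+ 2 by rewrite /s; nra.
have -> : 2 * (e / 5) * s * (b - a) + 2 * (e / 5) * s * (d - c) = 2 * (e / 5) * s ^+ 2 by rewrite /s; ring.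
move=> h; have := ler_wpM2l (ltW e5) h; have := sqr_ge0 s; nra.
Qed.

(* As in Goursat's proof, the defect of Green's formula is o(area) on small squares and
   bisection makes it vanish, without continuity of the partial derivatives. *)
Lemma green_rect P Q E a b c d : locbm P -> locbm Q -> locbm E -> a <= b -> c <= d ->
  (forall x y, a <= x <= b -> c <= y <= d -> green_at P Q E x y) ->
  green P Q E a b c d = 0.
Proof.
move=> lP lQ lE ab cd H.
suff S e : 0 < e -> `|green P Q E a b c d| <= e * ((b - a) + (d - c)) ^+ 2.
  apply/eqP; rewrite -normr_eq0 eq_le normr_ge0 andbT; apply/ler_addgt0Pl => e e0.
  rewrite addr0; set s := (b - a + (d - c)) ^+ 2 in S.
  have s0 : 0 <= s by exact: sqr_ge0.
  have s1 : 0 < s + 1 by lra.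
  apply: (le_trans (S (e / (s + 1)) (divr_gt0 e0 s1))).
  by rewrite mulrAC ler_pdivrMr // ler_pM2l //; lra.
move=> e0.
apply: (bisection (good := fun a b c d => `|green P Q E a b c d| <= e * ((b - a) + (d - c)) ^+ 2)) => //.
  (* The bound is quadratic in the sides, so a quarter has a fourth of it and four quarters restore
     the whole. *)
  move=> {ab cd H} {}a {}b {}c {}d ab cd.
  have am : a <= (a + b) / 2 by lra.
  have mb : (a + b) / 2 <= b by lra.
  have cn : c <= (c + d) / 2 by lra.
  have nd : (c + d) / 2 <= d by lra.
  move=> g1 g2 g3 g4.
  rewrite (greenX lP lQ lE am mb cd) !(greenY lP lQ lE _ cn nd) //.
  apply: (le_trans (ler_normD _ _)); apply: (le_trans (lerD (ler_normD _ _) (ler_normD _ _))).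
  apply: (le_trans (lerD (lerD g1 g3) (lerD g2 g4))); nra.
move=> x y xab ycd; have [r r0 Hr] := green_local lP lQ lE (H _ _ xab ycd) e0.
by exists r => // a' b' c' d' _ /andP[? ?] _ _ /andP[? ?] _ ? ?; exact: Hr.
Qed.

(** Rectangles that miss the exceptional point have no defect, so the square may be shrunk around it
    to half-side e. Local boundedness then makes the circulation O(e) and the area integral
    O(e^2). *)
Lemma green_puncture P Q E x0 y0 r : locbm P -> locbm Q -> locbm E -> 0 < r ->
  (forall x y, (x, y) <> (x0, y0) -> green_at P Q E x y) ->
  green P Q E (x0 - r) (x0 + r) (y0 - r) (y0 + r) = 0.
Proof.
move=> lP lQ lE r0 H.
have small e : 0 < e -> e < r -> green P Q E (x0 - r) (x0 + r) (y0 - r) (y0 + r) =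
    green P Q E (x0 - e) (x0 + e) (y0 - e) (y0 + e).
  move=> e0 er.
  have z a b c d : a <= b -> c <= d -> (forall x y, a <= x <= b -> c <= y <= d -> (x, y) <> (x0, y0)) ->
    green P Q E a b c d = 0.
    by move=> ab cd Hn; apply: green_rect => // x y hx hy; apply: H; exact: Hn.
  rewrite (@greenX P Q E _ (x0 - e)) //; try lra.
  rewrite (@greenX P Q E (x0 - e) (x0 + e)) //; try lra.
  rewrite (@greenY P Q E (x0 - e) _ _ (y0 - e)) //; try lra.
  rewrite (@greenY P Q E (x0 - e) _ (y0 - e) (y0 + e)) //; try lra.
  rewrite (z (x0 - r) (x0 - e)); [|lra|lra|by move=> x y ? ? [? ?]; lra].
  rewrite (z (x0 + e) (x0 + r)); [|lra|lra|by move=> x y ? ? [? ?]; lra].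
  rewrite (z (x0 - e) (x0 + e) (y0 - r)); [|lra|lra|by move=> x y ? ? [? ?]; lra].
  rewrite (z (x0 - e) (x0 + e) (y0 + e) (y0 + r)); [|lra|lra|by move=> x y ? ? [? ?]; lra].
  by rewrite add0r !addr0 add0r.
pose M := Num.max (Num.max `|x0 - r| `|x0 + r|) (Num.max `|y0 - r| `|y0 + r|).
have [BP HP] := lP.2 M; have [BQ HQ] := lQ.2 M; have [BE HE] := lE.2 M.
have inx x : x0 - r <= x -> x <= x0 + r -> `|x| <= M.
  by move=> h1 h2; rewrite /M le_max (norm_itv_le h1 h2).
have iny y : y0 - r <= y -> y <= y0 + r -> `|y| <= M.
  by move=> h1 h2; rewrite /M le_max (norm_itv_le h1 h2) orbT.
have BP0 : 0 <= BP by apply: (le_trans (normr_ge0 (P (x0, y0)))); apply: HP; [apply: inx|apply: iny]; lra.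
have BQ0 : 0 <= BQ by apply: (le_trans (normr_ge0 (Q (x0, y0)))); apply: HQ; [apply: inx|apply: iny]; lra.
have BE0 : 0 <= BE by apply: (le_trans (normr_ge0 (E (x0, y0)))); apply: HE; [apply: inx|apply: iny]; lra.
set G := green P Q E (x0 - r) (x0 + r) (y0 - r) (y0 + r) in small *.
have bound e : 0 < e -> e < r -> `|G| <= e * (4 * BP + 4 * BQ + 4 * BE * r).
  move=> e0 er; rewrite (small e e0 er).
  have ab : x0 - e <= x0 + e by lra.
  have cd : y0 - e <= y0 + e by lra.
  have B1 : `|\int[leb]_(x in `[(x0 - e), (x0 + e)[) (P (x, y0 - e) - P (x, y0 + e)) - 0 * ((x0 + e) - (x0 - e))| <=
    (2 * BP) * ((x0 + e) - (x0 - e)).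
    apply: Rint_near_cst; [exact: measurable_itv|exact: lebesgue_co|exact: locbmB_int_x|].
    move=> x /=; rewrite in_itv /= => /andP[hx1 /ltW hx2]; rewrite subr0.
    apply: (le_trans (ler_normB _ _)); rewrite mulr_natl mulr2n; apply: lerD;
      by apply: HP; [apply: inx; lra|apply: iny; lra].
  have B2 : `|\int[leb]_(y in `[(y0 - e), (y0 + e)[) (Q (x0 + e, y) - Q (x0 - e, y)) - 0 * ((y0 + e) - (y0 - e))| <=
    (2 * BQ) * ((y0 + e) - (y0 - e)).
    apply: Rint_near_cst; [exact: measurable_itv|exact: lebesgue_co|exact: locbmB_int_y|].
    move=> y /=; rewrite in_itv /= => /andP[hy1 /ltW hy2]; rewrite subr0.
    apply: (le_trans (ler_normB _ _)); rewrite mulr_natl mulr2n; apply: lerD;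
      by apply: HQ; [apply: inx; lra|apply: iny; lra].
  have B3 : `|\int[@lebC R]_(p in rect (x0 - e) (x0 + e) (y0 - e) (y0 + e)) E p - 0 * (((x0 + e) - (x0 - e)) * ((y0 + e) - (y0 - e)))| <=
    BE * (((x0 + e) - (x0 - e)) * ((y0 + e) - (y0 - e))).
    apply: Rint_near_cst; [exact: measurable_rect|exact: lebC_rect|exact: locbm_int_rect|].
    move=> [x y] [/= + +]; rewrite !in_itv /= => /andP[hx1 /ltW hx2] /andP[hy1 /ltW hy2].
    by rewrite subr0; apply: HE; [apply: inx; lra|apply: iny; lra].
  rewrite !mul0r !subr0 in B1 B2 B3.
  rewrite /green /bdry.
  apply: (le_trans (ler_normB _ _)); apply: (le_trans (lerD (le_trans (ler_normD _ _) (lerD B1 B2)) B3)).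
  have : BE * e * e <= BE * e * r by rewrite ler_wpM2l // ?mulr_ge0 // ltW.
  lra.
apply/eqP; rewrite -normr_eq0 eq_le normr_ge0 andbT; apply/ler_addgt0Pl => e e0; rewrite addr0.
set K := 4 * BP + 4 * BQ + 4 * BE * r in bound.
have K0 : 0 <= K by rewrite /K; have := mulr_ge0 BE0 (ltW r0); lra.
have K1 : 0 < K + 1 by lra.
have m0 : 0 < Num.min (r / 2) (e / (K + 1)) by rewrite lt_min !divr_gt0.
have mr : Num.min (r / 2) (e / (K + 1)) < r by rewrite gt_min; apply/orP; left; lra.
apply: (le_trans (bound _ m0 mr)).
apply: (@le_trans _ _ (e / (K + 1) * K)); first by rewrite ler_wpM2r // ge_min lexx orbT.
by rewrite mulrAC ler_pdivrMr // ler_pM2l //; lra.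
Qed.
End Green.

(** * Measurability of complex functions *)

Section MeasurableC.
Variable R : realType.
Local Notation C := R[i].
Local Notation RxR := (measurableTypeR R * measurableTypeR R)%type.

Section Generic.
Context d (T : measurableType d).
Implicit Types F G : T -> C.

(** Over an arbitrary measurable space, since Fubini for the kernel of Pi concerns functions of a
    pair of points of C. *)
Definition mc F : Prop :=
  measurable_fun setT (fun p => Re (F p) : measurableTypeR R) /\
  measurable_fun setT (fun p => Im (F p) : measurableTypeR R).

Lemma mc_cst (c : C) : mc (fun _ => c).
Proof. by split; exact: measurable_cst. Qed.

Lemma mc_conj F : mc F -> mc (fun p => conjc (F p)).
Proof.
move=> [m1 m2]; split.
  by apply: eq_measurable_fun m1 => p _; rewrite Re_cc.
by apply: eq_measurable_fun (measurable_funN m2) => p _; rewrite Im_cc.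
Qed.

Lemma mcD F G : mc F -> mc G -> mc (fun p => F p + G p).
Proof.
move=> [f1 f2] [g1 g2]; split.
  by apply: eq_measurable_fun (measurable_funD f1 g1) => p _; rewrite Re_add.
by apply: eq_measurable_fun (measurable_funD f2 g2) => p _; rewrite Im_add.
Qed.

Lemma mcM F G : mc F -> mc G -> mc (fun p => F p * G p).
Proof.
move=> [f1 f2] [g1 g2]; split.
  apply: eq_measurable_fun (measurable_funB (measurable_funM f1 g1) (measurable_funM f2 g2)).
  by move=> p _; rewrite Re_mul.
apply: eq_measurable_fun (measurable_funD (measurable_funM f1 g2) (measurable_funM f2 g1)).
by move=> p _; rewrite Im_mul.
Qed.

Lemma mcN F : mc F -> mc (fun p => - F p).
Proof.
move=> mF; have := mcM (mc_cst (-1)) mF.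
by congr mc; apply/funext => z; rewrite mulN1r.
Qed.

Lemma mcB F G : mc F -> mc G -> mc (fun p => F p - G p).
Proof. by move=> mF mG; exact: mcD mF (mcN mG). Qed.

Lemma mc_real (h : R -> R) F :
  measurable_fun setT (h : measurableTypeR R -> measurableTypeR R) ->
  mc F -> mc (fun p => (h (Re (F p)))%:C).
Proof.
move=> mh [f1 f2]; split; last exact: measurable_cst.
exact: (measurableT_comp mh f1).
Qed.

Lemma mc_cexp F : mc F -> mc (fun p => cexp (F p)).
Proof.
move=> [f1 f2].
have me : measurable_fun setT (fun p : T => expR (Re (F p)) : measurableTypeR R).
  have me : measurable_fun setT (@expR R : measurableTypeR R -> measurableTypeR R).
    by apply: continuous_measurable_fun; exact: continuous_expR.
  exact: (measurableT_comp me f1).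
have mcs : measurable_fun setT (@cos R : measurableTypeR R -> measurableTypeR R).
  by apply: continuous_measurable_fun; exact: continuous_cos.
have ms : measurable_fun setT (@sin R : measurableTypeR R -> measurableTypeR R).
  by apply: continuous_measurable_fun; exact: continuous_sin.
split; apply: (measurable_funM me).
  exact: (measurableT_comp mcs f2).
exact: (measurableT_comp ms f2).
Qed.

Lemma mc_cabs2 F : mc F -> mc (fun p => (cabs (F p) ^+ 2)%:C).
Proof.
move=> mF; have := mcM mF (mc_conj mF).
by congr mc; apply/funext => z; rewrite cabs_sqrC.
Qed.

Lemma mc_cabs F : mc F -> mc (fun p => (cabs (F p))%:C).
Proof.
move=> mF; have := mc_real (h := Num.sqrt) _ (mc_cabs2 mF).
move/(_ _)/wrap => [|H].
  by apply: continuous_measurable_fun; exact: sqrt_continuous.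
by move: H; congr mc; apply/funext => z /=; rewrite sqrtr_sqr ger0_norm ?cabs_ge0.
Qed.

Lemma mcV F : mc F -> mc (fun p => (F p)^-1).
Proof.
move=> mF; have := mcM (mc_conj mF) (mc_real (h := fun x => x `^ (-1)) (measurable_powR _) (mc_cabs2 mF)).
congr mc; apply/funext => z /=.
rewrite powR_inv1 ?sqr_ge0 //; have [->|n0] := eqVneq (F z) 0.
  by rewrite conjc0 mul0r invr0.
rewrite fmorphV /= cabs_sqrC; field.
by rewrite n0 conjc_eq0.
Qed.
End Generic.

Implicit Types f g : C -> C.
Lemma mC_cst (c : C) : measurableC (fun _ => c).
Proof. exact: mc_cst. Qed.
Lemma mC_id : measurableC (@id C).
Proof. by split; [exact: measurable_fst|exact: measurable_snd]. Qed.
Lemma mC_conj f : measurableC f -> measurableC (fun z => conjc (f z)).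
Proof. exact: mc_conj. Qed.
Lemma mC_add f g : measurableC f -> measurableC g -> measurableC (fun z => f z + g z).
Proof. exact: mcD. Qed.
Lemma mC_mul f g : measurableC f -> measurableC g -> measurableC (fun z => f z * g z).
Proof. exact: mcM. Qed.
Lemma mC_sub f g : measurableC f -> measurableC g -> measurableC (fun z => f z - g z).
Proof. exact: mcB. Qed.
Lemma mC_real (h : R -> R) f :
  measurable_fun setT (h : measurableTypeR R -> measurableTypeR R) ->
  measurableC f -> measurableC (fun z => (h (Re (f z)))%:C).
Proof. exact: mc_real. Qed.
Lemma mC_cexp f : measurableC f -> measurableC (fun z => cexp (f z)).
Proof. exact: mc_cexp. Qed.
Lemma mC_cabs2 f : measurableC f -> measurableC (fun z => (cabs (f z) ^+ 2)%:C).
Proof. exact: mc_cabs2. Qed.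
Lemma mC_cabs f : measurableC f -> measurableC (fun z => (cabs (f z))%:C).
Proof. exact: mc_cabs. Qed.
Lemma mC_inv f : measurableC f -> measurableC (fun z => (f z)^-1).
Proof. exact: mcV. Qed.
Lemma mC_cabs_fun f : measurableC f ->
  measurable_fun setT (fun p : RxR => cabs (f (toC p)) : measurableTypeR R).
Proof. by move=> mf; case: (mC_cabs mf). Qed.
End MeasurableC.

(** * Weighted mean value formula on squares *)

Section MeanValue.
Variable R : realType.
Local Notation C := R[i].
Local Notation RxR := (measurableTypeR R * measurableTypeR R)%type.

Lemma rcont_bounded (f : RxR -> R) : (forall x y, rcont f x y) ->
  forall M : R, exists B : R, forall x y : R, `|x| <= M -> `|y| <= M -> `|f (x, y)| <= B.
Proof.
move=> cf M.
have [M0|M0] := ltP M 0.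
  by exists 0 => x y xM; move: (le_lt_trans xM M0); rewrite ltNge normr_ge0.
suff [B HB] : exists B, forall x y, - M <= x <= M -> - M <= y <= M -> `|f (x, y)| <= B.
  by exists B => x y hx hy; apply: HB; rewrite -ler_norml.
apply: (@bisection R (fun a b c d => exists B, forall x y, a <= x <= b -> c <= y <= d -> `|f (x, y)| <= B)); try lra.
  move=> a b c d ab cd [B1 H1] [B2 H2] [B3 H3] [B4 H4].
  exists (Num.max (Num.max B1 B2) (Num.max B3 B4)) => x y /andP[ax xb] /andP[cy yd].
  rewrite !le_max; case: (leP x ((a + b) / 2)) => hx; case: (leP y ((c + d) / 2)) => hy.
  - by rewrite H1 ?ax ?cy.
  - by rewrite H3 ?ax ?yd ?(ltW hy) ?orbT.
  - by rewrite H2 ?xb ?cy ?(ltW hx) ?orbT.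
  - by rewrite H4 ?xb ?yd ?(ltW hx) ?(ltW hy) ?orbT.
move=> x y _ _; have [r r0 Hr] := cf x y 1 ltr01; exists r => //.
move=> a b c d _ /andP[ax xb] _ _ /andP[cy yd] _ ba dc.
exists (`|f (x, y)| + 1) => x' y' /andP[? ?] /andP[? ?].
have := Hr x' y' ltac:(rewrite ltr_norml; lra) ltac:(rewrite ltr_norml; lra).
have := ler_normD (f (x', y') - f (x, y)) (f (x, y)); rewrite subrK; lra.
Qed.

Lemma cabs_small (x y r : R) : `|x| < r / 2 -> `|y| < r / 2 -> cabs (x +i* y) < r.
Proof. by move=> hx hy; apply: (le_lt_trans (cabs_le _)) => /=; lra. Qed.

(** [A + D] is the derivative in x and [i (A - D)] the derivative in y. *)
Lemma wirt_rdiff (F : C -> C) x y A D : wirt F (x +i* y) A D ->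
  rdiff (fun p : RxR => Re (F (toC p))) x y (Re (A + D)) (- Im (A - D)) /\
  rdiff (fun p : RxR => Im (F (toC p))) x y (Im (A + D)) (Re (A - D)).
Proof.
move=> H; split=> e e0; have [d d0 {}H] := H e e0; (exists (d / 2); first by lra) => a b ha hb.
  have {}H := H (a +i* b) (cabs_small ha hb).
  rewrite /toC /=; apply: (le_trans _ (ler_wpM2l (ltW e0) (cabs_le ((a +i* b) - (x +i* y))))) => /=.
  apply: le_trans H; apply: le_trans (Re_le_cabs _).
  move: A D => [A1 A2] [D1 D2] /=; case: (F _) (F _) => [f1 f2] [g1 g2] /=.
  by rewrite le_eqVlt; apply/orP; left; apply/eqP; congr (Num.norm _); ring.
have {}H := H (a +i* b) (cabs_small ha hb).
rewrite /toC /=; apply: (le_trans _ (ler_wpM2l (ltW e0) (cabs_le ((a +i* b) - (x +i* y))))) => /=.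
apply: le_trans H; apply: le_trans (Im_le_cabs _).
move: A D => [A1 A2] [D1 D2] /=; case: (F _) (F _) => [f1 f2] [g1 g2] /=.
by rewrite le_eqVlt; apply/orP; left; apply/eqP; congr (Num.norm _); ring.
Qed.

Definition ccont (F : C -> C) z0 := forall e : R, 0 < e -> exists2 d : R, 0 < d & forall z,
    cabs (z - z0) < d -> cabs (F z - F z0) <= e.

Lemma wirt_ccont F z0 A D : wirt F z0 A D -> ccont F z0.
Proof.
move=> /wirt_lip[d d0 H] e e0; set L := _ + _ + 1 in H.
have L0 : 0 < L by have := cabs_ge0 A; have := cabs_ge0 D; rewrite /L; lra.
exists (Num.min d (e / L)); first by rewrite lt_min d0 divr_gt0.
move=> z; rewrite lt_min => /andP[/H {}H h2]; apply: (le_trans H).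
by rewrite mulrC -ler_pdivlMr // ltW.
Qed.

Lemma ccont_rcont F x y : ccont F (x +i* y) ->
  rcont (fun p : RxR => Re (F (toC p))) x y /\ rcont (fun p : RxR => Im (F (toC p))) x y.
Proof.
move=> H; split=> e e0; have [d d0 {}H] := H e e0; (exists (d / 2); first by lra) => a b ha hb;
  (apply: le_trans (H (a +i* b) (cabs_small ha hb)));
  [apply: le_trans (Re_le_cabs _)|apply: le_trans (Im_le_cabs _)];
  by rewrite /toC /=; case: (F _) (F _) => [? ?] [? ?].
Qed.
Lemma rcont_cmul k (f : RxR -> R) x y : rcont f x y -> rcont (fun p => k * f p) x y.
Proof.
move=> cf e e0; have k0 : 0 < `|k| + 1 by have := normr_ge0 k; lra.
have [r r0 H] := cf (e / (`|k| + 1)) (divr_gt0 e0 k0); exists r => // a b ha hb.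
rewrite -mulrBr normrM; apply: (le_trans (ler_wpM2l (normr_ge0 _) (H a b ha hb))).
by rewrite mulrA ler_pdivrMr // mulrC ler_wpM2l ?(ltW e0) //; lra.
Qed.

Lemma ccontM F G z0 : ccont F z0 -> ccont G z0 -> ccont (fun z => F z * G z) z0.
Proof.
move=> cF cG e e0.
have f0 : 0 < cabs (F z0) + 1 by have := cabs_ge0 (F z0); lra.
have g0 : 0 < cabs (G z0) + 1 by have := cabs_ge0 (G z0); lra.
have e2 : 0 < e / 2 by lra.
have [d1 d10 {}cF] := cF (Num.min 1 (e / 2 / (cabs (G z0) + 1))) ltac:(by rewrite lt_min ltr01 divr_gt0).
have [d2 d20 {}cG] := cG (e / 2 / (cabs (F z0) + 1)) (divr_gt0 e2 f0).
exists (Num.min d1 d2); first by rewrite lt_min d10.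
move=> z; rewrite lt_min => /andP[/cF + /cG {}cG]; rewrite le_min => /andP[c1 c2].
have -> : F z * G z - F z0 * G z0 = (F z - F z0) * G z0 + F z * (G z - G z0) by ring.
have fz : cabs (F z) <= cabs (F z0) + 1.
  by have := cabsD (F z - F z0) (F z0); rewrite subrK; lra.
apply: (le_trans (cabsD _ _)); rewrite !cabsM.
rewrite ler_pdivlMr // in c2; rewrite ler_pdivlMr // in cG.
have := cabs_ge0 (F z - F z0); have := cabs_ge0 (G z - G z0); have := cabs_ge0 (G z0); nra.
Qed.

Lemma ccont_cst c z0 : ccont (fun _ => c) z0.
Proof. by move=> e e0; exists 1 => // z _; rewrite subrr cabs0 ltW. Qed.
Lemma ccontB F G z0 : ccont F z0 -> ccont G z0 -> ccont (fun z => F z - G z) z0.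
Proof.
move=> cF cG e e0; have e2 : 0 < e / 2 by lra.
have [d1 d10 {}cF] := cF _ e2; have [d2 d20 {}cG] := cG _ e2.
exists (Num.min d1 d2); first by rewrite lt_min d10.
move=> z; rewrite lt_min => /andP[/cF {}cF /cG {}cG].
have -> : F z - G z - (F z0 - G z0) = (F z - F z0) - (G z - G z0) by ring.
by have := cabsBD (F z - F z0) (G z - G z0); lra.
Qed.

Lemma ccont_real (h : R -> R) F z0 : {for Re (F z0), continuous h} -> ccont F z0 ->
  ccont (fun z => (h (Re (F z)))%:C) z0.
Proof.
move=> ch cF e e0; move/cvgrPdist_le : ch => /(_ e e0)/nbhs_ballP[r /= r0 Hr].
have r2 : 0 < r / 2 by lra.
have [d d0 {}cF] := cF _ r2; exists d => // z /cF {}cF.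
rewrite -rmorphB cabsR distrC; apply: Hr => /=; rewrite /ball /= distrC.
have := Re_le_cabs (F z - F z0); case: (F z) (F z0) cF => [? ?] [? ?] /=; lra.
Qed.

Lemma ccont_bounded (F : C -> C) : (forall z, ccont F z) ->
  forall M : R, exists2 B : R, 0 <= B & forall z, `|Re z| <= M -> `|Im z| <= M -> cabs (F z) <= B.
Proof.
move=> cF M.
have [B1 H1] := rcont_bounded (fun x y => (ccont_rcont (cF (x +i* y))).1) M.
have [B2 H2] := rcont_bounded (fun x y => (ccont_rcont (cF (x +i* y))).2) M.
exists (`|B1| + `|B2|) => [|[x y] /= hx hy]; first by rewrite addr_ge0.
apply: (le_trans (cabs_le _)); apply: lerD.
  by apply: le_trans (H1 x y hx hy) (ler_norm _).
by apply: le_trans (H2 x y hx hy) (ler_norm _).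
Qed.

Definition box (z0 : C) (r : R) : set RxR := rect (Re z0 - r) (Re z0 + r) (Im z0 - r) (Im z0 + r).

(** The perimeter is 8r. The bound is required only on the boundary of the square, where the
    singularity at the centre and the size of F inside do not enter. *)
Lemma bdry_bound (P Q : RxR -> R) (x0 y0 r B : R) : 0 < r -> locbm P -> locbm Q ->
  (forall p, (`|p.1 - x0| <= r /\ `|p.2 - y0| = r) \/
             (`|p.1 - x0| = r /\ `|p.2 - y0| <= r) -> `|P p| <= B /\ `|Q p| <= B) ->
  `|bdry P Q (x0 - r) (x0 + r) (y0 - r) (y0 + r)| <= 8 * r * B.
Proof.
move=> r0 lP lQ H.
have ab : x0 - r <= x0 + r by lra.
have cd : y0 - r <= y0 + r by lra.
have nr : `|y0 - r - y0| = r by rewrite addrAC subrr add0r normrN gtr0_norm.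
have nr' : `|y0 + r - y0| = r by rewrite addrAC subrr add0r gtr0_norm.
have nr2 : `|x0 - r - x0| = r by rewrite addrAC subrr add0r normrN gtr0_norm.
have nr2' : `|x0 + r - x0| = r by rewrite addrAC subrr add0r gtr0_norm.
have B1 : `|\int[@lebesgue_measure R]_(x in `[(x0 - r), (x0 + r)[) (P (x, y0 - r) - P (x, y0 + r)) - 0 * ((x0 + r) - (x0 - r))| <=
    (2 * B) * ((x0 + r) - (x0 - r)).
  apply: Rint_near_cst; [exact: measurable_itv|exact: lebesgue_co|exact: locbmB_int_x|].
  move=> x /=; rewrite in_itv /= => /andP[hx1 /ltW hx2]; rewrite subr0.
  have xx : `|x - x0| <= r by rewrite ler_norml; lra.
  apply: (le_trans (ler_normB _ _)); rewrite mulr_natl mulr2n; apply: lerD.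
    by have [] := H (x, y0 - r) (or_introl (conj xx nr)).
  by have [] := H (x, y0 + r) (or_introl (conj xx nr')).
have B2 : `|\int[@lebesgue_measure R]_(y in `[(y0 - r), (y0 + r)[) (Q (x0 + r, y) - Q (x0 - r, y)) - 0 * ((y0 + r) - (y0 - r))| <=
    (2 * B) * ((y0 + r) - (y0 - r)).
  apply: Rint_near_cst; [exact: measurable_itv|exact: lebesgue_co|exact: locbmB_int_y|].
  move=> y /=; rewrite in_itv /= => /andP[hy1 /ltW hy2]; rewrite subr0.
  have yy : `|y - y0| <= r by rewrite ler_norml; lra.
  apply: (le_trans (ler_normB _ _)); rewrite mulr_natl mulr2n; apply: lerD.
    by have [] := H (x0 + r, y) (or_intror (conj nr2' yy)).
  by have [] := H (x0 - r, y) (or_intror (conj nr2 yy)).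
rewrite !mul0r !subr0 in B1 B2.
rewrite /bdry; apply: (le_trans (ler_normD _ _)); apply: (le_trans (lerD B1 B2)).
by rewrite le_eqVlt; apply/orP; left; apply/eqP; ring.
Qed.

Section Box.
Variables (g : C -> C) (z0 : C) (h h' : R -> R).
Hypothesis gE : forall z, exists A, wirt g z A 0.
Hypothesis mg : measurableC g.
Hypothesis dh : forall x, is_derive (x : R) 1 h (h' x).
Hypothesis ch' : continuous h'.

(** Subtracting g z0 keeps F bounded near z0, so the Cauchy kernel leaves no residue there; at z0
    itself F is 0, because 0^-1 = 0. *)
Let F z := (g z - g z0) * (z - z0)^-1 * (h (cabs (z - z0) ^+ 2))%:C.
(** The derivative of F in conj(z): that of the radial factor is h' times z - z0, which cancels the
    denominator. *)
Let D z := (g z - g z0) * (h' (cabs (z - z0) ^+ 2))%:C.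

Let N z : C := (z - z0) * conjc (z - z0).
Let NE z : cabs (z - z0) ^+ 2 = Re (N z).
Proof. by rewrite /N -cabs_sqrC. Qed.

Let wirtN z : wirt N z (conjc (z - z0)) (z - z0).
Proof.
have h1 : wirt (fun z => z - z0) z 1 0.
  by have := wirtD (wirt_id z) (wirt_cst (- z0) z); rewrite !addr0.
have h2 := wirtM h1 (wirt_comp h1 (wirt_conj _)).
have := h2; rewrite conjc0 conjc1 !(mul0r, mulr0, addr0, add0r, mul1r, mulr1).
exact.
Qed.

Let wirth z : wirt (fun z => (h (cabs (z - z0) ^+ 2))%:C) z
  ((h' (cabs (z - z0) ^+ 2))%:C * conjc (z - z0)) ((h' (cabs (z - z0) ^+ 2))%:C * (z - z0)).
Proof.
have nE : N z = (cabs (z - z0) ^+ 2) +i* 0 by rewrite /N -cabs_sqrC.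
have := @wirt_real R h _ _ (dh (cabs (z - z0) ^+ 2)) 0; rewrite -nE => wr.
have := wirt_comp (wirtN z) wr; set k := (_ / 2)%:C.
have k2 : (h' (cabs (z - z0) ^+ 2))%:C = k + k by rewrite /k -rmorphD /=; congr (_ %:C); field.
rewrite conjcK -!mulrDl -k2.
by apply: wirt_ext => w /=; rewrite NE.
Qed.

Let wirtF z : z != z0 -> exists A, wirt F z A (D z).
Proof.
move=> zz0; have nz : z - z0 != 0 by rewrite subr_eq0.
have [A wg] := gE z.
have h1 : wirt (fun z => g z - g z0) z A 0.
  by have := wirtD wg (wirt_cst (- g z0) z); rewrite !addr0.
have h2 : wirt (fun z => (z - z0)^-1) z (- (z - z0) ^- 2) 0.
  have h3 : wirt (fun z => z - z0) z 1 0.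
    by have := wirtD (wirt_id z) (wirt_cst (- z0) z); rewrite !addr0.
  by have := wirt_comp h3 (wirt_inv nz); rewrite !(mulr0, mul0r, addr0, mulr1).
have := wirtM (wirtM h1 h2) (wirth z).
rewrite !(mulr0, mul0r, addr0, add0r).
set A' := (X in wirt _ _ X _ -> _); set D' := (X in wirt _ _ _ X -> _) => w.
exists A'; rewrite /D; have -> // : (g z - g z0) * (h' (cabs (z - z0) ^+ 2))%:C = D'.
by rewrite /D'; field.
Qed.

Let gcont z : ccont g z.
Proof. by have [A /wirt_ccont] := gE z. Qed.

Let Dcont z : ccont D z.
Proof.
apply: ccontM; first exact: ccontB (gcont z) (ccont_cst _ _).
rewrite (_ : (fun z => _) = (fun z => (h' (Re (N z)))%:C)); last by apply/funext => w; rewrite NE.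
by apply: ccont_real; [exact: ch'|exact: wirt_ccont (wirtN z)].
Qed.

Let mh : measurable_fun setT (h : measurableTypeR R -> measurableTypeR R).
Proof.
by apply: continuous_measurable_fun => x; apply: differentiable_continuous; apply/derivable1_diffP; case: (dh x).
Qed.

Let mF : measurableC F.
Proof.
apply: mC_mul; first apply: mC_mul.
- exact: mC_sub mg (mC_cst _).
- by apply: mC_inv; exact: mC_sub (mC_id _) (mC_cst _).
rewrite (_ : (fun z => _) = (fun z => (h (Re (N z)))%:C)); last by apply/funext => w; rewrite NE.
apply: mC_real => //; apply: mC_mul; last apply: mC_conj; exact: mC_sub (mC_id _) (mC_cst _).
Qed.

Let mD : measurableC D.
Proof.
apply: mC_mul; first exact: mC_sub mg (mC_cst _).
rewrite (_ : (fun z => _) = (fun z => (h' (Re (N z)))%:C)); last by apply/funext => w; rewrite NE.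
apply: mC_real; first exact: continuous_measurable_fun.
apply: mC_mul; last apply: mC_conj; exact: mC_sub (mC_id _) (mC_cst _).
Qed.

Let bF M : exists2 B : R, 0 <= B & forall z, `|Re z| <= M -> `|Im z| <= M -> cabs (F z) <= B.
Proof.
have [A wg] := gE z0; have [d d0 Hd] := wirt_lip wg; set L := _ + _ + 1 in Hd.
have L0 : 0 < L by have := cabs_ge0 A; have := cabs_ge0 (0:C); rewrite /L; lra.
have [B1 B10 H1] := @ccont_bounded (fun z => g z - g z0) (fun z => ccontB (gcont z) (ccont_cst _ _)) M.
have [B2 B20 H2] := @ccont_bounded _ (fun z => wirt_ccont (wirth z)) M.
exists (L * B2 + B1 / d * B2); first by rewrite addr_ge0 ?mulr_ge0 ?(ltW L0) // invr_ge0 ltW.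
move=> z hx hy; have {}H1 := H1 z hx hy; have {}H2 := H2 z hx hy.
rewrite /F cabsM.
have [->|zz0] := eqVneq z z0.
  rewrite subrr mul0r cabs0 mul0r addr_ge0 ?mulr_ge0 ?(ltW L0) // invr_ge0 ltW //.
have c0 : 0 < cabs (z - z0) by rewrite cabs_gt0 // subr_eq0.
have BB : 0 <= L * B2 /\ 0 <= B1 / d * B2.
  by split; rewrite ?mulr_ge0 ?(ltW L0) // invr_ge0 ltW.
rewrite cabsM cabsV; have [hd|hd] := ltP (cabs (z - z0)) d.
  apply: (@le_trans _ _ (L * B2)); last by lra.
  apply: ler_pM; rewrite ?cabs_ge0 ?mulr_ge0 ?cabs_ge0 ?invr_ge0 ?cabs_ge0 //.
  by rewrite ler_pdivrMr //; exact: Hd.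
apply: (@le_trans _ _ (B1 / d * B2)); last by lra.
apply: ler_pM; rewrite ?cabs_ge0 ?mulr_ge0 ?cabs_ge0 ?invr_ge0 ?cabs_ge0 //.
by apply: ler_pM; rewrite ?cabs_ge0 ?invr_ge0 ?cabs_ge0 // lef_pV2.
Qed.

Let lbRe (f : C -> C) : measurableC f ->
  (forall M, exists2 B : R, 0 <= B & forall z, `|Re z| <= M -> `|Im z| <= M -> cabs (f z) <= B) ->
  locbm (fun p : RxR => Re (f (toC p))) /\ locbm (fun p : RxR => Im (f (toC p))).
Proof.
move=> [m1 m2] b; split; split=> // M; have [B _ HB] := b M; exists B => x y hx hy.
  exact: (le_trans (Re_le_cabs _) (HB (x +i* y) hx hy)).
exact: (le_trans (Im_le_cabs _) (HB (x +i* y) hx hy)).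
Qed.

Let locbm_cmul k (f : RxR -> R) : locbm f -> locbm (fun p => k * f p).
Proof.
move=> [m b]; split.
  by apply: measurable_funM m; exact: measurable_cst.
by move=> M; have [B HB] := b M; exists (`|k| * B) => x y hx hy; rewrite normrM ler_wpM2l ?HB.
Qed.

(* F is continuous and d F / d conj(z) = D away from z0, so Green's formula trades the
   integral of D over the box for a boundary integral of F. *)
Lemma mean_box r B : 0 < r ->
  (forall z, (`|Re z - Re z0| <= r /\ `|Im z - Im z0| = r) \/
             (`|Re z - Re z0| = r /\ `|Im z - Im z0| <= r) ->
     cabs ((g z - g z0) * (z - z0)^-1 * (h (cabs (z - z0) ^+ 2))%:C) <= B) ->
  `|\int[@lebC R]_(p in box z0 r) Re ((g (toC p) - g z0) * (h' (cabs (toC p - z0) ^+ 2))%:C)| <= 4 * r * B /\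
  `|\int[@lebC R]_(p in box z0 r) Im ((g (toC p) - g z0) * (h' (cabs (toC p - z0) ^+ 2))%:C)| <= 4 * r * B.
Proof.
move=> r0 HB.
have [lFr lFi] := lbRe mF bF.
have [lDr lDi] := lbRe mD (ccont_bounded Dcont).
have neq x y : (x, y) <> (Re z0, Im z0) -> x +i* y != z0.
  by move=> h1; apply/eqP => h2; apply: h1; rewrite -h2.
split.
  (* The imaginary part of the identity between the circulation of F dz and 2i times the integral of
     D. *)
  have H := @green_puncture R (fun p => Im (F (toC p))) (fun p => Re (F (toC p)))
    (fun p => 2 * Re (D (toC p))) (Re z0) (Im z0) r lFi lFr (locbm_cmul 2 lDr) r0.
  have {}H := H _; move: H => /(_ _)/wrap[|].
    move=> x y /neq /wirtF[A wA]; have [d1 d2] := wirt_rdiff wA.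
    exists (Im (A + D (x +i* y))), (Re (A - D (x +i* y))), (Re (A + D (x +i* y))), (- Im (A - D (x +i* y))).
    split => //; first by apply: rcont_cmul; exact: (ccont_rcont (Dcont _)).1.
    by rewrite /toC /=; move: (D _) A {wA d1 d2} => [? ?] [? ?] /=; ring.
  rewrite /green => /eqP; rewrite subr_eq0 => /eqP E.
  have := @bdry_bound _ _ (Re z0) (Im z0) r B r0 lFi lFr.
  move=> /(_ _)/wrap[|].
    move=> p hp; have := HB (toC p) hp; rewrite -/(F (toC p)) => hF.
    by split; [exact: le_trans (Im_le_cabs _) hF|exact: le_trans (Re_le_cabs _) hF].
  rewrite E RintegralZl; last 2 first.
  - exact: measurable_rect.
  - by apply: locbm_int_rect => //; lra.
  rewrite normrM ger0_norm //; rewrite -/(box z0 r) /D; lra.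
(* The real part of the same identity. *)
have H := @green_puncture R (fun p => Re (F (toC p))) (fun p => -1 * Im (F (toC p)))
    (fun p => -2 * Im (D (toC p))) (Re z0) (Im z0) r lFr (locbm_cmul (-1) lFi) (locbm_cmul (-2) lDi) r0.
have {}H := H _; move: H => /(_ _)/wrap[|].
  move=> x y /neq /wirtF[A wA]; have [d1 d2] := wirt_rdiff wA.
  exists (Re (A + D (x +i* y))), (- Im (A - D (x +i* y))), (- Im (A + D (x +i* y))), (- Re (A - D (x +i* y))).
  split => //.
  - move=> e e0; have [s s0 Hs] := d2 e e0; exists s => // a b ha hb.
    apply: le_trans (Hs a b ha hb); rewrite -normrN.
    by rewrite le_eqVlt; apply/orP; left; apply/eqP; congr (Num.norm _); ring.
  - by apply: rcont_cmul; exact: (ccont_rcont (Dcont _)).2.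
  by rewrite /toC /=; move: (D _) A {wA d1 d2} => [? ?] [? ?] /=; ring.
rewrite /green => /eqP; rewrite subr_eq0 => /eqP E.
have := @bdry_bound _ _ (Re z0) (Im z0) r B r0 lFr (locbm_cmul (-1) lFi).
move=> /(_ _)/wrap[|].
  move=> p hp; have := HB (toC p) hp; rewrite -/(F (toC p)) => hF.
  by split; rewrite ?normrM ?normrN1 ?mul1r; [exact: le_trans (Re_le_cabs _) hF|exact: le_trans (Im_le_cabs _) hF].
rewrite E RintegralZl; last 2 first.
- exact: measurable_rect.
- by apply: locbm_int_rect => //; lra.
have n2 : `|-2| = 2 :> R by rewrite ler0_norm ?opprK //; lra.
rewrite normrM n2; rewrite -/(box z0 r) /D; lra.
Qed.
End Box.
End MeanValue.

(** * Pointwise bounds in the Bargmann-Fock space *)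

Section PlaneIntegrals.
Variable R : realType.
Local Notation C := R[i].
Local Notation leb := (@lebesgue_measure R).
Local Notation RxR := (measurableTypeR R * measurableTypeR R)%type.
Local Notation lebC := (@lebC R).

Lemma integral_gauss_centered (m s : R) : s != 0 ->
  (\int[leb]_x (expR (- (x - m) ^+ 2 / (s ^+ 2 *+ 2)))%:E = (Num.sqrt (s ^+ 2 * pi *+ 2))%:E)%E.
Proof.
move=> s0; have := integral_normal_pdf m s.
under eq_integral do rewrite normal_pdfE // EFinM.
rewrite ge0_integralZl //=; last 3 first.
- by apply/measurable_EFinP; exact: measurable_normal_fun.
- by move=> x _; rewrite lee_fin expR_ge0.
- by rewrite lee_fin normal_peak_ge0.
have p0 := normal_peak_gt0 s0; rewrite /normal_fun.
set I := integral _ _ _ => H.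
have : ((Num.sqrt (s ^+ 2 * pi *+ 2))%:E * ((normal_peak s)%:E * I) = (Num.sqrt (s ^+ 2 * pi *+ 2))%:E)%E.
  by rewrite H mule1.
rewrite muleA -EFinM /normal_peak divff ?mul1e //.
by rewrite gt_eqF // -invr_gt0.
Qed.

Lemma lebC_integral_prod (f g : R -> R) (a b : R) :
  measurable_fun setT (f : measurableTypeR R -> measurableTypeR R) ->
  measurable_fun setT (g : measurableTypeR R -> measurableTypeR R) ->
  (forall x, 0 <= f x) -> (forall x, 0 <= g x) ->
  (\int[leb]_x (f x)%:E = a%:E)%E -> (\int[leb]_x (g x)%:E = b%:E)%E ->
  (\int[lebC]_p (f p.1 * g p.2)%:E = (a * b)%:E)%E.
Proof.
move=> mf mg f0 g0 fa gb; rewrite /lebC.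
have := @fubini_tonelli1 _ _ _ _ R leb leb (fun p : RxR => (f p.1 * g p.2)%:E) _ _.
move=> /(_ _ _)/wrap[||->].
- apply/measurable_EFinP; apply: measurable_funM.
    exact: (measurableT_comp mf measurable_fst).
  exact: (measurableT_comp mg measurable_snd).
- by move=> p; rewrite lee_fin mulr_ge0.
rewrite /fubini_F /=.
transitivity (\int[leb]_x ((f x)%:E * b%:E))%E.
  apply: eq_integral => x _; under eq_integral do rewrite EFinM.
  rewrite ge0_integralZl //= ?gb //; first by apply/measurable_EFinP.
    by move=> y _; rewrite lee_fin.
  by rewrite lee_fin.
rewrite ge0_integralZr //= ?fa //; first by apply/measurable_EFinP.
  by move=> y _; rewrite lee_fin.
by rewrite -gb integral_ge0 // => x _; rewrite lee_fin.
Qed.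

Lemma integrable_ge0 (f : RxR -> R) (a : R) : measurable_fun setT (f : RxR -> measurableTypeR R) ->
  (forall p, 0 <= f p) -> (\int[lebC]_p (f p)%:E <= a%:E)%E -> lebC.-integrable setT (EFin \o f).
Proof.
move=> mf f0 fa; apply/integrableP; split; first by apply/measurable_EFinP.
apply: le_lt_trans (ltry a); apply: le_trans fa.
by apply: ge0_le_integral => //= ; try (by apply/measurable_EFinP; try exact: measurableT_comp);
  move=> p _ /=; rewrite ?lee_fin ?ger0_norm.
Qed.

Lemma le_integrableR d (T : measurableType d) (m : {measure set T -> \bar R}) (f g : T -> R) :
  measurable_fun setT (f : T -> measurableTypeR R) ->
  (forall p, `|f p| <= g p) -> m.-integrable setT (EFin \o g) -> m.-integrable setT (EFin \o f).
Proof.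
move=> mf fg; apply: le_integrable => //; first by apply/measurable_EFinP.
by move=> p _ /=; rewrite lee_fin (le_trans (fg p)) // ler_norm.
Qed.

Lemma gaussC_dist (z0 : C) (p : RxR) : cabs (toC p - z0) ^+ 2 = (p.1 - Re z0) ^+ 2 + (p.2 - Im z0) ^+ 2.
Proof. by case: z0 p => a b [x y]; rewrite cabs_sqr. Qed.

Lemma integral_gaussC (z0 : C) :
  (\int[lebC]_p (expR (- cabs (toC p - z0) ^+ 2))%:E = pi%:E)%E.
Proof.
(* The standard deviation for which the Gaussian exponent is exactly -(x - m)^2. *)
pose s : R := Num.sqrt 2^-1.
have s2 : s ^+ 2 *+ 2 = 1 by rewrite sqr_sqrtr // -mulr_natr mulVf.
have s0 : s != 0 by rewrite sqrtr_eq0 -ltNge.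
pose f (m : R) (x : R) : R := expR (- (x - m) ^+ 2).
have fE m : (\int[leb]_x (f m x)%:E = (Num.sqrt pi)%:E)%E.
  have := integral_gauss_centered m s0; rewrite s2 -mulrnAl s2 mul1r => <-.
  by apply: eq_integral => x _; rewrite divr1.
have mf m : measurable_fun setT (f m : measurableTypeR R -> measurableTypeR R).
  have h : measurable_fun setT (fun x : R => - (x - m) ^+ 2).
    by apply: measurable_funN; apply: measurable_funX; apply: measurable_funB.
  have h2 := measurableT_comp (@measurable_expR R) h; exact h2.
have := lebC_integral_prod (mf (Re z0)) (mf (Im z0)) (fun x => expR_ge0 _) (fun x => expR_ge0 _) (fE _) (fE _).
rewrite -expr2 sqr_sqrtr ?pi_ge0 // => <-.
by apply: eq_integral => p _; rewrite /f -expRD gaussC_dist opprD.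
Qed.

Lemma integrable_gaussC (z0 : C) :
  lebC.-integrable setT (EFin \o (fun p : RxR => expR (- cabs (toC p - z0) ^+ 2 / 2))).
Proof.
have s0 : (1 : R) != 0 by [].
pose f (m : R) (x : R) : R := expR (- (x - m) ^+ 2 / 2).
have fE m : (\int[leb]_x (f m x)%:E = (Num.sqrt (1 ^+ 2 * pi *+ 2))%:E)%E.
  by have := integral_gauss_centered m s0; rewrite expr1n => <-.
have mf m : measurable_fun setT (f m : measurableTypeR R -> measurableTypeR R).
  have h : measurable_fun setT (fun x : R => - (x - m) ^+ 2 / 2).
    by apply: measurable_funM => //; apply: measurable_funN; apply: measurable_funX; apply: measurable_funB.
  have h2 := measurableT_comp (@measurable_expR R) h; exact h2.
have := lebC_integral_prod (mf (Re z0)) (mf (Im z0)) (fun x => expR_ge0 _) (fun x => expR_ge0 _) (fE _) (fE _).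
set a := _ * _ => H.
have E : (fun p : RxR => expR (- cabs (toC p - z0) ^+ 2 / 2)) = (fun p : RxR => f (Re z0) p.1 * f (Im z0) p.2).
  by apply/funext => p; rewrite /f -expRD gaussC_dist opprD mulrDl.
rewrite E; apply: (@integrable_ge0 _ a).
- apply: measurable_funM.
    exact: (measurableT_comp (mf _) measurable_fst).
  exact: (measurableT_comp (mf _) measurable_snd).
- by move=> p; rewrite mulr_ge0 // expR_ge0.
by rewrite H.
Qed.

(** Dominated by a multiple of 1 / ((1 + x^2) (1 + y^2)), whose factors are integrated by the
    arctangent. *)
Lemma integrable_exp_cabs (k : R) : 0 < k ->
  lebC.-integrable setT (EFin \o (fun p : RxR => expR (- k * cabs (toC p)))).
Proof.
move=> k0; pose f (x : R) : R := (oneDsqr x)^-1.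
have fE : (\int[leb]_x (f x)%:E = pi%:E)%E.
  rewrite ge0_symfun_integralT //=.
  - rewrite (_ : [set x | _] = `[0, +oo[%classic); last first.
      by apply/seteqP; split => x /=; rewrite in_itv /= andbT.
    by rewrite integral0y_oneDsqr -EFinM mulrCA divff // mulr1.
  - by move=> x; rewrite invr_ge0 ltW.
  - exact: continuous_oneDsqrV.
  - by move=> x /=; rewrite /f /oneDsqr sqrrN.
have mf : measurable_fun setT (f : measurableTypeR R -> measurableTypeR R).
  by apply: continuous_measurable_fun; exact: continuous_oneDsqrV.
have f0 x : 0 <= f x by rewrite invr_ge0 ltW.
have H := lebC_integral_prod mf mf f0 f0 fE fE.
(* Chosen for c (1 + r^2) <= (1 + k r / 4)^2 <= exp(k r / 2). The square of this bound suffices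
   since (1 + x^2) (1 + y^2) <= (1 + r^2)^2. *)
pose c := Num.min 1 (k ^+ 2 / 16); have c0 : 0 < c.
  by rewrite lt_min ltr01 divr_gt0 // exprn_gt0.
apply: (@le_integrableR _ _ _ _ (fun p : RxR => c ^- 2 * (f p.1 * f p.2))).
- have mk : measurableC (fun z : C => (expR (- k * Re (cabs z)%:C))%:C).
    apply: (mC_real (h := fun x => expR (- k * x))); last exact: mC_cabs (mC_id _).
    apply: continuous_measurable_fun => x; apply: continuous_comp; [|exact: continuous_expR].
    by apply: continuousM; [exact: cvg_cst|exact: cvg_id].
  by case: mk.
- move=> [x y] /=; rewrite ger0_norm ?expR_ge0 //.
  set r := cabs _; have r0 : 0 <= r := cabs_ge0 _.
  have r2 : r ^+ 2 = x ^+ 2 + y ^+ 2 by rewrite /r cabs_sqr.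
  have key : c * (1 + r ^+ 2) <= expR (k * r / 2).
    have -> : expR (k * r / 2) = expR (k * r / 4) ^+ 2 by rewrite -expRM_natl; congr expR; field.
    have h1 : 1 + k * r / 4 <= expR (k * r / 4) by exact: expR_ge1Dx.
    have h2 : 0 <= k * r / 4 by rewrite divr_ge0 // mulr_ge0 // ltW.
    have h3 : 1 + (k ^+ 2 / 16) * r ^+ 2 <= expR (k * r / 4) ^+ 2.
      apply: (@le_trans _ _ ((1 + k * r / 4) ^+ 2)); last by rewrite ler_pXn2r // nnegrE ?expR_ge0; lra.
      have -> : (1 + k * r / 4) ^+ 2 = 1 + k ^+ 2 / 16 * r ^+ 2 + 2 * (k * r / 4) by field.
      lra.
    apply: le_trans h3; rewrite mulrDr mulr1; apply: lerD; first by rewrite ge_min lexx.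
    by rewrite ler_wpM2r ?sqr_ge0 // ge_min lexx orbT.
  have -> : expR (- k * r) = (expR (k * r / 2) ^+ 2)^-1.
    by rewrite -expRM_natl -expRN; congr expR; field.
  have -> : c ^- 2 * (f x * f y) = (c ^+ 2 * (oneDsqr x * oneDsqr y))^-1 by rewrite !invfM.
  rewrite lef_pV2 ?posrE; last 2 first.
  - by rewrite exprn_gt0 // expR_gt0.
  - by rewrite !mulr_gt0 ?exprn_gt0 // oneDsqr_gt0.
  apply: (@le_trans _ _ ((c * (1 + r ^+ 2)) ^+ 2)); last first.
    by rewrite ler_pXn2r // nnegrE ?expR_ge0 // mulr_ge0 ?(ltW c0) // addr_ge0 // sqr_ge0.
  rewrite exprMn ler_pM2l ?exprn_gt0 // /oneDsqr r2.
  have := sqr_ge0 x; have := sqr_ge0 y; nra.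
have := integrableZl measurableT (c ^- 2) (@integrable_ge0 (fun p : RxR => f p.1 * f p.2) (pi * pi) _ _ _).
apply.
- apply: measurable_funM.
    exact: (measurableT_comp mf measurable_fst).
  exact: (measurableT_comp mf measurable_snd).
- by move=> p; rewrite mulr_ge0.
by rewrite H.
Qed.

Lemma Rint_box_limit (f : RxR -> R) (z0 : C) (c : R) :
  lebC.-integrable setT (EFin \o f) ->
  (forall r, 1 <= r -> `|\int[lebC]_(p in box z0 r) f p| <= c / r) ->
  \int[lebC]_p f p = 0.
Proof.
move=> fi H.
have [mfi _] := integrableP _ _ _ fi.
have mbox r : measurable (box z0 r) by exact: measurable_rect.
have H1 := @dominated_cvg _ _ R lebC setT measurableT
  (fun n => (EFin \o f) \_ (box z0 n.+1%:R)) (EFin \o f) (abse \o (EFin \o f)).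
have {}H1 : (\int[lebC]_x ((EFin \o f) \_ (box z0 n.+1%:R)) x)%E @[n --> \oo] --> (\int[lebC]_x (EFin \o f) x)%E.
  apply: H1.
  - move=> n; apply/(measurable_restrictT _ (mbox _)); apply: measurable_funTS; exact: mfi.
  - move=> p _.
    have E : \forall n \near \oo, ((EFin \o f) \_ (box z0 n.+1%:R)) p = (f p)%:E.
      have [n hn] : exists n : nat, `|p.1 - Re z0| + `|p.2 - Im z0| < n%:R.
        exists (Num.bound (`|p.1 - Re z0| + `|p.2 - Im z0|)).
        by rewrite archi_boundP ?addr_ge0.
      exists n => // k /= nk; rewrite patchE ifT // inE /box /rect /=.
      have kn : (n%:R : R) <= k.+1%:R by rewrite ler_nat (leq_trans nk).
      have h1 := normr_ge0 (p.1 - Re z0); have h2 := normr_ge0 (p.2 - Im z0).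
      have h3 : `|p.1 - Re z0| < k.+1%:R by lra.
      have h4 : `|p.2 - Im z0| < k.+1%:R by lra.
      by split; rewrite /= in_itv /=; move: h3 h4; rewrite !ltr_norml; lra.
    exact: cvg_near_cst E.
  - by move=> p _.
  - exact: integrable_abse.
  - move=> n p _ /=; rewrite patchE; case: ifP => _ //; rewrite abse0 //.
have fin := integrable_fin_num measurableT fi.
have H2 : (\int[lebC]_(p in box z0 n.+1%:R) f p) @[n --> \oo] --> \int[lebC]_p f p.
  have h : (\int[lebC]_x ((EFin \o f) \_ (box z0 n.+1%:R)) x)%E @[n --> \oo] -->
    (\int[lebC]_p f p)%:E by rewrite fineK.
  have -> : (fun n => \int[lebC]_(p in box z0 n.+1%:R) f p) =
      fine \o (fun n => (\int[lebC]_x ((EFin \o f) \_ (box z0 n.+1%:R)) x)%E).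
    by apply/funext => n /=; rewrite -integral_mkcond.
  exact: fine_cvg h.
have H0 : (\int[lebC]_(p in box z0 n.+1%:R) f p) @[n --> \oo] --> (0 : R).
  have ch : c * harmonic n @[n --> \oo] --> (0 : R).
    by rewrite -[X in _ --> X](mulr0 c); apply: cvgM; [exact: cvg_cst|exact: cvg_harmonic].
  apply: (squeeze_cvgr (f := fun n => - (c * harmonic n)) _ _ ch).
    near=> n; have := H n.+1%:R ltac:(by rewrite ler1n); rewrite ler_norml /harmonic.
    by [].
  by rewrite -[X in _ --> X]oppr0; exact: cvgN.
exact: (cvg_unique _ H2 H0).
Unshelve. all: by end_near.
Qed.
End PlaneIntegrals.

(** * Recentring, sup bounds and the reproducing formula *)

Section Fock.
Variable R : realType.
Local Notation C := R[i].
Local Notation leb := (@lebesgue_measure R).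
Local Notation RxR := (measurableTypeR R * measurableTypeR R)%type.
Local Notation lebC := (@lebC R).

(* [wirt g z A 0] says that g is complex differentiable at z, with derivative A. *)
Definition gauss_entire (f : C -> C) : Prop := measurableC f /\
  exists2 g : C -> C, (forall z, exists A, wirt g z A 0) &
    forall z, f z = cexp (- (cabs z ^+ 2 / 2)%:C) * g z.

Lemma fock_gauss_entire f : fock f -> gauss_entire f.
Proof. by move=> [[g /entire_wirt gE fE] [mf _]]; split => //; exists g. Qed.

Lemma gauss_entireB f f' : gauss_entire f -> gauss_entire f' ->
  gauss_entire (fun z => f z - f' z).
Proof.
move=> [mf [g gE fE]] [mf' [g' gE' fE']]; split; first exact: mC_sub.
exists (fun z => g z + -1 * g' z) => z; last by rewrite fE fE'; ring.
have [A wA] := gE z; have [B wB] := gE' z; exists (A + -1 * B).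
by have := wirtD wA (wirtZ (-1) wB); rewrite mulr0 addr0.
Qed.

(** Recentring at z0: since |z|^2 = |z0|^2 + 2 Re(conj(z0) (z - z0)) + |z - z0|^2, absorbing an
    exponential of z - z0 in the entire factor leaves a modulus whose Gaussian weight is radial
    about z0. *)
Lemma gauss_entire_at f z0 : gauss_entire f -> exists G : C -> C,
  [/\ (forall z, exists A, wirt G z A 0), measurableC G &
   forall z, f z = cexp (- (cabs z ^+ 2 / 2)%:C) * (G z * cexp (conjc z0 * (z - z0)))].
Proof.
move=> [mf [g gE fE]].
have mlin (c : C) : measurableC (fun z => c * (z - z0)).
  by apply: mC_mul; [exact: mC_cst|exact: mC_sub (mC_id _) (mC_cst _)].
exists (fun z => g z * cexp (- conjc z0 * (z - z0))); split.
- move=> z; have [A wA] := gE z.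
  have w1 : wirt (fun z => - conjc z0 * (z - z0)) z (- conjc z0) 0.
    by have := wirtZ (- conjc z0) (wirtD (wirt_id z) (wirt_cst (- z0) z)); rewrite !addr0 mulr1 mulr0.
  have := wirtM wA (wirt_comp w1 (wirt_cexp _)).
  by rewrite !(mul0r, mulr0, addr0, add0r) => H; eexists; exact: H.
- apply: mC_mul; last exact: mC_cexp.
  (* g is recovered as exp(|z|^2 / 2) f, which inherits measurability from f. *)
  have := mC_mul (mC_cexp (mC_real (h := fun x => x / 2) _ (mC_cabs2 (mC_id R)))) mf.
  move=> /(_ _)/wrap[|].
    by apply: continuous_measurable_fun; exact: mulrr_continuous.
  congr measurableC; apply/funext => z /=; rewrite fE mulrA -cexpD.
  by rewrite addrN cexp0 mul1r.
by move=> z; rewrite fE -(mulrA (g z)) -cexpD mulNr addNr cexp0 mulr1.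
Qed.

Lemma cabs_gauss_entire_at (f G : C -> C) z0 z :
  f z = cexp (- (cabs z ^+ 2 / 2)%:C) * (G z * cexp (conjc z0 * (z - z0))) ->
  cabs (G z) = cabs (f z) * expR (cabs z0 ^+ 2 / 2 + cabs (z - z0) ^+ 2 / 2).
Proof.
move=> ->; rewrite !cabsM !cabs_cexp.
set a := Re _; set b := Re _; set c := _ + _.
have -> : expR a * (cabs (G z) * expR b) * expR c = cabs (G z) * expR (a + b + c).
  by rewrite !expRD; ring.
suff -> : a + b + c = 0 by rewrite expR0 mulr1.
rewrite /a /b /c !cabs_sqr; by case: z z0 {a b c} => a b [c d] /=; field.
Qed.

(** As a function of s = |z - z0|^2 this is a C^1 cutoff that vanishes for |z - z0| >= 2, hence on
    the boundary of the box of half-side 2. The error of its linearisation is at most (y - x)^2. *)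
Lemma is_derive_max2 (x : R) : is_derive x 1 (fun s => Num.max (4 - s) 0 ^+ 2) (- (2 * Num.max (4 - x) 0)).
Proof.
have key y : `|Num.max (4 - y) 0 ^+ 2 - Num.max (4 - x) 0 ^+ 2 - - (2 * Num.max (4 - x) 0) * (y - x)| <= (y - x) ^+ 2.
  have -> : y - x = (4 - x) - (4 - y) by ring.
  move: (4 - y) (4 - x) => P Q; rewrite ler_norml.
  case: (leP P 0) => hP; case: (leP Q 0) => hQ.
  - by have := sqr_ge0 (Q - P); lra.
  - by have := sqr_ge0 P; have := sqr_ge0 Q; have := mulr_ge0_le0 (ltW hQ) hP; lra.
  - by have := sqr_ge0 P; have := sqr_ge0 Q; have := mulr_ge0_le0 (ltW hP) hQ; lra.
  - by have := sqr_ge0 (Q - P); lra.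
set h := fun s : R => _; set d := - _.
have H : (fun t : R => t^-1 *: (h (t *: 1 + x) - h x)) t @[t --> 0^'] --> d.
  apply/cvgrPdist_le => e e0; near=> t.
  have t0 : t != 0 by near: t; exact: nbhs_dnbhs_neq.
  have te : `|t| <= e.
    near: t; apply: dnbhs0_le => //.
  have := key (t + x); rewrite -/(h (t + x)) -/(h x) -/d addrK => K.
  rewrite /GRing.scale /= mulr1.
  have -> : d - t^-1 * (h (t + x) - h x) = - (h (t + x) - h x - d * t) / t by field.
  rewrite normrM normrN normfV ler_pdivrMr ?normr_gt0 //.
  apply: (le_trans K); have -> : t ^+ 2 = `|t| * `|t| by rewrite -expr2 real_normK ?num_real.
  by rewrite ler_wpM2r.
split; first by apply/cvg_ex; exists d.
exact: (cvg_lim _ H).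
Unshelve. all: by end_near.
Qed.

Lemma continuous_max2' : continuous (fun x : R => - (2 * Num.max (4 - x) 0)).
Proof.
move=> x; apply/cvgrPdist_le => e e0; have e2 : 0 < e / 2 by lra.
exists (e / 2) => // y /= xy; rewrite ler_norml.
have := xy; rewrite ltr_norml.
by case: (leP (4 - y) 0) => hy; case: (leP (4 - x) 0) => hx /andP[? ?]; apply/andP; split; lra.
Qed.

Lemma boundary_sqr (z z0 : C) r : 0 <= r ->
  (`|Re z - Re z0| <= r /\ `|Im z - Im z0| = r) \/
  (`|Re z - Re z0| = r /\ `|Im z - Im z0| <= r) -> r ^+ 2 <= cabs (z - z0) ^+ 2.
Proof.
move=> r0; rewrite cabs_sqr Re_add Im_add Re_opp Im_opp.
by move=> [[_ <-]|[<- _]]; rewrite real_normK ?num_real // ?lerDl ?lerDr sqr_ge0.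
Qed.

Lemma in_box_sqr (p : RxR) z0 r : box z0 r p -> cabs (toC p - z0) ^+ 2 <= 2 * r ^+ 2.
Proof.
move=> [/= + +]; rewrite !in_itv /= => /andP[a1 a2] /andP[b1 b2].
rewrite gaussC_dist; nra.
Qed.

Lemma locbm_ccont (f : C -> C) : measurableC f -> (forall z, ccont f z) ->
  [/\ locbm (fun p : RxR => Re (f (toC p))), locbm (fun p : RxR => Im (f (toC p))) &
      locbm (fun p : RxR => cabs (f (toC p)))].
Proof.
move=> mf cf; have b := ccont_bounded cf; have [m1 m2] := mf; split; split=> //.
- by move=> M; have [B _ HB] := b M; exists B => x y hx hy; exact: (le_trans (Re_le_cabs _) (HB (x +i* y) hx hy)).
- by move=> M; have [B _ HB] := b M; exists B => x y hx hy; exact: (le_trans (Im_le_cabs _) (HB (x +i* y) hx hy)).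
- exact: mC_cabs_fun.
- move=> M; have [B _ HB] := b M; exists B => x y hx hy.
  by rewrite ger0_norm ?cabs_ge0 //; exact: (HB (x +i* y)).
Qed.

Lemma locbm_cst (c : R) : locbm (fun _ : RxR => c).
Proof. by split; [exact: measurable_cst|move=> M; exists `|c|]. Qed.

Lemma locbmM (f g : RxR -> R) : locbm f -> locbm g -> locbm (fun p => f p * g p).
Proof.
move=> [mf bf] [mg bg]; split; first exact: measurable_funM.
move=> M; have [B HB] := bf M; have [B' HB'] := bg M; exists (B * B') => x y hx hy.
by rewrite normrM ler_pM ?HB ?HB'.
Qed.

(** With the cutoff above the boundary term vanishes, so G z0 is the mean of G with weight k = max(4
    - |z - z0|^2, 0). *)
Lemma gauss_entire_local f z0 : gauss_entire f ->
  cabs (f z0) <= expR 4 * \int[lebC]_(p in box z0 2) cabs (f (toC p)).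
Proof.
move=> GE; have [G [GEn mG fE]] := gauss_entire_at z0 GE.
have cG z : ccont G z by have [A /wirt_ccont] := GEn z.
have r2 : 0 < 2 :> R by [].
have := @mean_box R G z0 (fun s => Num.max (4 - s) 0 ^+ 2) (fun s => - (2 * Num.max (4 - s) 0))
  GEn mG is_derive_max2 continuous_max2' 2 0 r2.
move=> /(_ _)/wrap[|[HR HI]].
  move=> z /(boundary_sqr (ltW r2)) hz; rewrite max_r; last by lra.
  by rewrite expr0n /= mulr0 cabs0.
rewrite mulr0 in HR HI.
have b2 : measurable (box z0 2) by exact: measurable_rect.
pose k (p : RxR) : R := Num.max (4 - cabs (toC p - z0) ^+ 2) 0.
have k0 p : 0 <= k p by rewrite /k le_max lexx orbT.
have k4 p : k p <= 4 by rewrite /k ge_max; have := sqr_ge0 (cabs (toC p - z0)); lra.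
have lk : locbm k.
  split; last by move=> M; exists 4 => x y _ _; rewrite ger0_norm.
  have := (mC_real (h := fun s => Num.max (4 - s) 0) _ (mC_cabs2 (mC_sub (mC_id _) (mC_cst z0)))).1; apply.
  by apply: measurable_maxr => //; exact: measurable_funB.
have [lGr lGi lGa] := locbm_ccont mG cG.
have ib f' : locbm f' -> lebC.-integrable (box z0 2) (EFin \o f').
  by move=> lf; apply: locbm_int_rect => //; lra.
(* On the box of half-side 1, of area 4, the weight lies between 2 and 4. *)
have K8 : 8 <= \int[lebC]_(p in box z0 2) k p.
  have b1 : measurable (box z0 1) by exact: measurable_rect.
  have b12 : box z0 1 `<=` box z0 2.
    move=> p [/= + +]; rewrite !in_itv /= => /andP[? ?] /andP[? ?].
    by split; rewrite /= in_itv /=; lra.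
  have ib1 : lebC.-integrable (box z0 1) (EFin \o k) by apply: integrableS (ib _ lk).
  have v1 : lebC (box z0 1) = 4%:E.
    by rewrite /box lebC_rect; [congr (_%:E); ring|lra|lra].
  have : `|\int[lebC]_(p in box z0 1) k p - 3 * 4| <= 1 * 4.
    apply: Rint_near_cst => // p hp; have := in_box_sqr hp; have := k4 p.
    have : 4 - cabs (toC p - z0) ^+ 2 <= k p by rewrite /k le_max lexx.
    by rewrite ler_norml; lra.
  have : \int[lebC]_(p in box z0 1) k p <= \int[lebC]_(p in box z0 2) k p.
    have f1 := integrable_fin_num b1 ib1; have f2 := integrable_fin_num b2 (ib _ lk).
    apply: fine_le f1 f2 _.
    apply: ge0_subset_integral => //; first by case/integrableP: (ib _ lk).
    by move=> p _; rewrite lee_fin.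
  by rewrite ler_norml; lra.
set I := \int[lebC]_(p in box z0 2) cabs (G (toC p)).
have I0 : 0 <= I by apply: Rintegral_ge0 => p _; exact: cabs_ge0.
(* For the real and the imaginary part alike: c times the integral of k equals the integral of k h,
   which is at most 4 I, while the integral of k is at least 8. *)
have gen (h : RxR -> R) c : locbm h -> (forall p, `|h p| <= cabs (G (toC p))) ->
   `|\int[lebC]_(p in box z0 2) ((h p - c) * - (2 * k p))| <= 0 -> `|c| <= I / 2.
  move=> lh hG; rewrite normr_le0 => /eqP H.
  have E : \int[lebC]_(p in box z0 2) ((h p - c) * - (2 * k p)) =
     -2 * (\int[lebC]_(p in box z0 2) (k p * h p) - c * \int[lebC]_(p in box z0 2) k p).
    rewrite -RintegralZl //; last exact: ib.
    rewrite -RintegralB //; last first.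
    - by apply: ib; apply: locbmM => //; exact: locbm_cst.
    - by apply: ib; exact: locbmM.
    rewrite -RintegralZl //; last first.
      by apply: integrable_subR => //; apply: ib; apply: locbmM => //; exact: locbm_cst.
    by apply: eq_Rintegral => p _; ring.
  rewrite E in H; set X := Rintegral _ _ (fun p => k p * h p) in E H.
  have {}H : X = c * \int[lebC]_(p in box z0 2) k p by lra.
  have X4 : `|X| <= 4 * I.
    apply: (le_trans (le_normr_Rintegral _ _)) => //; first by apply: ib; exact: locbmM.
    rewrite -RintegralZl //; last exact: ib.
    apply: le_Rintegral => //.
    - by apply: integrable_norm; apply: ib; exact: locbmM.
    - by apply: ib; apply: locbmM => //; exact: locbm_cst.
    move=> p _; rewrite normrM ger0_norm //.
    by apply: ler_pM.
  move: X4; rewrite H normrM (ger0_norm (le_trans _ K8)) //; nra.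
have cR := gen _ (Re (G z0)) lGr (fun p => Re_le_cabs _).
have cI := gen _ (Im (G z0)) lGi (fun p => Im_le_cabs _).
have GI : cabs (G z0) <= I.
  apply: (le_trans (cabs_le _)).
  have {}cR : `|Re (G z0)| <= I / 2.
    apply: cR; apply: le_trans HR; rewrite le_eqVlt; apply/orP; left; apply/eqP.
    congr (Num.norm _); apply: eq_Rintegral => p _.
    by rewrite Re_mul /= mulr0 subr0 Re_add Re_opp.
  have {}cI : `|Im (G z0)| <= I / 2.
    apply: cI; apply: le_trans HI; rewrite le_eqVlt; apply/orP; left; apply/eqP.
    congr (Num.norm _); apply: eq_Rintegral => p _.
    by rewrite Im_mul /= mulr0 add0r Im_add Im_opp.
  lra.
have fG := cabs_gauss_entire_at (fE z0).
rewrite subrr cabs0 expr0n /= mul0r addr0 in fG.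
set E0 := expR (cabs z0 ^+ 2 / 2) in fG.
have E00 : 0 < E0 by exact: expR_gt0.
have cf : measurableC f by case: GE.
have lf : locbm (fun p : RxR => cabs (f (toC p))).
  split; first exact: mC_cabs_fun.
  move=> M; have [B HB] := lGa.2 M; exists B => x y hx hy.
  have := cabs_gauss_entire_at (fE (x +i* y)); have := HB x y hx hy.
  rewrite /toC /= !ger0_norm ?cabs_ge0 // => h1 h2; apply: le_trans h1; rewrite h2.
  rewrite ler_peMr ?cabs_ge0 //.
  have : 0 <= cabs z0 ^+ 2 / 2 + cabs (x +i* y - z0) ^+ 2 / 2.
    by have := sqr_ge0 (cabs z0); have := sqr_ge0 (cabs (x +i* y - z0)); lra.
  by rewrite -[X in _ -> X <= _](expR0 R) ler_expR.
rewrite -(ler_pM2r E00) -fG; apply: (le_trans GI).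
rewrite mulrAC -RintegralZl //; last exact: ib.
apply: le_Rintegral => //; first exact: ib.
  by apply: ib; apply: locbmM => //; exact: locbm_cst.
(* On the box |z - z0|^2 <= 8, whence the factor e^4. *)
move=> p hp; rewrite (cabs_gauss_entire_at (fE (toC p))) mulrC ler_wpM2r ?cabs_ge0 //.
rewrite /E0 -expRD ler_expR; have := in_box_sqr hp; lra.
Qed.

(** The weight exp(k |z|) varies by a factor of at most exp(3k) over the box around z0, so the local
    L^1 bound transfers to the weighted L^2 norm. *)
Lemma gauss_entire_sup f (k m : R) : gauss_entire f -> 0 <= k -> 0 < m ->
  (\int[lebC]_p ((expR (k * cabs (toC p)) * cabs (f (toC p))) ^+ 2)%:E <= (m ^+ 2)%:E)%E ->
  forall z, cabs (f z) <= 9 * expR (4 + 3 * k) * m * expR (- (k * cabs z)).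
Proof.
move=> GE k0 m0 H z0; have [mf _] := GE.
pose W (p : RxR) : R := expR (k * cabs (toC p)) * cabs (f (toC p)).
have mW : measurable_fun setT (W : RxR -> measurableTypeR R).
  apply: measurable_funM; last exact: mC_cabs_fun.
  have := (mC_real (h := fun x => expR (k * x)) _ (mC_cabs (mC_id R))).1; apply.
  apply: continuous_measurable_fun => x; apply: continuous_comp; [|exact: continuous_expR].
  exact: mulrl_continuous.
have W0 p : 0 <= W p by rewrite mulr_ge0 ?expR_ge0 ?cabs_ge0.
have iW : lebC.-integrable setT (EFin \o (fun p => W p ^+ 2)).
  by apply: integrable_ge0 H; [exact: measurable_funX|move=> p; exact: sqr_ge0].
have b2 : measurable (box z0 2) by exact: measurable_rect.
have iW2 : lebC.-integrable (box z0 2) (EFin \o (fun p => W p ^+ 2)).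
  exact: integrableS iW.
have ic c : lebC.-integrable (box z0 2) (EFin \o (fun _ : RxR => c)).
  by apply: locbm_int_rect; [exact: locbm_cst|lra|lra].
have v2 : lebC (box z0 2) = 16%:E by rewrite /box lebC_rect; [congr (_%:E); ring|lra|lra].
have IW : \int[lebC]_(p in box z0 2) (W p ^+ 2) <= m ^+ 2.
  rewrite -lee_fin /Rintegral fineK; last exact: (integrable_fin_num b2 iW2).
  apply: le_trans H; apply: ge0_subset_integral => //; first by case/integrableP: iW.
  by move=> p _; rewrite lee_fin sqr_ge0.
pose A := expR (k * 3 - k * cabs z0).
have A0 : 0 < A by exact: expR_gt0.
(* Young's inequality A W <= A W^2 / (2m) + A m / 2 passes from L^1 to L^2 on the box. *)
have pt p : box z0 2 p -> cabs (f (toC p)) <= A / (2 * m) * W p ^+ 2 + A * m / 2.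
  move=> /in_box_sqr hp.
  have d3 : cabs (toC p - z0) <= 3.
    by rewrite -(@ler_pXn2r _ 2) ?nnegrE ?cabs_ge0 //; lra.
  have hz : cabs z0 <= cabs (toC p) + 3.
    by have := cabsD (toC p) (z0 - toC p); rewrite addrC subrK (cabsB z0); lra.
  have h1 : cabs (f (toC p)) <= A * W p.
    rewrite /W mulrA -expRD ler_peMl ?cabs_ge0 // -[X in X <= _]expR0 ler_expR.
    have : k * cabs z0 <= k * (cabs (toC p) + 3) by rewrite ler_wpM2l.
    lra.
  apply: (le_trans h1).
  have -> : A / (2 * m) * W p ^+ 2 + A * m / 2 = A * W p + A / (2 * m) * (W p - m) ^+ 2.
    by field; rewrite gt_eqF.
  by rewrite lerDl mulr_ge0 ?sqr_ge0 // divr_ge0 ?(ltW A0) // mulr_ge0 // ltW.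
have loc := gauss_entire_local z0 GE.
have iR : lebC.-integrable (box z0 2) (EFin \o (fun p => A / (2 * m) * W p ^+ 2)).
  by have := integrableZl b2 (A / (2 * m)) iW2.
have iS : lebC.-integrable (box z0 2) (EFin \o (fun p => A / (2 * m) * W p ^+ 2 + A * m / 2)).
  have -> : (fun p => A / (2 * m) * W p ^+ 2 + A * m / 2) = (fun p => A / (2 * m) * W p ^+ 2 - - (A * m / 2)).
    by apply/funext => p; rewrite opprK.
  exact: integrable_subR iR (ic _).
have B : \int[lebC]_(p in box z0 2) cabs (f (toC p)) <= A / (2 * m) * m ^+ 2 + A * m / 2 * 16.
  apply: (@le_trans _ _ (\int[lebC]_(p in box z0 2) (A / (2 * m) * W p ^+ 2 + A * m / 2))).
    apply: le_Rintegral => //.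
    apply: le_integrable iS => //.
      by apply/measurable_EFinP; apply: measurable_funTS; exact: mC_cabs_fun.
    by move=> p hp /=; rewrite lee_fin ger0_norm ?cabs_ge0 // (le_trans (pt p hp)) // ler_norm.
  rewrite (RintegralD b2 iR (ic _)).
  rewrite RintegralZl // Rintegral_cst // v2 /=; apply: lerD => //.
  by rewrite ler_wpM2l // divr_ge0 ?(ltW A0) // mulr_ge0 // ltW.
apply: (le_trans loc); apply: (le_trans (ler_wpM2l (expR_ge0 _) B)).
(* The box has area 16, so the factor is 1/2 + 8 = 17/2, rounded up to 9. *)
have -> : A / (2 * m) * m ^+ 2 + A * m / 2 * 16 = A * m * (17 / 2) by field; rewrite gt_eqF.
have -> : 9 * expR (4 + 3 * k) * m * expR (- (k * cabs z0)) = expR 4 * (A * m * 9).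
  by rewrite /A !expRD (mulrC k 3); ring.
by rewrite ler_wpM2l ?expR_ge0 // ler_wpM2l ?mulr_ge0 ?(ltW A0) ?(ltW m0) //; lra.
Qed.

Lemma normL2_le F (m : R) : 0 <= m -> (normL2 F <= m%:E)%E ->
  (\int[lebC]_p (cabs (F (toC p)) ^+ 2)%:E <= (m ^+ 2)%:E)%E.
Proof.
move=> m0; rewrite /normL2 unlock /=.
have -> : (\int[lebC]_x `|(EFin \o @cabs R \o F \o @toC R) x| `^ 2 = \int[lebC]_p (cabs (F (toC p)) ^+ 2)%:E)%E.
  apply: eq_integral => p _ /=.
  by rewrite ger0_norm ?cabs_ge0 // powR_mulrn ?cabs_ge0.
set I := integral _ _ _ => H.
have I0 : (0 <= I)%E by apply: integral_ge0 => p _; rewrite lee_fin sqr_ge0.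
have h2 : (0 : R) <= 2 by [].
have := gt0_ler_poweR h2 _ _ H; rewrite -poweRrM mulVf // poweRe1 // poweR_EFin powR_mulrn //.
by apply; rewrite in_itv /= ?poweR_ge0 ?leey // lee_fin m0.
Qed.

Lemma gauss_entire_normX f (k m : R) : gauss_entire f -> 0 <= k -> 0 < m ->
  (normX k f <= m%:E)%E ->
  forall z, cabs (f z) <= 9 * expR (4 + 3 * k) * m * expR (- (k * cabs z)).
Proof.
move=> GE k0 m0 H; apply: gauss_entire_sup => //.
have := normL2_le (ltW m0) H; congr (_ <= _)%E; apply: eq_integral => p _.
by rewrite /expweight cabsM cabsR ger0_norm ?expR_ge0.
Qed.

Lemma is_derive_expRN (x : R) : is_derive x 1 (fun s : R => expR (- s)) (- expR (- x)).
Proof.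
have h : is_derive x 1 (fun s : R => - s) (-1) by exact: is_deriveN.
have := is_derive1_comp (is_derive_expR (- x)) h.
by rewrite mulrN1.
Qed.

(** The mean value identity with h(s) = exp(-s) on growing squares: in the limit G - G z0 integrates
    to zero against the Gaussian centred at z0, whose total mass is pi. *)
Lemma fock_proj_id f (M : R) : gauss_entire f -> (forall z, cabs (f z) <= M) ->
  forall z0, fock_proj f z0 = f z0.
Proof.
move=> GE fM z0; have M0 : 0 <= M by exact: le_trans (cabs_ge0 _) (fM 0).
have [G [GEn mG fE]] := gauss_entire_at z0 GE.
pose M' := M * expR (cabs z0 ^+ 2 / 2).
have M'0 : 0 <= M' by rewrite mulr_ge0 ?expR_ge0.
have GM z : cabs (G z) <= M' * expR (cabs (z - z0) ^+ 2 / 2).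
  by rewrite (cabs_gauss_entire_at (fE z)) expRD mulrA ler_wpM2r ?expR_ge0 // /M' ler_wpM2r ?expR_ge0.
have G0M z : cabs (G z0) <= M' * expR (cabs (z - z0) ^+ 2 / 2).
  apply: (le_trans (GM z0)); rewrite ler_wpM2l // ler_expR subrr cabs0 expr0n /= mul0r.
  by rewrite divr_ge0 // sqr_ge0.
have cN : continuous (fun s : R => - expR (- s)).
  move=> x; apply: (@cvgN _ R^o); apply: (@continuous_comp _ _ _ -%R (@expR R)).
    exact: oppr_continuous.
  exact: continuous_expR.
pose D z := (G z - G z0) * (- expR (- (cabs (z - z0) ^+ 2)))%:C.
have DM z : cabs (D z) <= 2 * M' * expR (- cabs (z - z0) ^+ 2 / 2).
  rewrite /D cabsM cabsR normrN ger0_norm ?expR_ge0 //.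
  have h : cabs (G z - G z0) <= 2 * M' * expR (cabs (z - z0) ^+ 2 / 2).
    by apply: (le_trans (cabsBD _ _)); have := GM z; have := G0M z; lra.
  apply: (le_trans (ler_wpM2r (expR_ge0 _) h)); rewrite -[X in X <= _]mulrA -expRD.
  by rewrite le_eqVlt; apply/orP; left; apply/eqP; congr (_ * expR _); field.
have mD : measurableC D.
  apply: mC_mul; first exact: mC_sub mG (mC_cst _).
  have := mC_real (h := fun s => - expR (- s)) (continuous_measurable_fun cN) (mC_cabs2 (mC_sub (mC_id R) (mC_cst z0))).
  exact.
(* On the boundary the Gaussian is bounded crudely by 2 / r and the Cauchy kernel by 1 / r, which
   beats the length of the perimeter. *)
have B r : 1 <= r -> `|\int[lebC]_(p in box z0 r) Re (D (toC p))| <= 16 * M' / r /\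
     `|\int[lebC]_(p in box z0 r) Im (D (toC p))| <= 16 * M' / r.
  move=> r1; have r0 : 0 < r by lra.
  have := @mean_box R G z0 (fun s => expR (- s)) (fun s => - expR (- s)) GEn mG is_derive_expRN cN r
     (2 * M' / r * (2 / r)) r0.
  move=> /(_ _)/wrap[|[H1 H2]]; last first.
    have E : 4 * r * (2 * M' / r * (2 / r)) = 16 * M' / r by field; rewrite gt_eqF.
    by rewrite E in H1 H2.
  move=> z /(boundary_sqr (ltW r0)) hz.
  have rz : r <= cabs (z - z0) by move: hz; rewrite ler_pXn2r ?nnegrE ?cabs_ge0 // ltW.
  have -> : cabs ((G z - G z0) * (z - z0)^-1 * (expR (- cabs (z - z0) ^+ 2))%:C) =
     cabs (D z) * (cabs (z - z0))^-1.
    by rewrite /D !cabsM cabsV !cabsR normrN mulrAC.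
  have z0' : 0 < cabs (z - z0) by lra.
  have hi : (cabs (z - z0))^-1 <= r^-1 by rewrite lef_pV2.
  have e1 : expR (- cabs (z - z0) ^+ 2 / 2) <= 2 / r.
    have -> : - cabs (z - z0) ^+ 2 / 2 = - (cabs (z - z0) ^+ 2 / 2) by rewrite mulNr.
    have h1 := expR_ge1Dx (cabs (z - z0) ^+ 2 / 2).
    have r2 : r <= r ^+ 2 by rewrite expr2 ler_peMl // ltW.
    have h2 : r / 2 <= expR (cabs (z - z0) ^+ 2 / 2) by lra.
    rewrite expRN -[2 / r]invrK invf_div lef_pV2 ?posrE ?expR_gt0 // divr_gt0 //.
  have i0 : 0 <= r^-1 by rewrite invr_ge0 ltW.
  have -> : 2 * M' / r * (2 / r) = 2 * M' * (2 / r) * r^-1 by ring.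
  apply: ler_pM; rewrite ?cabs_ge0 ?invr_ge0 ?cabs_ge0 //.
  by apply: (le_trans (DM z)); rewrite ler_wpM2l // mulr_ge0.
have idom (F : C -> C) c : measurableC F -> (forall z, cabs (F z) <= c * expR (- cabs (z - z0) ^+ 2 / 2)) ->
   lebC.-integrable setT (EFin \o (fun p : RxR => Re (F (toC p)))) /\
   lebC.-integrable setT (EFin \o (fun p : RxR => Im (F (toC p)))).
  move=> [m1 m2] HF; have ig : lebC.-integrable setT (EFin \o (fun p : RxR => c * expR (- cabs (toC p - z0) ^+ 2 / 2))).
    by have := integrableZl measurableT c (integrable_gaussC z0).
  split; apply: le_integrableR ig => // p.
    exact: le_trans (Re_le_cabs _) (HF _).
  exact: le_trans (Im_le_cabs _) (HF _).
have [iDr iDi] := idom D _ mD DM.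
have ZR := Rint_box_limit iDr (fun r hr => (B r hr).1).
have ZI := Rint_box_limit iDi (fun r hr => (B r hr).2).
pose E z := G z * (expR (- cabs (z - z0) ^+ 2))%:C.
have mE : measurableC (fun z => (expR (- cabs (z - z0) ^+ 2))%:C : C).
  have := mC_real (h := fun s => expR (- s)) _ (mC_cabs2 (mC_sub (mC_id R) (mC_cst z0))); apply.
  apply: continuous_measurable_fun => x; apply: (@continuous_comp _ _ _ -%R (@expR R)).
    exact: oppr_continuous.
  exact: continuous_expR.
have EM z : cabs (E z) <= M' * expR (- cabs (z - z0) ^+ 2 / 2).
  rewrite /E cabsM cabsR ger0_norm ?expR_ge0 //.
  apply: (le_trans (ler_wpM2r (expR_ge0 _) (GM z))); rewrite -[X in X <= _]mulrA -expRD.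
  by rewrite le_eqVlt; apply/orP; left; apply/eqP; congr (_ * expR _); field.
have [iEr iEi] := idom E _ (mC_mul mG mE) EM.
have e2 z : cabs ((expR (- cabs (z - z0) ^+ 2))%:C : C) <= 1 * expR (- cabs (z - z0) ^+ 2 / 2).
  by rewrite mul1r cabsR ger0_norm ?expR_ge0 // ler_expR; have := sqr_ge0 (cabs (z - z0)); lra.
have [ie _] := idom _ _ mE e2.
have pi_int : \int[lebC]_p expR (- cabs (toC p - z0) ^+ 2) = pi :> R.
  by rewrite /Rintegral integral_gaussC.
have RE : \int[lebC]_p Re (E (toC p)) = pi * Re (G z0).
  have : \int[lebC]_p Re (D (toC p)) = Re (G z0) * \int[lebC]_p expR (- cabs (toC p - z0) ^+ 2) - \int[lebC]_p Re (E (toC p)).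
    rewrite -RintegralZl //; rewrite -RintegralB //; last by have := integrableZl measurableT (Re (G z0)) ie.
    apply: eq_Rintegral => p _; rewrite /D /E !Re_mul /= !mulr0 !subr0 Re_add Re_opp; ring.
  rewrite ZR pi_int; lra.
have IE : \int[lebC]_p Im (E (toC p)) = pi * Im (G z0).
  have : \int[lebC]_p Im (D (toC p)) = Im (G z0) * \int[lebC]_p expR (- cabs (toC p - z0) ^+ 2) - \int[lebC]_p Im (E (toC p)).
    rewrite -RintegralZl //; rewrite -RintegralB //; last by have := integrableZl measurableT (Im (G z0)) ie.
    apply: eq_Rintegral => p _; rewrite /D /E !Im_mul /= !mulr0 !add0r Im_add Im_opp; ring.
  rewrite ZI pi_int; lra.
rewrite /fock_proj.
(* With f recentred at z0 the exponents add up to -|w - z0|^2. *)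
have -> : (fun w => cexp (conjc w * z0 - (cabs w ^+ 2 / 2)%:C) * f w) = E.
  apply/funext => w; rewrite /E fE -cexpR mulrA -cexpD.
  rewrite [cexp _ * (G w * _)]mulrC -mulrA -cexpD; congr (_ * cexp _).
  rewrite !cabs_sqr; case: w z0 {GE GEn fE G0M GM DM mD iDr iDi ZR ZI EM mE iEr iEi e2 ie pi_int RE IE B idom D E M' M'0} => a b [c d] /=.
  by apply/eqP; rewrite eq_complex /=; apply/andP; split; apply/eqP; field.
rewrite /integralC RE IE fE subrr mulr0 cexp0 mulr1.
have -> : (pi * Re (G z0)) +i* (pi * Im (G z0)) = pi%:C * G z0.
  by case: (G z0) => a b; apply/eqP; rewrite eq_complex /= !mul0r subr0 addr0 !eqxx.
have pi0 : (pi : R) != 0 by rewrite gt_eqF // pi_gt0.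
have pi1 : (pi^-1)%:C * pi%:C = 1 :> C by rewrite -rmorphM /= mulVf.
by rewrite mulrA (mulrAC (pi^-1)%:C) pi1 mul1r.
Qed.
End Fock.

(** * Symmetry of the projection *)

Section SigmaFinite.
Variable R : realType.
Local Notation RxR := (measurableTypeR R * measurableTypeR R)%type.

(* A bare set function, to carry the sigma-finite structure of lebC. *)
Definition lebC_set : set RxR -> \bar R := @lebC R.

HB.instance Definition _ := Measure.copy lebC_set (@lebC R).

Lemma lebC_sigma_finite : sigma_finite setT lebC_set.
Proof.
exists (fun n => rect (- n%:R) n%:R (- n%:R) n%:R).
  apply/seteqP; split=> // -[x y] _.
  pose n := Num.bound (`|x| + `|y|).
  have hn : `|x| + `|y| < n%:R by rewrite archi_boundP ?addr_ge0.
  have hx := normr_ge0 x; have hy := normr_ge0 y.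
  have xn : `|x| < n%:R by lra.
  have yn : `|y| < n%:R by lra.
  by exists n => //; split; rewrite /= in_itv /=; move: xn yn; rewrite !ltr_norml; lra.
move=> n; split; first exact: measurable_rect.
have n0 : 0 <= n%:R :> R by [].
by rewrite /lebC_set lebC_rect ?ltry //; lra.
Qed.

HB.instance Definition _ := Measure_isSigmaFinite.Build _ _ _ lebC_set lebC_sigma_finite.
End SigmaFinite.

Section ComplexIntegral.
Variable R : realType.
Local Notation C := R[i].
Local Notation RxR := (measurableTypeR R * measurableTypeR R)%type.
Local Notation lebC := (@lebC R).
Implicit Types f g : C -> C.

Definition integrableC f : Prop :=
  lebC.-integrable setT (EFin \o (fun p : RxR => Re (f (toC p)))) /\
  lebC.-integrable setT (EFin \o (fun p : RxR => Im (f (toC p)))).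

Lemma integrableC_dom f (g : RxR -> R) : measurableC f -> lebC.-integrable setT (EFin \o g) ->
  (forall p, cabs (f (toC p)) <= g p) -> integrableC f.
Proof.
move=> [m1 m2] ig H; split; apply: le_integrableR ig => // p.
  exact: le_trans (Re_le_cabs _) (H _).
exact: le_trans (Im_le_cabs _) (H _).
Qed.

Lemma integrableR_Zl d (T : measurableType d) (m : {measure set T -> \bar R}) (c : R) (f : T -> R) :
  m.-integrable setT (EFin \o f) -> m.-integrable setT (EFin \o (fun p => c * f p)).
Proof. by move=> fi; have := integrableZl measurableT c fi. Qed.

Lemma integrableR_add (f g : RxR -> R) : lebC.-integrable setT (EFin \o f) ->
  lebC.-integrable setT (EFin \o g) -> lebC.-integrable setT (EFin \o (fun p => f p + g p)).
Proof. by move=> fi gi; have := integrableD measurableT fi gi. Qed.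

Lemma integralCZ (c : C) f : integrableC f ->
  integralC (fun z => c * f z) = c * integralC f.
Proof.
move=> [i1 i2]; rewrite /integralC.
have -> : (fun p : RxR => Re (c * f (toC p))) = (fun p => Re c * Re (f (toC p)) - Im c * Im (f (toC p))).
  by apply/funext => p; rewrite Re_mul.
have -> : (fun p : RxR => Im (c * f (toC p))) = (fun p => Re c * Im (f (toC p)) + Im c * Re (f (toC p))).
  by apply/funext => p; rewrite Im_mul.
rewrite (RintegralB measurableT (integrableR_Zl _ i1) (integrableR_Zl _ i2)).
rewrite (RintegralD measurableT (integrableR_Zl _ i2) (integrableR_Zl _ i1)).
rewrite !(RintegralZl _ _ i1, RintegralZl _ _ i2) //.
by case: c.
Qed.

Lemma integralCB f g : integrableC f -> integrableC g ->
  integralC (fun z => f z - g z) = integralC f - integralC g.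
Proof.
move=> [i1 i2] [j1 j2]; rewrite /integralC.
have -> : (fun p : RxR => Re (f (toC p) - g (toC p))) = (fun p => Re (f (toC p)) - Re (g (toC p))).
  by apply/funext => p; rewrite Re_add Re_opp.
have -> : (fun p : RxR => Im (f (toC p) - g (toC p))) = (fun p => Im (f (toC p)) - Im (g (toC p))).
  by apply/funext => p; rewrite Im_add Im_opp.
by rewrite !RintegralB.
Qed.

Lemma integralC_conj f : integrableC f ->
  integralC (fun z => conjc (f z)) = conjc (integralC f).
Proof.
move=> [i1 i2]; rewrite /integralC.
have -> : (fun p : RxR => Re (conjc (f (toC p)))) = (fun p => Re (f (toC p))).
  by apply/funext => p; rewrite Re_cc.
have -> : (fun p : RxR => Im (conjc (f (toC p)))) = (fun p => (-1) * Im (f (toC p))).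
  by apply/funext => p; rewrite Im_cc mulN1r.
by rewrite RintegralZl // mulN1r.
Qed.

(** The factor 2 comes from bounding real and imaginary parts separately; below only the finiteness
    of the bound matters. *)
Lemma cabs_integralC f (g : RxR -> R) : measurableC f -> lebC.-integrable setT (EFin \o g) ->
  (forall p, cabs (f (toC p)) <= g p) -> cabs (integralC f) <= 2 * \int[lebC]_p g p.
Proof.
move=> mf ig H; have [i1 i2] := integrableC_dom mf ig H.
apply: (le_trans (cabs_le _)) => /=; rewrite mulr_natl mulr2n; apply: lerD.
  apply: (le_trans (le_normr_Rintegral measurableT i1)).
  apply: le_Rintegral => //; first exact: integrable_norm.
  by move=> p _; exact: le_trans (Re_le_cabs _) (H _).
apply: (le_trans (le_normr_Rintegral measurableT i2)).
apply: le_Rintegral => //; first exact: integrable_norm.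
by move=> p _; exact: le_trans (Im_le_cabs _) (H _).
Qed.

(** The product majorant makes h integrable on the product space, by Tonelli. *)
Lemma Rint_fubini d (T : measurableType d) (m : {sigma_finite_measure set T -> \bar R})
    (h : T -> T -> R) (a b : T -> R) :
  measurable_fun setT (fun pq : T * T => h pq.1 pq.2 : measurableTypeR R) ->
  m.-integrable setT (EFin \o a) -> m.-integrable setT (EFin \o b) ->
  (forall p q, `|h p q| <= a p * b q) ->
  \int[m]_p (\int[m]_q h p q) = \int[m]_q (\int[m]_p h p q).
Proof.
move=> mh ia ib H.
have [ma _] := integrableP _ _ _ ia; have [mb _] := integrableP _ _ _ ib.
(* The hypothesis forces a p * b q >= 0 but fixes the sign of neither factor. *)
pose a' p := `|a p|; pose b' p := `|b p|.
have a0 p : 0 <= a' p by exact: normr_ge0.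
have b0 p : 0 <= b' p by exact: normr_ge0.
have ia' : m.-integrable setT (EFin \o a') by exact: integrable_norm.
have ib' : m.-integrable setT (EFin \o b') by exact: integrable_norm.
have H' p q : `|h p q| <= a' p * b' q.
  by apply: (le_trans (H p q)); rewrite -normrM ler_norm.
pose F (pq : T * T) := (h pq.1 pq.2)%:E.
have mF : measurable_fun setT F by apply/measurable_EFinP.
have iF : (m \x m)%E.-integrable setT F.
  apply/(integrable12ltyP m m mF).
  apply: (@le_lt_trans _ _ (\int[m]_p ((a' p)%:E * \int[m]_q (b' q)%:E))%E).
    apply: ge0_le_integral => //.
    - by move=> p _; exact: integral_ge0.
    - have maF : measurable_fun setT (abse \o F) by exact: measurableT_comp.
      exact: (@measurable_fun_fubini_tonelli_F _ _ T T R m (abse \o F) maF (fun x => abse_ge0 _)).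
    - apply: emeasurable_funM => //; by case/integrableP: ia'.
    move=> p _; rewrite -ge0_integralZl //=.
    - apply: ge0_le_integral => //.
      + by apply/measurable_EFinP; apply: measurableT_comp => //; exact: (measurableT_comp mh (measurable_pair1 p)).
      + by apply: emeasurable_funM => //; case/integrableP: ib'.
      + by move=> q _; rewrite /= -EFinM lee_fin; exact: H'.
    - by case/integrableP: ib'.
    - by move=> q _; rewrite lee_fin.
    - by rewrite lee_fin.
  have fb := integrable_fin_num measurableT ib'; rewrite /= in fb.
  rewrite -(fineK fb) ge0_integralZr //=.
  - have fa := integrable_fin_num measurableT ia'; rewrite /= in fa.
    by rewrite -(fineK fa) -EFinM ltry.
  - by case/integrableP: ia'.
  - by move=> p _; rewrite lee_fin.
  - by rewrite lee_fin fine_ge0 // integral_ge0 // => q _; rewrite lee_fin.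
have i1 p : m.-integrable setT (EFin \o (fun q => h p q)).
  apply: (le_integrableR (g := fun q => a' p * b' q)).
  - exact: (measurableT_comp mh (measurable_pair1 p)).
  - exact: H'.
  - exact: integrableR_Zl.
have i2 q : m.-integrable setT (EFin \o (fun p => h p q)).
  apply: (le_integrableR (g := fun p => b' q * a' p)).
  - exact: (measurableT_comp mh (measurable_pair2 q)).
  - by move=> p; rewrite mulrC; exact: H'.
  - exact: integrableR_Zl.
have E1 p : fubini_F m F p = (\int[m]_q h p q)%:E.
  by rewrite /fubini_F /F /Rintegral fineK //; exact: (integrable_fin_num measurableT (i1 p)).
have E2 q : fubini_G m F q = (\int[m]_p h p q)%:E.
  by rewrite /fubini_G /F /Rintegral fineK //; exact: (integrable_fin_num measurableT (i2 q)).
have e1 : (\int[m]_p (\int[m]_q h p q)%:E = \int[m]_p fubini_F m F p)%E.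
    by apply: eq_integral => p _; rewrite E1.
  have e2 : (\int[m]_q (\int[m]_p h p q)%:E = \int[m]_q fubini_G m F q)%E.
    by apply: eq_integral => q _; rewrite E2.
  have e3 : (\int[m]_p fubini_F m F p = \int[m]_q fubini_G m F q)%E by exact: Fubini iF.
  by apply: (congr1 fine); rewrite e1 e2.
Qed.

Lemma integralC_fubini (H : C -> C -> C) (a b : RxR -> R) :
  mc (fun pq : RxR * RxR => H (toC pq.1) (toC pq.2)) ->
  lebC.-integrable setT (EFin \o a) -> lebC.-integrable setT (EFin \o b) ->
  (forall p q, cabs (H (toC p) (toC q)) <= a p * b q) ->
  integralC (fun z => integralC (H z)) = integralC (fun q => integralC (fun z => H z q)).
Proof.
move=> [m1 m2] ia ib Hab; rewrite /integralC /=.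
have e1 := @Rint_fubini _ _ (@lebC_set R)
  (fun p q => Re (H (toC p) (toC q))) a b m1 ia ib (fun p q => le_trans (Re_le_cabs _) (Hab p q)).
have e2 := @Rint_fubini _ _ (@lebC_set R)
  (fun p q => Im (H (toC p) (toC q))) a b m2 ia ib (fun p q => le_trans (Im_le_cabs _) (Hab p q)).
by congr Complex; [exact: e1|exact: e2].
Qed.

(** The integral kernel of Pi with the outer factor absorbed, which makes it Hermitian in z and
    w. *)
Definition fock_kernel (z w : C) : C :=
  (pi^-1)%:C * cexp (- (cabs z ^+ 2 / 2)%:C) * cexp (conjc w * z - (cabs w ^+ 2 / 2)%:C).

Lemma fock_kernel_conj (z w : C) : conjc (fock_kernel z w) = fock_kernel w z.
Proof.
rewrite /fock_kernel !conjcM -!cexp_conj !conjc_real -!mulrA -!cexpD; congr (_ * cexp _).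
by case: z w => a b [c d]; apply/eqP; rewrite eq_complex /=; apply/andP; split; apply/eqP; ring.
Qed.

(** The modulus is exp(-|z - w|^2 / 2) / pi. Being bounded, the kernel preserves integrability of
    the functions it multiplies. *)
Lemma cabs_fock_kernel (z w : C) : cabs (fock_kernel z w) <= 1.
Proof.
rewrite /fock_kernel !cabsM cabsR !cabs_cexp -mulrA -expRD.
rewrite -[X in _ <= X]mulr1; apply: ler_pM; rewrite ?normr_ge0 ?expR_ge0 //.
  rewrite ger0_norm ?invr_ge0 ?pi_ge0 // invf_le1 ?pi_gt0 //.
  by have := pi_ge2 R; lra.
rewrite -[X in _ <= X]expR0 ler_expR !cabs_sqr; case: z w => a b [c d] /=.
have := sqr_ge0 (a - c); have := sqr_ge0 (b - d); lra.
Qed.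

Lemma mc_fock_kernel d (T : measurableType d) (F G : T -> C) : mc F -> mc G ->
  mc (fun p => fock_kernel (F p) (G p)).
Proof.
have m2 : measurable_fun setT ((fun x => - (x / 2)) : measurableTypeR R -> measurableTypeR R).
  by apply: measurable_funN; exact: mulrr_measurable.
have mh (H : T -> C) : mc H -> mc (fun p => - (cabs (H p) ^+ 2 / 2)%:C).
  move=> mH; have := mc_real m2 (mc_cabs2 mH); congr mc; apply/funext => p.
  by rewrite /= rmorphN.
move=> mF mG; apply: mcM; first apply: mcM; first exact: mc_cst.
  by apply: mc_cexp; exact: mh.
by apply: mc_cexp; apply: mcD; [apply: mcM => //; exact: mc_conj|exact: mh].
Qed.

Lemma fock_projE f (g : RxR -> R) z : measurableC f -> lebC.-integrable setT (EFin \o g) ->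
  (forall p, cabs (f (toC p)) <= g p) ->
  fock_proj f z = integralC (fun w => fock_kernel z w * f w).
Proof.
move=> mf ig Hg; rewrite /fock_proj -integralCZ.
  by congr integralC; apply/funext => w; rewrite /fock_kernel -!mulrA.
set c := (pi^-1)%:C * cexp (- (cabs z ^+ 2 / 2)%:C).
have c0 : c != 0.
  rewrite mulf_neq0 //.
    by rewrite fmorph_eq0 invr_eq0 gt_eqF // pi_gt0.
  by apply/eqP => /(congr1 (fun x => cabs x)); rewrite cabs_cexp cabs0; apply/eqP; rewrite gt_eqF // expR_gt0.
(* Without the outer factor c, the integrand is bounded by g / |c|. *)
apply: (@integrableC_dom _ (fun p => (cabs c)^-1 * g p)).
- have := mC_mul (mC_cst c^-1) (mC_mul (mc_fock_kernel (mc_cst _ z) (mC_id R)) mf).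
  congr measurableC; apply/funext => w; rewrite /fock_kernel -/c; field.
  exact: c0.
- exact: integrableR_Zl.
move=> p; rewrite -(ler_pM2l (cabs_gt0 c0)) mulrA divff ?mul1r; last by rewrite gt_eqF // cabs_gt0.
rewrite -cabsM mulrA cabsM; apply: le_trans (Hg p).
by rewrite ler_piMl ?cabs_ge0 //; exact: cabs_fock_kernel.
Qed.

Lemma cabs_fock_proj f (g : RxR -> R) z : measurableC f -> lebC.-integrable setT (EFin \o g) ->
  (forall p, cabs (f (toC p)) <= g p) -> cabs (fock_proj f z) <= 2 * \int[lebC]_p g p.
Proof.
move=> mf ig Hg; rewrite (fock_projE z mf ig Hg); apply: cabs_integralC => //.
  by apply: mC_mul => //; exact: (mc_fock_kernel (mc_cst _ z) (mC_id R)).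
by move=> p; rewrite cabsM (le_trans _ (Hg p)) // ler_piMl ?cabs_ge0 // cabs_fock_kernel.
Qed.

Lemma integrableC_kernel f (g : RxR -> R) z : measurableC f -> lebC.-integrable setT (EFin \o g) ->
  (forall p, cabs (f (toC p)) <= g p) -> integrableC (fun w => fock_kernel z w * f w).
Proof.
move=> mf ig Hg; apply: (integrableC_dom (g := g)) => //.
  by apply: mC_mul => //; exact: (mc_fock_kernel (mc_cst _ z) (mC_id R)).
by move=> p; rewrite cabsM (le_trans _ (Hg p)) // ler_piMl ?cabs_ge0 // cabs_fock_kernel.
Qed.

Lemma fock_projB f f' (g g' : RxR -> R) z : measurableC f -> measurableC f' ->
  lebC.-integrable setT (EFin \o g) -> lebC.-integrable setT (EFin \o g') ->
  (forall p, cabs (f (toC p)) <= g p) -> (forall p, cabs (f' (toC p)) <= g' p) ->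
  fock_proj (fun w => f w - f' w) z = fock_proj f z - fock_proj f' z.
Proof.
move=> mf mf' ig ig' Hg Hg'.
rewrite (fock_projE z mf ig Hg) (fock_projE z mf' ig' Hg').
rewrite (@fock_projE _ (fun p => g p + g' p)) //.
- rewrite -integralCB; [|exact: integrableC_kernel ig Hg|exact: integrableC_kernel ig' Hg'].
  by congr integralC; apply/funext => w; ring.
- exact: mC_sub.
- exact: integrableR_add.
by move=> p; apply: (le_trans (cabsBD _ _)); exact: lerD.
Qed.

(** After Fubini, the Hermitian symmetry of the kernel makes the inner integral the conjugate of Pi
    w at q, which is the conjugate of w q. *)
Lemma fock_proj_pairing (N w : C -> C) (a b : RxR -> R) : measurableC N -> measurableC w ->
  lebC.-integrable setT (EFin \o a) -> lebC.-integrable setT (EFin \o b) ->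
  (forall p, cabs (w (toC p)) <= a p) -> (forall p, cabs (N (toC p)) <= b p) ->
  (forall z, fock_proj w z = w z) ->
  integralC (fun z => conjc (w z) * fock_proj N z) = integralC (fun z => conjc (w z) * N z).
Proof.
move=> mN mw ia ib Ha Hb pw.
pose H z q := conjc (w z) * (fock_kernel z q * N q).
have -> : (fun z => conjc (w z) * fock_proj N z) = (fun z => integralC (H z)).
  apply/funext => z; rewrite (fock_projE z mN ib Hb) -integralCZ //.
  exact: integrableC_kernel ib Hb.
rewrite (@integralC_fubini H a b) //; last 2 first.
- apply: mcM; first apply: mc_conj.
    have [w1 w2] := mw; split; [exact: (measurableT_comp w1 measurable_fst)|exact: (measurableT_comp w2 measurable_fst)].
  have [i1 i2] := mC_id R.
  have m1 : mc (fun pq : RxR * RxR => toC pq.1).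
    by split; [exact: (measurableT_comp i1 measurable_fst)|exact: (measurableT_comp i2 measurable_fst)].
  have m2 : mc (fun pq : RxR * RxR => toC pq.2).
    by split; [exact: (measurableT_comp i1 measurable_snd)|exact: (measurableT_comp i2 measurable_snd)].
  apply: mcM; first exact: mc_fock_kernel.
  by have [n1 n2] := mN; split; [exact: (measurableT_comp n1 measurable_snd)|exact: (measurableT_comp n2 measurable_snd)].
- move=> p q; rewrite /H cabsM cabs_conj; apply: ler_pM; rewrite ?cabs_ge0 //.
  by rewrite cabsM (le_trans _ (Hb q)) // ler_piMl ?cabs_ge0 // cabs_fock_kernel.
congr integralC; apply/funext => q; rewrite mulrC -[in RHS](pw q) (fock_projE q mw ia Ha).
rewrite -integralC_conj; last exact: integrableC_kernel ia Ha.
rewrite -integralCZ.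
  congr integralC; apply/funext => z; rewrite /H conjcM fock_kernel_conj; ring.
have [j1 j2] := integrableC_kernel q mw ia Ha.
apply: (integrableC_dom (g := a)) => //.
  by apply: mC_conj; apply: mC_mul => //; exact: (mc_fock_kernel (mc_cst _ q) (mC_id R)).
by move=> p; rewrite cabs_conj cabsM (le_trans _ (Ha p)) // ler_piMl ?cabs_ge0 // cabs_fock_kernel.
Qed.
End ComplexIntegral.

(** * The energy of a difference of solutions *)

Section Energy.
Variable R : realType.
Local Notation C := R[i].
Local Notation RxR := (measurableTypeR R * measurableTypeR R)%type.
Local Notation lebC := (@lebC R).
Implicit Types (w : R -> C -> C) (k E : R).

(** The pointwise counterpart of a bound on [normX k f]; for a Gaussian times an entire function it
    follows from one. *)
Definition expdecay k E (f : C -> C) : Prop := forall z, cabs (f z) <= E * expR (- (k * cabs z)).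

Lemma expdecay_integrable k E : 0 < k ->
  lebC.-integrable setT (EFin \o (fun p : RxR => E * expR (- (k * cabs (toC p))))).
Proof.
move=> k0; apply: integrableR_Zl; have := integrable_exp_cabs k0.
by congr integrable; apply/funext => p; rewrite /= mulNr.
Qed.

Lemma expdecay_ge0 k E f : expdecay k E f -> 0 <= E.
Proof. by move=> /(_ 0); rewrite -(pmulr_lge0 _ (expR_gt0 (- (k * cabs (0 : C))))); exact: le_trans (cabs_ge0 _). Qed.

Lemma expdecay_le k E f z : 0 <= k -> expdecay k E f -> cabs (f z) <= E.
Proof.
move=> k0 H; apply: (le_trans (H z)); rewrite ler_piMr ?(expdecay_ge0 H) //.
by rewrite -[X in _ <= X]expR0 ler_expR oppr_le0 mulr_ge0 ?cabs_ge0.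
Qed.

Definition energy w (s : R) : R := \int[lebC]_p (cabs (w s (toC p)) ^+ 2 / 2).

Lemma time_derivable_cabs2 w s z : time_derivable w s z ->
  is_derive s 1 (fun s => cabs (w s z) ^+ 2 / 2) (Re (conjc (w s z) * dt w s z)).
Proof.
move=> [d1 d2]; have i1 := derivableP d1; have i2 := derivableP d2.
have E : (fun s => cabs (w s z) ^+ 2 / 2) =
   (fun s => 2^-1 *: (Re (w s z) * Re (w s z) + Im (w s z) * Im (w s z))).
  by apply/funext => x; rewrite cabs_sqr /GRing.scale /= !expr2 mulrC.
rewrite E Re_conjM /dt /= !derive1E.
have := is_deriveZ 2^-1 (is_deriveD (is_deriveM i1 i1) (is_deriveM i2 i2)).
by congr (is_derive _ _ _ _); rewrite /GRing.scale /=; field.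
Qed.

(** Differentiation under the integral with majorant E E' exp(-k |z|): the decay comes from w, and
    the time derivative only has to be bounded. *)
Lemma energy_derivable w (t r k E E' : R) : 0 < k -> 0 < r ->
  (forall s, measurableC (w s)) ->
  (forall s z, time_derivable w s z) ->
  (forall s, `|s - t| < r -> expdecay k E (w s)) ->
  (forall s z, `|s - t| < r -> cabs (dt w s z) <= E') ->
  is_derive t 1 (energy w) (\int[lebC]_p Re (conjc (w t (toC p)) * dt w t (toC p))).
Proof.
move=> k0 r0 mw dw bw bd.
have tr s : s \in `]t - r, t + r[%classic -> `|s - t| < r.
  by rewrite inE /= in_itv /= ltr_norml; lra.
have E0 : 0 <= E by apply: (@expdecay_ge0 k E (w t)); apply: bw; rewrite subrr normr0.
have E'0 : 0 <= E' by apply: (le_trans (cabs_ge0 (dt w t 0))); apply: bd; rewrite subrr normr0.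
pose G (p : RxR) := (E * E') * expR (- (k * cabs (toC p))).
have iG : lebC.-integrable setT (EFin \o G) by exact: expdecay_integrable.
have G0 p : 0 <= G p by rewrite !mulr_ge0 ?expR_ge0.
have It : `]t - r, t + r[%classic t by rewrite /= in_itv /=; lra.
have idf s : `]t - r, t + r[%classic s ->
    lebC.-integrable setT (EFin \o (fun p : RxR => cabs (w s (toC p)) ^+ 2 / 2)).
  move=> /mem_set /tr st.
  apply: (le_integrableR (g := fun p : RxR => (E * E) * expR (- (k * cabs (toC p))))); last exact: expdecay_integrable.
    apply: measurable_funM; last exact: measurable_cst.
    by apply: measurable_funX; exact: mC_cabs_fun.
  move=> p; rewrite ger0_norm; last by rewrite divr_ge0 // sqr_ge0.
  have h1 := bw s st (toC p); have h2 := expdecay_le (toC p) (ltW k0) (bw s st).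
  have := ler_pM (cabs_ge0 _) (cabs_ge0 _) h2 h1; rewrite -expr2.
  have := sqr_ge0 (cabs (w s (toC p))); lra.
have dfd s (p : RxR) : `]t - r, t + r[%classic s -> setT p -> derivable (fun x => cabs (w x (toC p)) ^+ 2 / 2) s 1.
  by move=> _ _; have [] := time_derivable_cabs2 (dw s (toC p)).
have Gub s (p : RxR) : `]t - r, t + r[%classic s -> setT p ->
    `|partial1of2 (fun x (p : RxR) => cabs (w x (toC p)) ^+ 2 / 2) s p| <= G p.
  move=> /mem_set /tr st _; rewrite /partial1of2 derive1E.
  have [_ ->] := time_derivable_cabs2 (dw s (toC p)).
  apply: (le_trans (Re_le_cabs _)); rewrite cabsM cabs_conj /G mulrAC.
  by apply: ler_pM; rewrite ?cabs_ge0 // ?bd //; exact: bw.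
have D := @derivable_under_integral R _ _ lebC (fun x (p : RxR) => cabs (w x (toC p)) ^+ 2 / 2)
  setT measurableT t (t - r) (t + r) It idf dfd G G0 iG Gub.
split; first exact: D.
rewrite -derive1E.
have := @differentiation_under_integral R _ _ lebC (fun x (p : RxR) => cabs (w x (toC p)) ^+ 2 / 2)
  setT measurableT t (t - r) (t + r) It idf dfd G G0 iG Gub.
rewrite /energy => ->; apply: eq_Rintegral => p _.
by rewrite /partial1of2 derive1E; have [_ ->] := time_derivable_cabs2 (dw t (toC p)).
Qed.

(* For i dw/dt = Pi N with Pi w = w, symmetry of Pi moves it from N to w. *)
Lemma energy_derive_proj w (N : R -> C -> C) (t r k E B : R) : 0 < k -> 0 < r ->
  (forall s, gauss_entire (w s)) -> (forall s, measurableC (N s)) ->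
  (forall s z, time_derivable w s z) ->
  (forall s, `|s - t| < r -> expdecay k E (w s)) ->
  (forall s, `|s - t| < r -> expdecay k B (N s)) ->
  (forall s z, `|s - t| < r -> 'i%C * dt w s z = fock_proj (N s) z) ->
  is_derive t 1 (energy w) (\int[lebC]_p Im (conjc (w t (toC p)) * N t (toC p))).
Proof.
move=> k0 r0 GE mN dw bw bN eqn.
have mw s : measurableC (w s) by case: (GE s).
have tt : `|t - t| < r by rewrite subrr normr0.
pose bB (p : RxR) := B * expR (- (k * cabs (toC p))).
have ibB : lebC.-integrable setT (EFin \o bB) by exact: expdecay_integrable.
have dtE s z : `|s - t| < r -> dt w s z = - 'i%C * fock_proj (N s) z.
  by move=> st; rewrite -eqn // mulrA mulNr -expr2 sqr_i opprK mul1r.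
have bd s z : `|s - t| < r -> cabs (dt w s z) <= 2 * \int[lebC]_p bB p.
  move=> st; rewrite dtE // cabsM cabsN cabsi mul1r.
  by apply: cabs_fock_proj => // p; exact: bN.
have := energy_derivable k0 r0 mw dw bw bd.
suff -> : \int[lebC]_p Re (conjc (w t (toC p)) * dt w t (toC p)) =
   \int[lebC]_p Im (conjc (w t (toC p)) * N t (toC p)) by [].
have pw : forall z, fock_proj (w t) z = w t z.
  by apply: (@fock_proj_id R (w t) E (GE t)) => z; exact: expdecay_le (ltW k0) (bw t tt).
have := fock_proj_pairing (mN t) (mw t) (expdecay_integrable E k0) ibB
   (fun p => bw t tt (toC p)) (fun p => bN t tt (toC p)) pw.
move=> /(congr1 (fun x => Im x)); rewrite /integralC /= => <-.
apply: eq_Rintegral => p _; rewrite dtE //.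
by case: (conjc _) (fock_proj _ _) => a b [c d] /=; ring.
Qed.

(** Splitting off |b'|^2 (a' - a), whose pairing with a' - a is real, leaves (|b'|^2 - |b|^2) a, and
    the difference of squares factors. *)
Lemma Im_cubic_le (a' a b' b : C) :
  `|Im (conjc (a' - a) * ((cabs b' ^+ 2)%:C * a' - (cabs b ^+ 2)%:C * a))| <=
  cabs (a' - a) * cabs (b' - b) * ((cabs b' + cabs b) * cabs a).
Proof.
have -> : Im (conjc (a' - a) * ((cabs b' ^+ 2)%:C * a' - (cabs b ^+ 2)%:C * a)) =
   Im (conjc (a' - a) * ((cabs b' ^+ 2 - cabs b ^+ 2)%:C * a)).
  move: (cabs b' ^+ 2) (cabs b ^+ 2) => x y.
  by case: a' a => a1 a2 [a3 a4] /=; ring.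
apply: (le_trans (Im_le_cabs _)); rewrite !cabsM cabs_conj cabsR -!mulrA ler_wpM2l ?cabs_ge0 //.
rewrite mulrA ler_wpM2r ?cabs_ge0 // subr_sqr normrM (ger0_norm (addr_ge0 (cabs_ge0 _) (cabs_ge0 _))).
by rewrite ler_wpM2r ?addr_ge0 ?cabs_ge0 // cabs_tri.
Qed.

Lemma expdecay_cubic k E (f g : C -> C) : 0 <= k -> expdecay k E f -> expdecay k E g ->
  expdecay k (E ^+ 3) (fun z => (cabs (f z) ^+ 2)%:C * g z).
Proof.
move=> k0 df dg z; have E0 := expdecay_ge0 df.
rewrite cabsM cabsR ger0_norm ?sqr_ge0 //.
have -> : E ^+ 3 * expR (- (k * cabs z)) = E ^+ 2 * (E * expR (- (k * cabs z))) by ring.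
apply: ler_pM; rewrite ?sqr_ge0 ?cabs_ge0 //.
by rewrite ler_pXn2r ?nnegrE ?cabs_ge0 // (expdecay_le z k0 df).
Qed.

Lemma expdecayB k E E' (f g : C -> C) : expdecay k E f -> expdecay k E' g ->
  expdecay k (E + E') (fun z => f z - g z).
Proof. by move=> df dg z; apply: (le_trans (cabsBD _ _)); rewrite mulrDl lerD. Qed.

Lemma time_derivableB (u u' : R -> C -> C) s z :
  time_derivable u s z -> time_derivable u' s z ->
  time_derivable (fun s z => u' s z - u s z) s z /\
  dt (fun s z => u' s z - u s z) s z = dt u' s z - dt u s z.
Proof.
move=> [d1 d2] [e1 e2].
have ER : (fun x => Re (u' x z - u x z)) = (fun x => Re (u' x z)) - (fun x => Re (u x z)).
  by apply/funext => x; rewrite Re_add Re_opp.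
have EI : (fun x => Im (u' x z - u x z)) = (fun x => Im (u' x z)) - (fun x => Im (u x z)).
  by apply/funext => x; rewrite Im_add Im_opp.
rewrite /time_derivable /dt ER EI; split; first by split; exact: derivableB.
rewrite (derive1E (_ - fun x => Re (u x z))) (derive1E (_ - fun x => Im (u x z))).
by rewrite (deriveB e1 d1) (deriveB e2 d2) -!derive1E.
Qed.

Section Difference.
Variables (u v u' v' : R -> C -> C) (k : R).
Hypothesis k0 : 0 < k.
Hypotheses (gu : forall s, gauss_entire (u s)) (gv : forall s, gauss_entire (v s)).
Hypotheses (gu' : forall s, gauss_entire (u' s)) (gv' : forall s, gauss_entire (v' s)).
Hypotheses (sol : LLL_solution u v) (sol' : LLL_solution u' v').

Let w1 s z := u' s z - u s z.
Let w2 s z := v' s z - v s z.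

Definition diff_energy (s : R) : R := energy w1 s + energy w2 s.

Definition decay_near (t r E : R) : Prop := forall s, `|s - t| < r ->
  [/\ expdecay k E (u s), expdecay k E (v s), expdecay k E (u' s) & expdecay k E (v' s)].

(** The majorant Q is left free because two are used: a multiple of the energy density for Gronwall,
    and an explicitly decaying function for large times. *)
Lemma diff_energy_derive t r E : 0 < r -> decay_near t r E -> exists d,
  is_derive t 1 diff_energy d /\
  forall Q : RxR -> R, lebC.-integrable setT (EFin \o Q) ->
    (forall p, cabs (w1 t (toC p)) * cabs (w2 t (toC p)) *
       ((cabs (v' t (toC p)) + cabs (v t (toC p))) * cabs (u t (toC p)) +
        (cabs (u' t (toC p)) + cabs (u t (toC p))) * cabs (v t (toC p))) <= Q p) ->
    `|d| <= \int[lebC]_p Q p.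
Proof.
move=> r0 bn.
pose N1 s z := (cabs (v' s z) ^+ 2)%:C * u' s z - (cabs (v s z) ^+ 2)%:C * u s z.
(* The order is reversed to absorb the minus sign of the second equation. *)
pose N2 s z := (cabs (u s z) ^+ 2)%:C * v s z - (cabs (u' s z) ^+ 2)%:C * v' s z.
have mu s : measurableC (u s) by case: (gu s).
have mv s : measurableC (v s) by case: (gv s).
have mu' s : measurableC (u' s) by case: (gu' s).
have mv' s : measurableC (v' s) by case: (gv' s).
have mN1 s : measurableC (N1 s) by apply: mC_sub; apply: mC_mul => //; exact: mC_cabs2.
have mN2 s : measurableC (N2 s) by apply: mC_sub; apply: mC_mul => //; exact: mC_cabs2.
have bN1 s : `|s - t| < r -> expdecay k (E ^+ 3 + E ^+ 3) (N1 s).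
  by move=> /bn[? ? ? ?]; apply: expdecayB; apply: expdecay_cubic => //; exact: ltW.
have bN2 s : `|s - t| < r -> expdecay k (E ^+ 3 + E ^+ 3) (N2 s).
  by move=> /bn[? ? ? ?]; apply: expdecayB; apply: expdecay_cubic => //; exact: ltW.
have bw1 s : `|s - t| < r -> expdecay k (E + E) (w1 s) by move=> /bn[? ? ? ?]; exact: expdecayB.
have bw2 s : `|s - t| < r -> expdecay k (E + E) (w2 s) by move=> /bn[? ? ? ?]; exact: expdecayB.
have dw1 s z : time_derivable w1 s z /\ dt w1 s z = dt u' s z - dt u s z.
  by have [? _ _ _] := sol s z; have [? _ _ _] := sol' s z; exact: time_derivableB.
have dw2 s z : time_derivable w2 s z /\ dt w2 s z = dt v' s z - dt v s z.
  by have [_ ? _ _] := sol s z; have [_ ? _ _] := sol' s z; exact: time_derivableB.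
have i3 : lebC.-integrable setT (EFin \o (fun p : RxR => E ^+ 3 * expR (- (k * cabs (toC p))))).
  exact: expdecay_integrable.
have e1 s z : `|s - t| < r -> 'i%C * dt w1 s z = fock_proj (N1 s) z.
  move=> /bn[bu bv bu' bv']; rewrite (dw1 s z).2 mulrBr.
  have [_ _ -> _] := sol s z; have [_ _ -> _] := sol' s z.
  by rewrite -(fock_projB _ _ _ i3 i3) //;
    [apply: mC_mul => //; exact: mC_cabs2|apply: mC_mul => //; exact: mC_cabs2|
     move=> p; exact: expdecay_cubic (ltW k0) bv' bu' _|move=> p; exact: expdecay_cubic (ltW k0) bv bu _].
have e2 s z : `|s - t| < r -> 'i%C * dt w2 s z = fock_proj (N2 s) z.
  move=> /bn[bu bv bu' bv']; rewrite (dw2 s z).2 mulrBr.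
  have [_ _ _ ->] := sol s z; have [_ _ _ ->] := sol' s z; rewrite opprK addrC.
  by rewrite -(fock_projB _ _ _ i3 i3) //;
    [apply: mC_mul => //; exact: mC_cabs2|apply: mC_mul => //; exact: mC_cabs2|
     move=> p; exact: expdecay_cubic (ltW k0) bu bv _|move=> p; exact: expdecay_cubic (ltW k0) bu' bv' _].
have D1 := energy_derive_proj k0 r0 (fun s => gauss_entireB (gu' s) (gu s)) mN1
   (fun s z => (dw1 s z).1) bw1 bN1 e1.
have D2 := energy_derive_proj k0 r0 (fun s => gauss_entireB (gv' s) (gv s)) mN2
   (fun s z => (dw2 s z).1) bw2 bN2 e2.
set d1 := Rintegral _ _ _ in D1; set d2 := Rintegral _ _ _ in D2.
exists (d1 + d2); split; first exact: is_deriveD.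
move=> Q iQ HQ.
have tt : `|t - t| < r by rewrite subrr normr0.
have dom w (N : R -> C -> C) B B' : expdecay k B (w t) -> expdecay k B' (N t) -> measurableC (w t) -> measurableC (N t) ->
    lebC.-integrable setT (EFin \o (fun p : RxR => Im (conjc (w t (toC p)) * N t (toC p)))).
  move=> bw bN mw mN.
  have H (p : RxR) : cabs (conjc (w t (toC p)) * N t (toC p)) <= B * B' * expR (- (k * cabs (toC p))).
    rewrite cabsM cabs_conj -mulrA; apply: ler_pM; rewrite ?cabs_ge0 //.
    exact: expdecay_le (ltW k0) bw.
  exact: (integrableC_dom (mC_mul (mC_conj mw) mN) (expdecay_integrable _ k0) H).2.
have mw1 : measurableC (w1 t) by exact: mC_sub.
have mw2 : measurableC (w2 t) by exact: mC_sub.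
have J1 := dom w1 N1 _ _ (bw1 t tt) (bN1 t tt) mw1 (mN1 t).
have J2 := dom w2 N2 _ _ (bw2 t tt) (bN2 t tt) mw2 (mN2 t).
rewrite /d1 /d2 -RintegralD //.
have J := integrableR_add J1 J2.
apply: (le_trans (le_normr_Rintegral measurableT J)).
apply: le_Rintegral => //; first exact: integrable_norm.
move=> p _; apply: le_trans (HQ p); apply: (le_trans (ler_normD _ _)).
rewrite [X in _ <= X]mulrDr; apply: lerD; first exact: Im_cubic_le.
rewrite (mulrC (cabs (w1 _ _))).
have := Im_cubic_le (v' t (toC p)) (v t (toC p)) (u' t (toC p)) (u t (toC p)).
rewrite -[X in X <= _]normrN -Im_opp; congr (`|Im _| <= _); rewrite /N2 /w2; ring.
Qed.
End Difference.
End Energy.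

(** * Solitons *)

Section Soliton.
Variable R : realType.
Local Notation C := R[i].

Lemma gauss_entireD (f f' : C -> C) : gauss_entire f -> gauss_entire f' ->
  gauss_entire (fun z => f z + f' z).
Proof.
move=> [mf [g gE fE]] [mf' [g' gE' fE']]; split; first exact: mC_add.
exists (fun z => g z + g' z) => z; last by rewrite fE fE'; ring.
have [A wA] := gE z; have [B wB] := gE' z; exists (A + B).
by have := wirtD wA wB; rewrite addr0.
Qed.

Lemma gauss_entireZ (c : C) (f : C -> C) : gauss_entire f -> gauss_entire (fun z => c * f z).
Proof.
move=> [mf [g gE fE]]; split; first exact: mC_mul (mC_cst c) mf.
exists (fun z => c * g z) => z; last by rewrite fE; ring.
by have [A wA] := gE z; exists (c * A); have := wirtZ c wA; rewrite mulr0.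
Qed.

Lemma gauss_entire0 : gauss_entire (fun _ : C => 0).
Proof.
split; first exact: mC_cst.
by exists (fun _ => 0) => z; [exists 0; exact: wirt_cst|rewrite mulr0].
Qed.

Lemma gauss_entire_sum (I : Type) (s : seq I) (F : I -> C -> C) :
  (forall i, gauss_entire (F i)) -> gauss_entire (fun z => \sum_(i <- s) F i z).
Proof.
move=> HF; elim: s => [|i s IH].
  by have := gauss_entire0; congr gauss_entire; apply/funext => z; rewrite big_nil.
by have := gauss_entireD (HF i) IH; congr gauss_entire; apply/funext => z; rewrite big_cons.
Qed.

Lemma wirt_pow (c z : C) n : exists A, wirt (fun z => (z + c) ^+ n) z A 0.
Proof.
elim: n => [|n [A IH]]; first by exists 0; exact: wirt_cst.
have := wirtM (wirtD (wirt_id z) (wirt_cst c z)) IH.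
rewrite !(mul0r, mulr0, addr0) => H; eexists.
by apply: wirt_ext H => w /=; rewrite exprS.
Qed.

Lemma mC_cexp_gauss : measurableC (fun z : C => cexp (- (cabs z ^+ 2 / 2)%:C)).
Proof.
apply: mC_cexp; have h : measurable_fun setT ((fun x : R => - (x / 2)) : measurableTypeR R -> measurableTypeR R).
  by apply: measurable_funN; exact: mulrr_measurable.
have := mC_real h (mC_cabs2 (mC_id R)).
by congr measurableC; apply/funext => z; rewrite /= rmorphN.
Qed.

(* A magnetic translate of phi: completing the square in the exponent leaves an
   entire function times exp(-|z|^2/2). *)
Lemma gauss_entire_phi n (gamma a : C) :
  gauss_entire (fun z => phi n gamma (z + a) * cexp ((1 / 2)%:C * (conjc z * a - z * conjc a))).
Proof.
pose b : C := - (cabs a ^+ 2 / 2)%:C - (cabs gamma ^+ 2 / 2)%:C + gamma * a.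
pose c : C := ((Num.sqrt (pi * n`!%:R))^-1)%:C.
pose g z : C := c * (z + (a - conjc gamma)) ^+ n * cexp ((gamma - conjc a) * z + b).
have E z : phi n gamma (z + a) * cexp ((1 / 2)%:C * (conjc z * a - z * conjc a)) =
   cexp (- (cabs z ^+ 2 / 2)%:C) * g z.
  rewrite /phi /g -/c addrA; set P := _ ^+ n.
  set X := (X in c * P * cexp X * _); set Y := (X in c * P * _ * cexp X = _).
  set G := (X in _ = cexp X * _); set H := (X in _ = _ * (c * P * cexp X)).
  have -> : c * P * cexp X * cexp Y = c * P * cexp (X + Y) by rewrite (cexpD X Y); ring.
  have -> : cexp G * (c * P * cexp H) = c * P * cexp (G + H) by rewrite (cexpD G H); ring.
  congr (_ * cexp _); rewrite /X /Y /G /H /b !cabs_sqr.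
  case: z a gamma {c g b P X Y G H} => z1 z2 [a1 a2] [g1 g2] /=.
  by apply/eqP; rewrite eq_complex /=; apply/andP; split; apply/eqP; field.
have mlin : measurableC (fun z : C => (gamma - conjc a) * z + b).
  by apply: mC_add; [apply: mC_mul; [exact: mC_cst|exact: mC_id]|exact: mC_cst].
split.
  have mg : measurableC g.
    apply: mC_mul; last exact: mC_cexp.
    apply: mC_mul; first exact: mC_cst.
    elim: n {c g E} => [|n IH]; first exact: mC_cst.
    have := mC_mul (mC_add (mC_id R) (mC_cst (a - conjc gamma))) IH.
    by congr measurableC; apply/funext => z; rewrite exprS.
  have := mC_mul mC_cexp_gauss mg.
  by congr measurableC; apply/funext => z; rewrite E.
exists g => // z.
have [A wA] := wirt_pow (a - conjc gamma) z n.
have w1 : wirt (fun z => (gamma - conjc a) * z + b) z (gamma - conjc a) 0.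
  by have := wirtD (wirtZ (gamma - conjc a) (wirt_id z)) (wirt_cst b z); rewrite !(mulr0, addr0, mulr1).
have := wirtM (wirtZ c wA) (wirt_comp w1 (wirt_cexp _)).
by rewrite !(mulr0, mul0r, addr0, add0r) => H; eexists; exact: H.
Qed.

Lemma cabs_expi (x : R) : cabs (expi x) = 1.
Proof. by rewrite /expi cabs_cexp /= mul0r mul1r subrr expR0. Qed.

(** The exponent completes to -|z - conj(gamma)|^2 / 2, and the normalising factor is at most 1 as
    pi n! >= 1. *)
Lemma cabs_phi n (gamma z : C) :
  cabs (phi n gamma z) <= cabs (z - conjc gamma) ^+ n * expR (- (cabs (z - conjc gamma) ^+ 2 / 2)).
Proof.
have pE : cabs (z - conjc gamma) ^+ 2 / 2 = cabs z ^+ 2 / 2 + cabs gamma ^+ 2 / 2 - Re (gamma * z).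
  by rewrite !cabs_sqr; case: z gamma => z1 z2 [g1 g2] /=; field.
have cX (w : C) m : cabs (w ^+ m) = cabs w ^+ m.
  by elim: m => [|m IH]; rewrite ?expr0 ?cabs1 // !exprS cabsM IH.
rewrite /phi !cabsM cabsR cabs_cexp cX pE.
have -> : Re (- (cabs z ^+ 2 / 2)%:C - (cabs gamma ^+ 2 / 2)%:C + gamma * z) =
   - (cabs z ^+ 2 / 2 + cabs gamma ^+ 2 / 2 - Re (gamma * z)).
  by rewrite !Re_add !Re_opp /=; ring.
rewrite ler_wpM2r ?expR_ge0 // ler_piMl ?exprn_ge0 ?cabs_ge0 //.
rewrite ger0_norm ?invr_ge0 ?sqrtr_ge0 // invf_le1.
  rewrite -[X in X <= _](sqrtr1 R) ler_wsqrtr //.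
  have f1 : 1 <= n`!%:R :> R by rewrite ler1n fact_gt0.
  by have := pi_ge2 R; nra.
by rewrite sqrtr_gt0 mulr_gt0 ?pi_gt0 // ltr0n fact_gt0.
Qed.

(* (1+x) exp(-x^2/2) <= exp((k+1)x - x^2/2) exp(-kx), and the exponent is maximal at x = k+1. *)
Lemma gauss_le_exp (k x : R) : 0 <= x ->
  (1 + x) * expR (- (x ^+ 2 / 2)) <= expR ((k + 1) ^+ 2 / 2) * expR (- (k * x)).
Proof.
move=> x0; apply: (@le_trans _ _ (expR x * expR (- (x ^+ 2 / 2)))).
  by rewrite ler_wpM2r ?expR_ge0 // expR_ge1Dx.
rewrite -!expRD ler_expR; have := sqr_ge0 (k + 1 - x); lra.
Qed.

Lemma cabs_profile (K s th k : R) (c gamma z : C) : 0 <= K -> cabs c <= 1 ->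
  cabs (K%:C * expi s * ((1 / 2)%:C * phi 0 gamma z + c * phi 1 gamma z)) <=
  K * (expR ((k + 1) ^+ 2 / 2) * expR (- (k * cabs (z - conjc gamma)))).
Proof.
move=> K0 c1; rewrite (cabsM _ (_ + _)) (cabsM K%:C) cabsR cabs_expi mulr1 ger0_norm // ler_wpM2l //.
apply: le_trans (gauss_le_exp k (cabs_ge0 _)).
apply: (le_trans (cabsD _ _)); rewrite (cabsM (1 / 2)%:C) (cabsM c) cabsR.
have h0 := cabs_phi 0 gamma z; have h1 := cabs_phi 1 gamma z.
rewrite expr0 mul1r in h0; rewrite expr1 in h1.
rewrite [X in _ <= X]mulrDl [X in _ <= X + _]mul1r; apply: lerD.
  apply: le_trans h0; rewrite ler_piMl ?cabs_ge0 // ger0_norm; lra.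
by apply: le_trans h1; rewrite ler_piMl ?cabs_ge0.
Qed.

Section Sum.
Variables (n : nat) (K a b theta : 'I_n -> R) (gamma : 'I_n -> C).
Hypothesis K0 : forall j, 0 < K j.

Lemma profile_coef (x : R) : cabs ((Num.sqrt 3 / 2)%:C * 'i%C * expi x) <= 1.
Proof.
rewrite !cabsM cabsR cabsi cabs_expi !mulr1 ger0_norm; last by rewrite divr_ge0 ?sqrtr_ge0.
rewrite ler_pdivrMr // mul1r -(@ler_pXn2r _ 2) ?nnegrE ?sqrtr_ge0 // sqr_sqrtr //; lra.
Qed.

(** The common shape of the U_j and the V_j, with free phase and free coefficient of modulus at most
    1, so that each bound is proved once for both families. *)
Definition profile (W : 'I_n -> C -> C) : Prop := forall j, exists (s : R) (c : C),
  cabs c <= 1 /\ forall z, W j z = (K j)%:C * expi s * ((1 / 2)%:C * phi 0 (gamma j) z + c * phi 1 (gamma j) z).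

Lemma profileU_profile : profile (profileU K a theta gamma).
Proof. by move=> j; eexists; eexists; split; first exact: (profile_coef (theta j)). Qed.

Lemma profileV_profile : profile (profileV K b theta gamma).
Proof.
move=> j; exists (b j), (- ((Num.sqrt 3 / 2)%:C * 'i%C * expi (theta j))); split.
  by rewrite cabsN; exact: profile_coef.
by move=> z; rewrite /profileV mulNr.
Qed.

Lemma gauss_entire_soliton (om : 'I_n -> R) W t : profile W ->
  gauss_entire (soliton_sum K theta om W t).
Proof.
move=> PW; apply: gauss_entire_sum => j; have [s [c [_ WE]]] := PW j.
set x := expi _; set al := alpha K theta j.
have e0 := gauss_entireZ (x * ((K j)%:C * expi s) * (1 / 2)%:C) (gauss_entire_phi 0 (gamma j) (al * t%:C)).
have e1 := gauss_entireZ (x * ((K j)%:C * expi s) * c) (gauss_entire_phi 1 (gamma j) (al * t%:C)).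
have := gauss_entireD e0 e1; congr gauss_entire; apply/funext => z; rewrite WE.
have -> : (1 / 2)%:C * (conjc z * al - z * conjc al) * t%:C =
   (1 / 2)%:C * (conjc z * (al * t%:C) - z * conjc (al * t%:C)).
  by rewrite conjcM conjc_real; ring.
ring.
Qed.

(** The magnetic phases have modulus one. The rate k is free: it is taken to be 1 for the sup bound
    and kappa for the weighted one. *)
Lemma cabs_soliton (om : 'I_n -> R) W t z (k : R) : profile W ->
  cabs (soliton_sum K theta om W t z) <= \sum_(j < n) K j * (expR ((k + 1) ^+ 2 / 2) *
    expR (- (k * cabs (z + alpha K theta j * t%:C - conjc (gamma j))))).
Proof.
move=> PW; rewrite /soliton_sum.
have cabs_sum (F : 'I_n -> C) : cabs (\sum_(j < n) F j) <= \sum_(j < n) cabs (F j).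
  elim/big_ind2 : _ => [|x y x' y' h h'|//]; first by rewrite cabs0.
  by apply: (le_trans (cabsD _ _)); exact: lerD.
apply: (le_trans (cabs_sum _)); apply: ler_sum => j _.
have [s [c [c1 WE]]] := PW j; rewrite !cabsM cabs_expi mul1r WE cabs_cexp.
set al := alpha _ _ _; have -> : Re ((1 / 2)%:C * (conjc z * al - z * conjc al) * t%:C) = 0.
  by case: z al => z1 z2 [a1 a2] /=; ring.
by rewrite expR0 mulr1; apply: cabs_profile => //; exact: ltW.
Qed.
End Sum.
End Soliton.

(** * Uniqueness of decaying differences *)

Section Gronwall.
Variable R : realType.

Lemma is_derive_nondecreasing (f : R -> R) (a b : R) : a <= b ->
  (forall s, a <= s <= b -> exists2 d, is_derive s 1 f d & 0 <= d) -> f a <= f b.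
Proof.
move=> ab H.
have [df Hdf] : exists df : R -> R, forall s, a <= s <= b -> is_derive s 1 f (df s) /\ 0 <= df s.
  have step s : exists d, a <= s <= b -> is_derive s 1 f d /\ 0 <= d.
    have [/H[d h1 h2]|n] := pselect (a <= s <= b); first by exists d.
    by exists 0 => h.
  by have [df h] := choice step; exists df.
have [c|c|c] := MVT_segment (f := f) (df := df) ab.
- by rewrite in_itv /= => /andP[ac cb]; apply: (Hdf c _).1; rewrite !ltW.
- apply: derivable_within_continuous => x; rewrite in_itv /= => /Hdf[h _].
  by case: h.
rewrite in_itv /= => /Hdf[_ c0] E; rewrite -subr_ge0 E mulr_ge0 // subr_ge0 //.
Qed.

Lemma is_derive_expM (c x : R) : is_derive x 1 (fun s => expR (c * s)) (c * expR (c * x)).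
Proof.
have h : is_derive x 1 (fun s : R => c * s) c.
  have := is_deriveZ c (is_derive_id x 1).
  by congr (is_derive _ _ _ _); rewrite /GRing.scale /= mulr1.
by have := is_derive1_comp (is_derive_expR (c * x)) h; rewrite mulrC.
Qed.

(** y exp(L s) has derivative (y' + L y) exp(L s) >= 0. *)
Lemma gronwall_backward (y : R -> R) (L a b : R) : a <= b ->
  (forall s, a <= s <= b -> exists2 d, is_derive s 1 y d & `|d| <= L * y s) ->
  y a * expR (L * a) <= y b * expR (L * b).
Proof.
move=> ab H; apply: (is_derive_nondecreasing (f := fun s => y s * expR (L * s))) => // s /H[d yd db].
have := is_deriveM yd (is_derive_expM L s); rewrite /GRing.scale /= => D.
eexists; first exact: D.
have -> : y s * (L * expR (L * s)) + expR (L * s) * d = (L * y s + d) * expR (L * s) by ring.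
by rewrite mulr_ge0 ?expR_ge0 //; move: db; rewrite ler_norml; lra.
Qed.

Lemma expR_small (D e be : R) : 0 < e -> 0 < be -> exists2 T, 0 <= T &
  forall t, T <= t -> D * expR (- (be * t)) <= e.
Proof.
move=> e0 b0; exists (`|D| / e / be); first by rewrite !divr_ge0 // ltW.
move=> t ht; apply: (@le_trans _ _ (`|D| * expR (- (be * t)))).
  by rewrite ler_wpM2r ?expR_ge0 // ler_norm.
rewrite expRN ler_pdivrMr ?expR_gt0 //.
have h : `|D| / e <= be * t by rewrite [be * _]mulrC -ler_pdivrMr.
have h2 := expR_ge1Dx (be * t).
have : `|D| / e <= expR (be * t) by lra.
by rewrite ler_pdivrMr // [e * _]mulrC.
Qed.

(** y - (D / be) exp(-be s) is nondecreasing, and at late times it is at most any given positive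
    number. *)
Lemma integrate_decay (y : R -> R) (D be T : R) : 0 < be ->
  (forall s, T <= s -> exists2 d, is_derive s 1 y d & `|d| <= D * expR (- (be * s))) ->
  (forall e, 0 < e -> exists T', forall s, T' <= s -> y s <= e) ->
  forall t, T <= t -> y t <= D / be * expR (- (be * t)).
Proof.
move=> b0 H y0 t Tt; rewrite -subr_le0; apply/ler_addgt0Pl => e e0; rewrite addr0.
have D0 : 0 <= D.
  have [d _ hd] := H T (lexx T); have := le_trans (normr_ge0 d) hd.
  by rewrite pmulr_lge0 // expR_gt0.
have [T' HT'] := y0 e e0; pose s := Num.max t T'.
have ts : t <= s by rewrite /s le_max lexx.
have T's : T' <= s by rewrite /s le_max lexx orbT.
apply: le_trans (HT' s T's).
apply: (@le_trans _ _ (y s - D / be * expR (- (be * s)))); last first.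
  by rewrite gerBl mulr_ge0 ?expR_ge0 // divr_ge0 // ltW.
apply: (is_derive_nondecreasing (f := fun s => y s - D / be * expR (- (be * s)))) => // x /andP[tx xs].
have [d yd db] := H x (le_trans Tt tx).
have h : is_derive x 1 (fun s => D / be * expR (- (be * s))) (D / be * (- be * expR (- (be * x)))).
  have := is_deriveZ (D / be) (is_derive_expM (- be) x).
  have -> : (D / be \*: (fun s => expR (- be * s))) = (fun s => D / be * expR (- (be * s))).
    by apply/funext => z; rewrite /GRing.scale /= mulNr.
  by rewrite /GRing.scale /= !mulNr.
exists (d - D / be * (- be * expR (- (be * x)))); first exact: is_deriveB.
have -> : D / be * (- be * expR (- (be * x))) = - (D * expR (- (be * x))) by field; rewrite gt_eqF.
by move: db; rewrite ler_norml; lra.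
Qed.

(** Bisection of the interval, the second side being degenerate. *)
Lemma compact_bound (P : R -> R -> Prop) (a b : R) : a <= b ->
  (forall E E' s, E <= E' -> P E s -> P E' s) ->
  (forall t, exists2 r, 0 < r & exists E, forall s, `|s - t| < r -> P E s) ->
  exists E, forall s, a <= s <= b -> P E s.
Proof.
move=> ab mono loc.
apply: (@bisection R (fun a b _ _ => exists E, forall s, a <= s <= b -> P E s) a b 0 0) => //.
  move=> {ab}a {}b c d _ _ [E1 H1] [E2 H2] _ _; exists (Num.max E1 E2) => s /andP[sa sb].
  have [h|/ltW h] := leP s ((a + b) / 2).
    by apply: (mono E1); [rewrite le_max lexx|apply: H1; rewrite sa].
  by apply: (mono E2); [rewrite le_max lexx orbT|apply: H2; rewrite h].
move=> x y _ _; have [r r0 [E HE]] := loc x; exists r => // a' b' c' d' _ /andP[ax xb] _ _ _ _ ba _.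
by exists E => s /andP[sa sb]; apply: HE; rewrite ltr_norml; lra.
Qed.

Lemma ereal_cvg0_le (T : Type) (F : set_system T) (f : T -> \bar R) (m : R) : Filter F ->
  f x @[x --> F] --> 0%E -> 0 < m -> \forall x \near F, (f x <= m%:E)%E.
Proof.
move=> FF /fine_cvgP[fin /cvgrPdist_le/(_ m) H] m0; have {}H := H m0.
near=> x; have fx : f x \is a fin_num by near: x; exact: fin.
rewrite -(fineK fx) lee_fin; have : `|0 - fine (f x)| <= m by near: x; exact: H.
by rewrite sub0r normrN; exact: le_trans (ler_norm _).
Unshelve. all: by end_near.
Qed.
End Gronwall.

(** * Separation of the solitons at large times *)

Section Separation.
Variable R : realType.
Local Notation C := R[i].
Variables (n : nat) (al gamma : 'I_n -> C).
Hypothesis al_inj : forall j l, j != l -> al j != al l.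

(** The inverse of one plus the sum of all inverse distances is positive and below each distance; no
    minimum over pairs is taken, of which there are none for n = 1. Diagonal terms are 0^-1 = 0. *)
Lemma min_gap : exists2 d : R, 0 < d & forall j l, j != l -> d <= cabs (al j - al l).
Proof.
pose S : R := 1 + \sum_j \sum_l (cabs (al j - al l))^-1.
have i0 j l : 0 <= (cabs (al j - al l))^-1 by rewrite invr_ge0 cabs_ge0.
have S0 : 0 < S by rewrite ltr_wpDr // sumr_ge0 // => j _; apply: sumr_ge0.
exists S^-1; first by rewrite invr_gt0.
move=> j l jl; have c0 : 0 < cabs (al j - al l) by rewrite cabs_gt0 // subr_eq0 al_inj.
rewrite -[X in _ <= X]invrK lef_pV2 ?posrE ?invr_gt0 //.
have h1 : (cabs (al j - al l))^-1 <= \sum_l (cabs (al j - al l))^-1.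
  by rewrite (bigD1 l) //= lerDl sumr_ge0.
have h2 : \sum_l (cabs (al j - al l))^-1 <= \sum_j \sum_l (cabs (al j - al l))^-1.
  by rewrite [X in _ <= X](bigD1 j) //= lerDl sumr_ge0 // => i _; exact: sumr_ge0.
by rewrite /S; lra.
Qed.

(** Once any two distances rho_j, rho_l add up to at least 2n, at most one of them is below n; its
    term is at most 1, and the others are at most exp(-n) <= 1/n each. The bound 2 is independent of
    n, which makes the final constant universal. *)
Lemma soliton_separated : exists2 T : R, 0 <= T & forall t, T <= t -> forall z : C,
  \sum_j expR (- cabs (z + al j * t%:C - conjc (gamma j))) <= 2.
Proof.
have [d d0 gap] := min_gap.
pose G : R := \sum_j cabs (gamma j).
have gG j : cabs (gamma j) <= G.
  by rewrite /G (bigD1 j) //= lerDl sumr_ge0 // => i _; exact: cabs_ge0.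
have G0 : 0 <= G by apply: sumr_ge0 => j _; exact: cabs_ge0.
(* d t must exceed 2n by the displacement of two centres, at most 2G. *)
exists ((2 * n%:R + 2 * G) / d); first by rewrite divr_ge0 ?(ltW d0) // addr_ge0 // mulr_ge0.
move=> t; rewrite ler_pdivrMr // => ht z.
have t0 : 0 <= t.
  rewrite -(pmulr_lge0 _ d0); apply: le_trans ht.
  by rewrite addr_ge0 // mulr_ge0.
pose rho j := cabs (z + al j * t%:C - conjc (gamma j)).
have two j l : j != l -> 2 * n%:R <= rho j + rho l.
  move=> /gap jl.
  have : cabs ((al j - al l) * t%:C) <= rho j + rho l + (cabs (gamma j) + cabs (gamma l)).
    have -> : (al j - al l) * t%:C = (z + al j * t%:C - conjc (gamma j)) - (z + al l * t%:C - conjc (gamma l)) +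
      (conjc (gamma j) - conjc (gamma l)) by ring.
    apply: (le_trans (cabsD _ _)); apply: lerD; first exact: cabsBD.
    by apply: (le_trans (cabsBD _ _)); rewrite !cabs_conj.
  rewrite cabsM cabsR ger0_norm //; have := gG j; have := gG l.
  have := ler_wpM2r t0 jl; lra.
have small j : n%:R <= rho j -> expR (- rho j) <= (n%:R)^-1.
  move=> h; have n0 : 0 < n%:R :> R by rewrite ltr0n; exact: leq_ltn_trans (leq0n j) (ltn_ord j).
  rewrite expRN lef_pV2 ?posrE ?expR_gt0 //; have := expR_ge1Dx (rho j); lra.
have sum_small (P : pred 'I_n) : (forall j, P j -> n%:R <= rho j) -> \sum_(j | P j) expR (- rho j) <= 1.
  move=> HP; apply: (@le_trans _ _ (\sum_(j < n) (n%:R)^-1)).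
    rewrite big_mkcond; apply: ler_sum => j _; case: ifP => [/HP/small //|_].
    by rewrite invr_ge0.
  rewrite sumr_const card_ord -[_ *+ n]mulr_natr; have [->|n0] := eqVneq (n%:R : R) 0; first by rewrite mulr0.
  by rewrite mulVf.
have [[j0 hj0]|none] := pselect (exists j, rho j < n%:R).
  rewrite (bigD1 j0) //= (_ : 2 = 1 + 1 :> R); last by ring.
  apply: lerD; first by rewrite -[X in _ <= X]expR0 ler_expR oppr_le0 cabs_ge0.
  by apply: sum_small => j jj0; have := two j j0 jj0; lra.
apply: (@le_trans _ _ 1); last by lra.
apply: sum_small => j _; rewrite leNgt; apply/negP => h; apply: none; by exists j.
Qed.

(** By the triangle inequality |alpha_j| t <= rho + |z| + |gamma_j|: a point near a soliton is far
    from the origin, and one of the two weights is small. *)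
Lemma soliton_weighted (amin k t : R) (z : C) (j : 'I_n) : 0 <= k -> 0 <= t -> amin <= cabs (al j) ->
  expR (- (k * cabs (z + al j * t%:C - conjc (gamma j)))) * expR (- (k * cabs z)) <=
  expR (k * cabs (gamma j)) * expR (- (k * amin * t)).
Proof.
move=> k0 t0 ha; rewrite -!expRD ler_expR.
set rho := cabs (_ - _).
have : cabs (al j * t%:C) <= rho + cabs z + cabs (gamma j).
  have -> : al j * t%:C = (z + al j * t%:C - conjc (gamma j)) - z + conjc (gamma j) by ring.
  apply: (le_trans (cabsD _ _)); rewrite cabs_conj lerD2r; exact: cabsBD.
rewrite cabsM cabsR (ger0_norm t0) => h.
have h2 := ler_wpM2r t0 ha.
have := ler_wpM2l k0 (le_trans h2 h); lra.
Qed.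
End Separation.

(** * Vanishing of the energy *)

Section Main.
Variable R : realType.
Local Notation C := R[i].
Local Notation RxR := (measurableTypeR R * measurableTypeR R)%type.
Local Notation lebC := (@lebC R).

(** The constant of [gauss_entire_sup]. *)
Definition supC (k : R) : R := 9 * expR (4 + 3 * k).

Lemma supC_gt0 k : 0 < supC k.
Proof. by rewrite mulr_gt0 ?expR_gt0. Qed.

Lemma Xcontinuous_gauss_entire k (u : R -> C -> C) : Xcontinuous k u -> forall s, gauss_entire (u s).
Proof. by move=> [X _] s; apply: fock_gauss_entire; case: (X s). Qed.

(** Continuity bounds u s - u t in X^k for s near t; the pointwise bound is then applied to u s - u
    t and to u t. *)
Lemma Xcontinuous_bounded_near k (u : R -> C -> C) : 0 <= k -> Xcontinuous k u ->
  forall t, exists2 r : R, 0 < r & exists E, forall s, `|s - t| < r -> expdecay k E (u s).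
Proof.
move=> k0 Xu t; have gu := Xcontinuous_gauss_entire Xu; have [X cu] := Xu.
have [_ [_ nt]] := X t.
have n0 : (0 <= normX k (u t))%E by exact: Lnorm_ge0.
have ft : normX k (u t) \is a fin_num by rewrite ge0_fin_numE.
pose m := fine (normX k (u t)) + 1.
have m0 : 0 < m by rewrite ltr_wpDl // fine_ge0.
have bt : expdecay k (supC k * m) (u t).
  move=> z; apply: (gauss_entire_normX (gu t) k0 m0 _ z).
  by rewrite -(fineK ft) lee_fin lerDl.
have H1 := ereal_cvg0_le _ (cu t) ltr01.
have /nbhs_ballP[r /= r0 Hr] : nbhs t (fun s : R => (normX k (fun z => (u s z - u t z)%R) <= 1%:E)%E) by exact: H1.
exists r => //; exists (supC k * 1 + supC k * m) => s st z.
have -> : u s z = (u s z - u t z) + u t z by rewrite subrK.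
apply: (le_trans (cabsD _ _)); rewrite mulrDl; apply: lerD; last exact: bt.
apply: (gauss_entire_normX (gauss_entireB (gu s) (gu t)) k0 ltr01 _ z).
by apply: Hr; rewrite /ball /= distrC.
Qed.

Section Pair.
Variables (u v u' v' : R -> C -> C) (k : R).
Hypothesis k0 : 0 < k.
Hypotheses (Xu : Xcontinuous k u) (Xv : Xcontinuous k v).
Hypotheses (Xu' : Xcontinuous k u') (Xv' : Xcontinuous k v').
Hypotheses (sol : LLL_solution u v) (sol' : LLL_solution u' v').

Let gu := Xcontinuous_gauss_entire Xu.
Let gv := Xcontinuous_gauss_entire Xv.
Let gu' := Xcontinuous_gauss_entire Xu'.
Let gv' := Xcontinuous_gauss_entire Xv'.

Let mono4 E E' s : E <= E' ->
  [/\ expdecay k E (u s), expdecay k E (v s), expdecay k E (u' s) & expdecay k E (v' s)] ->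
  [/\ expdecay k E' (u s), expdecay k E' (v s), expdecay k E' (u' s) & expdecay k E' (v' s)].
Proof.
move=> EE [h1 h2 h3 h4]; split=> z.
- by apply: (le_trans (h1 z)); rewrite ler_wpM2r ?expR_ge0.
- by apply: (le_trans (h2 z)); rewrite ler_wpM2r ?expR_ge0.
- by apply: (le_trans (h3 z)); rewrite ler_wpM2r ?expR_ge0.
- by apply: (le_trans (h4 z)); rewrite ler_wpM2r ?expR_ge0.
Qed.

Lemma bounded_near_all t : exists2 r : R, 0 < r & exists E, decay_near u v u' v' k t r E.
Proof.
have k0' := ltW k0.
have [r1 r10 [E1 H1]] := Xcontinuous_bounded_near k0' Xu t.
have [r2 r20 [E2 H2]] := Xcontinuous_bounded_near k0' Xv t.
have [r3 r30 [E3 H3]] := Xcontinuous_bounded_near k0' Xu' t.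
have [r4 r40 [E4 H4]] := Xcontinuous_bounded_near k0' Xv' t.
exists (Num.min (Num.min r1 r2) (Num.min r3 r4)); first by rewrite !lt_min r10 r20 r30 r40.
pose E := Num.max (Num.max E1 E2) (Num.max E3 E4).
exists E => s; rewrite !lt_min => /andP[/andP[s1 s2] /andP[s3 s4]].
have up E' f : E' <= E -> expdecay k E' f -> expdecay k E f.
  by move=> EE h z; apply: (le_trans (h z)); rewrite ler_wpM2r ?expR_ge0.
split; [apply: up (H1 s s1)|apply: up (H2 s s2)|apply: up (H3 s s3)|apply: up (H4 s s4)];
  by rewrite /E !le_max lexx ?orbT.
Qed.

Let w1 s z := u' s z - u s z.
Let w2 s z := v' s z - v s z.
Let Y := diff_energy u v u' v'.

Lemma integrable_half_sqr (f : C -> C) E : measurableC f -> expdecay k E f ->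
  lebC.-integrable setT (EFin \o (fun p : RxR => cabs (f (toC p)) ^+ 2 / 2)).
Proof.
move=> mf bf.
apply: (le_integrableR (g := fun p : RxR => (E * E) * expR (- (k * cabs (toC p))))); last exact: expdecay_integrable.
  apply: measurable_funM; last exact: measurable_cst.
  by apply: measurable_funX; exact: mC_cabs_fun.
move=> p; rewrite ger0_norm; last by rewrite divr_ge0 // sqr_ge0.
have h1 := bf (toC p); have h2 := expdecay_le (toC p) (ltW k0) bf.
have := ler_pM (cabs_ge0 _) (cabs_ge0 _) h2 h1; rewrite -expr2.
have := sqr_ge0 (cabs (f (toC p))); lra.
Qed.

Let int_w s : [/\ lebC.-integrable setT (EFin \o (fun p : RxR => cabs (w1 s (toC p)) ^+ 2 / 2)) &
   lebC.-integrable setT (EFin \o (fun p : RxR => cabs (w2 s (toC p)) ^+ 2 / 2))].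
Proof.
have [r r0 [E H]] := bounded_near_all s.
have [bu bv bu' bv'] := H s ltac:(by rewrite subrr normr0).
have [mu _] := gu s; have [mv _] := gv s; have [mu' _] := gu' s; have [mv' _] := gv' s.
by split; [exact: integrable_half_sqr (mC_sub mu' mu) (expdecayB bu' bu)|
           exact: integrable_half_sqr (mC_sub mv' mv) (expdecayB bv' bv)].
Qed.

(** Since |w1| |w2| <= (|w1|^2 + |w2|^2) / 2, a sup bound on the bracket gives a majorant
    proportional to the energy density. *)
Lemma diff_energy_lipschitz t L :
  (forall z, (cabs (v' t z) + cabs (v t z)) * cabs (u t z) +
             (cabs (u' t z) + cabs (u t z)) * cabs (v t z) <= L) ->
  exists2 d, is_derive t 1 Y d & `|d| <= L * Y t.
Proof.
move=> HL; have [r r0 [E H]] := bounded_near_all t.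
have [d [yd Hd]] := diff_energy_derive k0 gu gv gu' gv' sol sol' r0 H.
exists d => //; have [i1 i2] := int_w t.
have L0 : 0 <= L by apply: le_trans (HL 0); rewrite addr_ge0 ?mulr_ge0 ?addr_ge0 ?cabs_ge0.
rewrite /Y /diff_energy /energy -RintegralD // -RintegralZl //; last exact: integrableR_add.
apply: Hd; first by apply: integrableR_Zl; exact: integrableR_add.
move=> p; rewrite -/(w1 t (toC p)) -/(w2 t (toC p)) mulrC.
have h : cabs (w1 t (toC p)) * cabs (w2 t (toC p)) <=
    cabs (w1 t (toC p)) ^+ 2 / 2 + cabs (w2 t (toC p)) ^+ 2 / 2.
  have := sqr_ge0 (cabs (w1 t (toC p)) - cabs (w2 t (toC p))); lra.
apply: ler_pM => //; first by rewrite addr_ge0 ?mulr_ge0 ?addr_ge0 ?cabs_ge0.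
by rewrite mulr_ge0 ?cabs_ge0.
Qed.

Lemma quad_le (x y x' y' E : R) : 0 <= x -> 0 <= y -> 0 <= x' -> 0 <= y' ->
  x <= E -> y <= E -> x' <= E -> y' <= E -> (y' + y) * x + (x' + x) * y <= 4 * E ^+ 2.
Proof. by move=> *; nra. Qed.

(** On a compact interval the local decay constants are uniform, so backward Gronwall applies with
    some finite rate, whatever its size. *)
Lemma diff_energy_backward a b : a <= b -> Y b = 0 -> Y a <= 0.
Proof.
move=> ab yb.
have [E HE] := @compact_bound R (fun E s => [/\ expdecay k E (u s), expdecay k E (v s),
   expdecay k E (u' s) & expdecay k E (v' s)]) a b ab mono4 bounded_near_all.
have H s : a <= s <= b -> exists2 d, is_derive s 1 Y d & `|d| <= (4 * E ^+ 2) * Y s.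
  move=> /HE[bu bv bu' bv']; apply: diff_energy_lipschitz => z; have k0' := ltW k0.
  apply: quad_le; rewrite ?cabs_ge0 //.
  - exact: expdecay_le k0' bu.
  - exact: expdecay_le k0' bv.
  - exact: expdecay_le k0' bu'.
  - exact: expdecay_le k0' bv'.
by have := gronwall_backward ab H; rewrite yb mul0r pmulr_lle0 // expR_gt0.
Qed.

(** A function with zero L^2 norm satisfies [gauss_entire_sup] with k = 0 for every m > 0, so it
    vanishes at every point and not merely almost everywhere. *)
Lemma diff_energy0 s : Y s <= 0 -> forall z, u' s z = u s z /\ v' s z = v s z.
Proof.
move=> Y0; have [i1 i2] := int_w s.
have e1 : 0 <= energy w1 s by apply: Rintegral_ge0 => p _; rewrite divr_ge0 // sqr_ge0.
have e2 : 0 <= energy w2 s by apply: Rintegral_ge0 => p _; rewrite divr_ge0 // sqr_ge0.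
have Ys : energy w1 s + energy w2 s <= 0 by exact: Y0.
have zero (f : C -> C) : gauss_entire f ->
    lebC.-integrable setT (EFin \o (fun p : RxR => cabs (f (toC p)) ^+ 2 / 2)) ->
    \int[lebC]_p (cabs (f (toC p)) ^+ 2 / 2) = 0 -> forall z, f z = 0.
  move=> gf fi f0 z; apply: cabs_eq0; apply/eqP; rewrite eq_le cabs_ge0 andbT.
  apply/ler_addgt0Pl => e e0'; rewrite addr0.
  have m0 : 0 < e / supC 0 by rewrite divr_gt0 // supC_gt0.
  have := gauss_entire_sup gf (lexx 0) m0 _ z; rewrite mul0r oppr0 expR0 mulr1 -/(supC 0).
  have -> : supC 0 * (e / supC 0) = e by field; rewrite gt_eqF // supC_gt0.
  apply.
  have E2 : (\int[lebC]_p (cabs (f (toC p)) ^+ 2 / 2)%:E = 0)%E.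
    by have ff := integrable_fin_num measurableT fi; rewrite -(fineK ff) -[fine _]/(\int[lebC]_p (cabs (f (toC p)) ^+ 2 / 2)) f0.
  apply: (@le_trans _ _ (2%:E * \int[lebC]_p (cabs (f (toC p)) ^+ 2 / 2)%:E)%E).
    rewrite -integralZl // le_eqVlt; apply/orP; left; apply/eqP; apply: eq_integral => p _.
    by rewrite mul0r expR0 mul1r -EFinM; congr (_%:E); field.
  by rewrite E2 mule0 lee_fin sqr_ge0.
have z1 : energy w1 s = 0 by lra.
have z2 : energy w2 s = 0 by lra.
move=> z; split; apply/eqP; rewrite -subr_eq0; apply/eqP.
  exact: (zero (w1 s) (gauss_entireB (gu' s) (gu s)) i1 z1 z).
exact: (zero (w2 s) (gauss_entireB (gv' s) (gv s)) i2 z2 z).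
Qed.

(* The decay beta of the energy beats its Lipschitz rate L. *)
Lemma uniqueness_of_decay (L D beta T : R) : L < beta -> 0 < beta ->
  (forall t z, T <= t -> (cabs (v' t z) + cabs (v t z)) * cabs (u t z) +
             (cabs (u' t z) + cabs (u t z)) * cabs (v t z) <= L) ->
  (forall t z, T <= t -> cabs (w1 t z) * cabs (w2 t z) *
     ((cabs (v' t z) + cabs (v t z)) * cabs (u t z) +
      (cabs (u' t z) + cabs (u t z)) * cabs (v t z)) <=
     D * expR (- (beta * t)) * expR (- (k * cabs z))) ->
  (forall e, 0 < e -> exists T', forall t, T' <= t -> expdecay k e (w1 t) /\ expdecay k e (w2 t)) ->
  forall t z, u' t z = u t z /\ v' t z = v t z.
Proof.
move=> Lb b0 HL HD Hw.
pose I := \int[lebC]_p expR (- (k * cabs (toC p))).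
have iI : lebC.-integrable setT (EFin \o (fun p : RxR => expR (- (k * cabs (toC p))))).
  by have := expdecay_integrable 1 k0; congr integrable; apply/funext => p; rewrite /= mul1r.
have I0 : 0 <= I by apply: Rintegral_ge0 => p _; exact: expR_ge0.
have decY s : T <= s -> exists2 d, is_derive s 1 Y d & `|d| <= D * I * expR (- (beta * s)).
  move=> Ts; have [r r0 [E H]] := bounded_near_all s.
  have [d [yd Hd]] := diff_energy_derive k0 gu gv gu' gv' sol sol' r0 H.
  exists d => //; have -> : D * I * expR (- (beta * s)) = D * expR (- (beta * s)) * I by ring.
  rewrite /I -RintegralZl //; apply: Hd; first exact: integrableR_Zl.
  by move=> p; exact: HD.
have Y0 e : 0 < e -> exists T', forall s, T' <= s -> Y s <= e.
  (* c <= 1 gives c^2 <= c, so each of the two energies is at most c I / 2. *)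
  move=> e0; have c0 : 0 < Num.min 1 (e / (I + 1)) by rewrite lt_min ltr01 divr_gt0 // ltr_wpDl.
  set c := Num.min _ _ in c0; have [T' HT'] := Hw c c0.
  exists T' => s /HT'[b1 b2]; have [i1 i2] := int_w s.
  have half (f : C -> C) : expdecay k c f ->
     lebC.-integrable setT (EFin \o (fun p : RxR => cabs (f (toC p)) ^+ 2 / 2)) ->
     \int[lebC]_p (cabs (f (toC p)) ^+ 2 / 2) <= c / 2 * I.
    move=> bf fi; rewrite /I -RintegralZl //; apply: le_Rintegral => //; first exact: integrableR_Zl.
    move=> p _; have h1 := bf (toC p); have h2 := expdecay_le (toC p) (ltW k0) bf.
    have h3 := ler_pM (cabs_ge0 _) (cabs_ge0 _) h2 h1; rewrite -expr2 in h3.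
    have c1 : c <= 1 by rewrite /c ge_min lexx.
    have : c * (c * expR (- (k * cabs (toC p)))) <= 1 * (c * expR (- (k * cabs (toC p)))).
      by rewrite ler_wpM2r // mulr_ge0 ?expR_ge0 // ltW.
    lra.
  have := lerD (half _ b1 i1) (half _ b2 i2); rewrite -/(energy w1 s) -/(energy w2 s) => h.
  apply: (le_trans h); have -> : c / 2 * I + c / 2 * I = c * I by field.
  have c2 : c <= e / (I + 1) by rewrite /c ge_min lexx orbT.
  apply: (le_trans (ler_wpM2r I0 c2)); rewrite mulrAC ler_pdivrMr ?ltr_wpDl // ler_pM2l //; lra.
have bnd := integrate_decay b0 decY Y0.
(* Y(t) exp(L t) <= Y(s) exp(L s) <= (D I / beta) exp(-(beta - L) s), where s is as large as
   desired. *)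
have YT t : T <= t -> Y t <= 0.
  move=> Tt; rewrite -(pmulr_lle0 _ (expR_gt0 (L * t))).
  apply/ler_addgt0Pl => e e0; rewrite addr0.
  have lb : 0 < beta - L by rewrite subr_gt0.
  have [T' _ HT'] := expR_small (D * I / beta) e0 lb.
  pose s := Num.max t T'; have ts : t <= s by rewrite /s le_max lexx.
  have T's : T' <= s by rewrite /s le_max lexx orbT.
  apply: le_trans (HT' s T's).
  have g : forall x, t <= x <= s -> exists2 d, is_derive x 1 Y d & `|d| <= L * Y x.
    by move=> x /andP[tx _]; apply: diff_energy_lipschitz => z; apply: HL; exact: le_trans Tt tx.
  apply: (le_trans (gronwall_backward ts g)).
  have := ler_wpM2r (expR_ge0 (L * s)) (bnd s (le_trans Tt ts)); rewrite -[X in _ <= X]mulrA -expRD.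
  by have -> : - (beta * s) + L * s = - ((beta - L) * s) by ring.
have Yge s : 0 <= Y s.
  by rewrite addr_ge0 //; apply: Rintegral_ge0 => p _; rewrite divr_ge0 // sqr_ge0.
move=> t; apply: diff_energy0; have [Tt|/ltW tT] := leP T t; first exact: YT.
by apply: (diff_energy_backward tT); apply/le_anti; rewrite YT // Yge.
Qed.
End Pair.
End Main.

(** * Large-time bounds on the solitons and the remainders *)

Section Remainders.
Variable R : realType.
Local Notation C := R[i].
Variables (n : nat) (K a b theta : 'I_n -> R) (gamma : 'I_n -> C).
Hypotheses (n0 : (0 < n)%N) (K0 : forall j, 0 < K j).
Hypothesis alpha_inj : forall j l, j != l -> alpha K theta j != alpha K theta l.

Let Ks : R := sup [set K j ^+ 2 | j in [set: 'I_n]].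
Let Ki : R := inf [set K j ^+ 2 | j in [set: 'I_n]].

Lemma sqr_le_sup j : K j ^+ 2 <= Ks.
Proof.
apply: ub_le_sup; last by exists j.
exists (\sum_j K j ^+ 2) => _ [i _ <-]; rewrite (bigD1 i) //= lerDl sumr_ge0 // => l _.
exact: sqr_ge0.
Qed.

Lemma inf_le_sqr j : Ki <= K j ^+ 2.
Proof. by apply: ge_inf; [exists 0 => _ [i _ <-]; exact: sqr_ge0|exists j]. Qed.

(** The inverse of the sum of the K_j^-2 is a positive lower bound. *)
Lemma inf_sqr_gt0 : 0 < Ki.
Proof.
pose S := \sum_j (K j ^+ 2)^-1; have p j : 0 < (K j ^+ 2)^-1 by rewrite invr_gt0 exprn_gt0.
have Sj j : (K j ^+ 2)^-1 <= S.
  by rewrite /S (bigD1 j) //= lerDl sumr_ge0 // => l _; exact: ltW.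
have S0 : 0 < S := lt_le_trans (p (Ordinal n0)) (Sj _).
apply: (@lt_le_trans _ _ S^-1); first by rewrite invr_gt0.
apply: lb_le_inf; first by exists (K (Ordinal n0) ^+ 2); exists (Ordinal n0).
by move=> _ [j _ <-]; rewrite -[X in _ <= X]invrK lef_pV2 ?posrE.
Qed.

Let amin : R := Num.sqrt 3 / (32 * pi) * Ki.

Let c32 : 0 < Num.sqrt 3 / (32 * pi) :> R.
Proof. by rewrite divr_gt0 ?sqrtr_gt0 // mulr_gt0 // pi_gt0. Qed.

Lemma amin_le j : amin <= cabs (alpha K theta j).
Proof. by rewrite cabs_alpha ler_pM2l // inf_le_sqr. Qed.

(** Decay rate 1 in the bound of a single profile gives the factor exp((1 + 1)^2 / 2) = e^2, and
    separation bounds the sum of the exponentials by 2. *)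
Lemma soliton_bounded : exists2 T : R, 0 <= T & forall (om : 'I_n -> R) W t z,
  profile K gamma W -> T <= t ->
  cabs (soliton_sum K theta om W t z) <= 2 * (expR 2 * Num.sqrt Ks).
Proof.
have [T T0 HT] := soliton_separated gamma alpha_inj; exists T => // om W t z PW Tt.
apply: (le_trans (cabs_soliton theta K0 om t z 1 PW)).
have -> : (1 + 1) ^+ 2 / 2 = 2 :> R by field.
apply: (@le_trans _ _ (\sum_(j < n) (expR 2 * Num.sqrt Ks) *
   expR (- cabs (z + alpha K theta j * t%:C - conjc (gamma j))))).
  apply: ler_sum => j _; rewrite mul1r mulrA [K j * _]mulrC ler_wpM2r ?expR_ge0 //.
  rewrite ler_wpM2l ?expR_ge0 // -[X in X <= _]ger0_norm ?(ltW (K0 j)) //.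
  by rewrite -sqrtr_sqr ler_wsqrtr // sqr_le_sup.
rewrite -mulr_sumr mulrC ler_wpM2r ?mulr_ge0 ?expR_ge0 ?sqrtr_ge0 //; exact: HT.
Qed.

Lemma soliton_weight_decay k : 0 <= k -> exists2 D : R, 0 <= D & forall (om : 'I_n -> R) W t z,
  profile K gamma W -> 0 <= t ->
  expR (- (k * cabs z)) * cabs (soliton_sum K theta om W t z) <= D * expR (- (k * amin * t)).
Proof.
move=> k0; exists (\sum_(j < n) K j * expR ((k + 1) ^+ 2 / 2) * expR (k * cabs (gamma j))).
  by apply: sumr_ge0 => j _; rewrite !mulr_ge0 ?expR_ge0 // ltW.
move=> om W t z PW t0.
apply: (le_trans (ler_wpM2l (expR_ge0 _) (cabs_soliton theta K0 om t z k PW))).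
rewrite mulr_sumr mulr_suml; apply: ler_sum => j _.
have h := soliton_weighted gamma z k0 t0 (amin_le j).
have KE : 0 <= K j * expR ((k + 1) ^+ 2 / 2) by rewrite mulr_ge0 ?expR_ge0 // ltW.
have := ler_wpM2l KE h; lra.
Qed.

(** The exponents differ by the square 2 (be / d - d t / 4)^2, so a Gaussian rate beats every
    exponential one. *)
Lemma gauss_le_expR (C0 d be t : R) : 0 <= C0 -> 0 < d ->
  C0 * expR (- (1 / 8 * d ^+ 2 * t ^+ 2)) <=
  C0 * expR (2 * be ^+ 2 / d ^+ 2) * expR (- (be * t)).
Proof.
move=> C00 d0; rewrite -[X in _ <= X]mulrA ler_wpM2l // -expRD ler_expR -subr_ge0.
have -> : 2 * be ^+ 2 / d ^+ 2 - be * t - - (1 / 8 * d ^+ 2 * t ^+ 2) =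
  2 * (be / d - d * t / 4) ^+ 2 by field; rewrite gt_eqF.
by rewrite mulr_ge0 // sqr_ge0.
Qed.

(** [alpha_sharp], possibly +oo, is replaced by a finite positive lower bound d, and monotonicity in
    the extended reals covers n = 1 as well. *)
Lemma gaussian_rate_decay (r1 r2 : R -> C -> C) kappa be :
  (exists2 C0 : R, 0 < C0 & forall t : R, 0 <= t ->
    (normX kappa (r1 t) + normX kappa (r2 t) <=
     C0%:E * expeR (- ((1 / 8)%:E * alpha_sharp K theta ^+ 2 * (t ^+ 2)%:E)))%E) ->
  exists2 D : R, 0 < D & forall t, 0 <= t ->
    (normX kappa (r1 t) + normX kappa (r2 t) <= (D * expR (- (be * t)))%:E)%E.
Proof.
move=> [C0 C00 H]; have [d d0 gap] := min_gap alpha_inj.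
exists (C0 * expR (2 * be ^+ 2 / d ^+ 2)); first by rewrite mulr_gt0 // expR_gt0.
move=> t t0; apply: (le_trans (H t t0)).
apply: (@le_trans _ _ (C0 * expR (- (1 / 8 * d ^+ 2 * t ^+ 2)))%:E); last first.
  by rewrite lee_fin; apply: gauss_le_expR => //; exact: ltW.
have da : (d%:E <= alpha_sharp K theta)%E.
  by apply: le_ereal_inf_tmp => _ [[j l] /= jl <-]; rewrite lee_fin; exact: gap.
rewrite [X in (_ <= X)%E]EFinM lee_pmul2l // ?lte_fin //.
rewrite -[(expR _)%:E]/(expeR (- (1 / 8 * d ^+ 2 * t ^+ 2))%:E) lee_expeR EFinN leeN2.
rewrite (EFinM (1 / 8 * d ^+ 2)) (EFinM (1 / 8)).
rewrite lee_wpmul2r ?lee_fin ?sqr_ge0 // lee_wpmul2l ?lee_fin //.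
by rewrite expe2 expr2 (EFinM d) lee_pmul // lee_fin ltW.
Qed.

End Remainders.

Section Remainder_bounds.
Variable R : realType.
Local Notation C := R[i].

Lemma normX_add_expdecay (f g : C -> C) (k m : R) : 0 <= k -> 0 < m ->
  gauss_entire f -> gauss_entire g -> (normX k f + normX k g <= m%:E)%E ->
  expdecay k (supC k * m) f /\ expdecay k (supC k * m) g.
Proof.
move=> k0 m0 gf gg H.
have f0 : (0 <= normX k f)%E by exact: Lnorm_ge0.
have g0 : (0 <= normX k g)%E by exact: Lnorm_ge0.
split=> z; apply: gauss_entire_normX => //; apply: le_trans H.
  exact: leeDl.
exact: leeDr.
Qed.

Lemma soliton_plus_weight (D E be k t : R) (W r u : C -> C) (z : C) : 0 <= k ->
  u z = W z + r z -> expdecay k (E * expR (- (be * t))) r ->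
  expR (- (k * cabs z)) * cabs (W z) <= D * expR (- (be * t)) ->
  expR (- (k * cabs z)) * cabs (u z) <= (D + E) * expR (- (be * t)).
Proof.
move=> k0 -> br hW; apply: (le_trans (ler_wpM2l (expR_ge0 _) (cabsD _ _))).
rewrite mulrDr [X in _ <= X]mulrDl; apply: lerD => //.
apply: le_trans (expdecay_le z k0 br); rewrite ler_piMl ?cabs_ge0 //.
by rewrite -expR0 ler_expR oppr_le0 mulr_ge0 ?cabs_ge0.
Qed.

(** Both differences carry the weight e. One copy turns x and y into quantities of size F, the other
    survives as the integrable factor. *)
Lemma weighted_quad_le (x y x' y' w1 w2 B F m e : R) :
  0 <= x -> 0 <= y -> 0 <= x' -> 0 <= y' -> 0 <= w1 -> 0 <= w2 -> 0 <= e ->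
  x <= B -> y <= B -> x' <= B -> y' <= B -> w1 <= m * e -> w2 <= m * e ->
  e * x <= F -> e * y <= F ->
  w1 * w2 * ((y' + y) * x + (x' + x) * y) <= m ^+ 2 * (4 * B * F) * e.
Proof.
move=> x0 y0 x'0 y'0 w10 w20 e0 xB yB x'B y'B h1 h2 hx hy.
have hw := ler_pM w10 w20 h1 h2.
have a1 : (y' + y) * (e * x) <= (B + B) * F.
  by apply: ler_pM => //; [exact: addr_ge0|exact: mulr_ge0|exact: lerD].
have a2 : (x' + x) * (e * y) <= (B + B) * F.
  by apply: ler_pM => //; [exact: addr_ge0|exact: mulr_ge0|exact: lerD].
have q0 : 0 <= (y' + y) * x + (x' + x) * y by rewrite addr_ge0 // mulr_ge0 // addr_ge0.
apply: (le_trans (ler_wpM2r q0 hw)).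
have -> : m * e * (m * e) * ((y' + y) * x + (x' + x) * y) =
  m ^+ 2 * e * ((y' + y) * (e * x) + (x' + x) * (e * y)) by ring.
have -> : m ^+ 2 * (4 * B * F) * e = m ^+ 2 * e * ((B + B) * F + (B + B) * F) by ring.
by apply: ler_wpM2l; [rewrite mulr_ge0 // sqr_ge0|exact: lerD].
Qed.

End Remainder_bounds.

(** * Choice of the constants and conclusion *)

Theorem theorem1p5 (R : realType) :
  exists2 c0 : R, 0 < c0 &
  forall (n : nat) (K a b theta : 'I_n -> R) (gamma : 'I_n -> R[i]),
    (1 <= n)%N ->
    (forall j, 0 < K j) ->
    (forall j l, j != l -> alpha K theta j != alpha K theta l) ->
  forall kappa : R, c0 * delta K < kappa ->
  forall u v : R -> R[i] -> R[i],
    gaussian_multisoliton K a b theta gamma kappa u v ->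
  forall u' v' : R -> R[i] -> R[i],
    Xcontinuous kappa u' -> Xcontinuous kappa v' ->
    LLL_solution u' v' ->
    (exists r1 r2 : R -> R[i] -> R[i],
       has_remainders K a b theta gamma u' v' r1 r2 /\
       (normX kappa (r1 t) + normX kappa (r2 t))%E @[t --> +oo] --> 0%E) ->
  forall (t : R) (z : R[i]), u' t z = u t z /\ v' t z = v t z.
Proof.
have s3 : 0 < Num.sqrt 3 :> R by rewrite sqrtr_gt0.
have p32 : 0 < 32 * pi :> R by rewrite mulr_gt0 // pi_gt0.
(* 36 e^4 is the ratio of L to max K_j^2, and 32 pi / sqrt 3 that of K_j^2 to |alpha_j|. *)
have c00 : 0 < 36 * expR 2 ^+ 2 * (32 * pi / Num.sqrt 3) :> R.
  by rewrite mulr_gt0 ?divr_gt0 // mulr_gt0 // exprn_gt0 // expR_gt0.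
exists (36 * expR 2 ^+ 2 * (32 * pi / Num.sqrt 3)) => // n K a b theta gamma n0 K0 inj k hk.
move=> u v [sXu sXv sol [r1 [r2 [rem dec]]]] u' v' Xu' Xv' sol' [r1' [r2' [rem' cv]]].
have Xu : Xcontinuous k u := (sXu 0%N).1.
have Xv : Xcontinuous k v := (sXv 0%N).1.
pose Ks : R := sup [set K j ^+ 2 | j in [set: 'I_n]].
pose Ki : R := inf [set K j ^+ 2 | j in [set: 'I_n]].
have Ki0 : 0 < Ki := inf_sqr_gt0 n0 K0.
have Ks0 : 0 < Ks.
  apply: lt_le_trans (sqr_le_sup K (Ordinal n0)); exact: exprn_gt0.
have k0 : 0 < k by apply: lt_trans hk; rewrite mulr_gt0 // divr_gt0.
(* For large t each component is bounded by 3m: 2m for the solitons, whose weights add up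
   to at most 2 once they are separated, and m for the remainder. *)
pose m := expR 2 * Num.sqrt Ks.
have m0 : 0 < m by rewrite mulr_gt0 ?expR_gt0 // sqrtr_gt0.
have mE : 4 * (3 * m) ^+ 2 = 36 * expR 2 ^+ 2 * Ks.
  by rewrite /m !exprMn sqr_sqrtr ?ltW //; ring.
pose be := k * (Num.sqrt 3 / (32 * pi) * Ki).
have Lbe : 4 * (3 * m) ^+ 2 < be.
  rewrite mE /be -ltr_pdivrMr; last by rewrite mulr_gt0 ?divr_gt0.
  have fld (A x y r p : R) : y != 0 -> r != 0 -> p != 0 -> A * x / (r / p * y) = A * (p / r) * (x / y).
    by move=> *; field; apply/and3P.
  by apply: le_lt_trans hk; rewrite /delta -/Ks -/Ki fld ?gt_eqF.
have be0 : 0 < be by apply: le_lt_trans Lbe; rewrite mulr_ge0 // sqr_ge0.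
have pU := profileU_profile K a theta gamma; have pV := profileV_profile K b theta gamma.
(* A remainder is the difference of a solution and a soliton sum, both a Gaussian times an entire
   function, so its weighted L^2 bounds become pointwise. *)
have ent (w r : R -> R[i] -> R[i]) om W : profile K gamma W -> Xcontinuous k w ->
    (forall t z, w t z = soliton_sum K theta om W t z + r t z) -> forall t, gauss_entire (r t).
  move=> PW Xw E t.
  have := gauss_entireB (Xcontinuous_gauss_entire Xw t) (gauss_entire_soliton theta om t PW).
  by congr gauss_entire; apply/funext => z; rewrite E addrAC subrr add0r.
have uE t z := (rem t z).1; have vE t z := (rem t z).2.
have uE' t z := (rem' t z).1; have vE' t z := (rem' t z).2.
have g1 := ent _ _ _ _ pU Xu uE; have g2 := ent _ _ _ _ pV Xv vE.
have g1' := ent _ _ _ _ pU Xu' uE'; have g2' := ent _ _ _ _ pV Xv' vE'.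
have [Dr Dr0 HDr] : exists2 D : R, 0 < D & forall t, 0 <= t ->
    (normX k (r1 t) + normX k (r2 t) <= (D * expR (- (be * t)))%:E)%E.
  (* 1/8 is a positive rate below 1/4; m = 0 concerns the remainders themselves. *)
  apply: (gaussian_rate_decay inj); apply: (dec (1 / 8) 0%N); lra.
have fast t : 0 <= t -> expdecay k (supC k * Dr * expR (- (be * t))) (r1 t) /\
    expdecay k (supC k * Dr * expR (- (be * t))) (r2 t).
  move=> t0; rewrite -mulrA; apply: normX_add_expdecay (HDr t t0) => //; first exact: ltW.
  by rewrite mulr_gt0 ?expR_gt0.
have small e : 0 < e -> exists2 T, 0 <= T & forall t, T <= t ->
    [/\ expdecay k e (r1 t), expdecay k e (r2 t), expdecay k e (r1' t) & expdecay k e (r2' t)].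
  move=> e0; have [T1 T10 H1] := expR_small (supC k * Dr) e0 be0.
  have e1 : 0 < e / supC k by rewrite divr_gt0 // supC_gt0.
  have [T2 [_ H2]] := ereal_cvg0_le _ cv e1.
  (* The neighbourhood of +oo supplies its bound only for times strictly beyond T2. *)
  exists (Num.max T1 (T2 + 1)); first by rewrite le_max T10.
  move=> t; rewrite ge_max => /andP[t1 t2].
  have [b1 b2] := fast t (le_trans T10 t1).
  have := normX_add_expdecay (ltW k0) e1 (g1' t) (g2' t) (H2 t ltac:(lra)).
  have -> : supC k * (e / supC k) = e by field; rewrite gt_eqF // supC_gt0.
  move=> [b1' b2']; split=> // z; [apply: (le_trans (b1 z))|apply: (le_trans (b2 z))];
    by rewrite ler_wpM2r ?expR_ge0 // H1.
have [T1 T10 HT1] := soliton_bounded gamma K0 inj.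
have [T2 T20 HT2] := small m m0.
have [Ds Ds0 HDs] := soliton_weight_decay theta gamma K0 (ltW k0).
have ubd (w r : R -> R[i] -> R[i]) om W t z : profile K gamma W -> Num.max T1 T2 <= t ->
    w t z = soliton_sum K theta om W t z + r t z -> expdecay k m (r t) -> cabs (w t z) <= 3 * m.
  rewrite ge_max => PW /andP[t1 _] -> br; apply: (le_trans (cabsD _ _)).
  have := HT1 om W t z PW t1; rewrite -/m; have := expdecay_le z (ltW k0) br; lra.
have all t z : Num.max T1 T2 <= t -> [/\ cabs (u t z) <= 3 * m, cabs (v t z) <= 3 * m,
     cabs (u' t z) <= 3 * m & cabs (v' t z) <= 3 * m].
  move=> Tt; have /HT2[b1 b2 b1' b2'] : T2 <= t by move: Tt; rewrite ge_max => /andP[].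
  split; [exact: ubd pU Tt (uE t z) b1|exact: ubd pV Tt (vE t z) b2|
          exact: ubd pU Tt (uE' t z) b1'|exact: ubd pV Tt (vE' t z) b2'].
(* The two solutions share the same soliton sum, so it cancels and only the remainders are left. *)
have dif (x x' y y' s : R[i] -> R[i]) e z : 
    x z = s z + y z -> x' z = s z + y' z -> expdecay k e y -> expdecay k e y' ->
    cabs (x' z - x z) <= (e + e) * expR (- (k * cabs z)).
  move=> -> -> h h'; rewrite opprD addrACA subrr add0r.
  by apply: (le_trans (cabsBD _ _)); rewrite mulrDl lerD.
apply: (@uniqueness_of_decay R u v u' v' k k0 Xu Xv Xu' Xv' sol sol' (4 * (3 * m) ^+ 2)
  ((m + m) ^+ 2 * (4 * (3 * m) * (Ds + supC k * Dr))) be (Num.max T1 T2)) => //.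
- by move=> t z /(all t z)[h1 h2 h3 h4]; apply: quad_le; rewrite ?cabs_ge0.
- move=> t z Tt; have [h1 h2 h3 h4] := all t z Tt.
  have t0 : 0 <= t by apply: le_trans Tt; rewrite le_max T10.
  have [f1 f2] := fast t t0.
  have /HT2[b1 b2 b1' b2'] : T2 <= t by move: Tt; rewrite ge_max => /andP[].
  have W1 := soliton_plus_weight (u := u t) (ltW k0) (uE t z) f1 (HDs _ _ t z pU t0).
  have W2 := soliton_plus_weight (u := v t) (ltW k0) (vE t z) f2 (HDs _ _ t z pV t0).
  have d1 := dif (u t) (u' t) _ _ _ _ z (uE t z) (uE' t z) b1 b1'.
  have d2 := dif (v t) (v' t) _ _ _ _ z (vE t z) (vE' t z) b2 b2'.
  apply: le_trans (weighted_quad_le (cabs_ge0 _) (cabs_ge0 _) (cabs_ge0 _) (cabs_ge0 _)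
    (cabs_ge0 _) (cabs_ge0 _) (expR_ge0 _) h1 h2 h3 h4 d1 d2 W1 W2) _.
  by rewrite le_eqVlt; apply/orP; left; apply/eqP; ring.
- move=> e e0; have e2 : 0 < e / 2 by rewrite divr_gt0.
  have [T _ HT] := small _ e2; exists T => t /HT[b1 b2 b1' b2'].
  have E2 : e / 2 + e / 2 = e by field.
  split=> z; rewrite -E2; first exact: dif (uE t z) (uE' t z) b1 b1'.
  exact: dif (vE t z) (vE' t z) b2 b2'.
Qed.
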